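(* Let $p>1$ and fix $k\in\mathbb{R}$. Consider the eigenvalue problem of finding $\lambda\in\mathbb{R}$ and $0\neq u\in W_0^{1,p}(0,1)$ such that $$k^2\int_0^1|\nabla_k u|^{p-2}uv\,dx+\int_0^1|\nabla_k u|^{p-2}u'v'\,dx=\lambda\int_0^1|u|^{p-2}uv\,dx\quad\text{for all }v\in W_0^{1,p}(0,1),\qquad (\ast)$$ where $|\nabla_k u|=(k^2u^2+u'^2)^{1/2}$. Then: (a) There exists an infinite sequence of eigenvalues $\lambda_n(k)$, $n\ge 1$, of problem $(\ast)$, arranged as $$0<\lambda_1(k)<\lambda_2(k)\le\dots\le\lambda_n(k)\le\dots,\qquad \lambda_n(k)\to+\infty\ \text{ as } n\to\infty.$$ (b) $0<\lambda_1(\Delta_p)\le\lambda_1(k)$ and $|k|^p\le\lambda_1(k)$, where $\lambda_1(\Delta_p)$ denotes the first eigenvalue of the one-dimensional $p$-Laplacian problem $-(|u'|^{p-2}u')'=\lambda|u|^{p-2}u$ in $(0,1)$, $u(0)=u(1)=0$. (c) $\lambda_1(k)$ is simple and isolated, and $\lambda_2(k)$ is the second eigenvalue of problem $(\ast)$.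
   Context: All functions are real-valued. For $k\in\mathbb{R}$ and $u\in W_0^{1,p}(0,1)$, $\nabla_k u:=(ku,u')$, so $|\nabla_k u|=(k^2u^2+u'^2)^{1/2}$. An eigenvalue of $(\ast)$ is a real $\lambda$ for which there is a nonzero $u\in W_0^{1,p}(0,1)$ (an eigenfunction) satisfying $(\ast)$. The $p$-Laplacian problem in (b) is understood in the same weak sense (it is the case $k=0$ of $(\ast)$), and its first eigenvalue is $\lambda_1(\Delta_p)=\inf_{0\ne u\in W_0^{1,p}(0,1)}\int_0^1|u'|^p\,dx\big/\int_0^1|u|^p\,dx$. An eigenvalue is simple if its eigenfunctions are all scalar multiples of a single one; it is isolated if some neighbourhood of it contains no other eigenvalue. ''Second eigenvalue'' means the smallest eigenvalue strictly larger than the first (smallest) eigenvalue $\lambda_1(k)$, i.e. there is no eigenvalue of $(\ast)$ below $\lambda_1(k)$ or strictly between $\lambda_1(k)$ and $\lambda_2(k)$. *)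

(* Defs.v *)
From mathcomp Require Import all_boot all_order all_algebra.
From mathcomp Require Import all_classical all_reals all_analysis.

Set Implicit Arguments.
Unset Strict Implicit.
Unset Printing Implicit Defensive.

Import Order.TTheory GRing.Theory Num.Theory.
Import numFieldNormedType.Exports.

Local Open Scope classical_set_scope.
Local Open Scope ring_scope.

(* Functions on (0,1) are represented by total functions R -> R, of which only
   the restriction to `]0, 1[ matters. *)

Definition I01 (R : realType) : set R := `]0, 1[%classic.
Arguments I01 {R}.

Definition int01 (R : realType) (f : R -> R) : R :=
  \int[lebesgue_measure]_(x in I01) f x.

Definition ae_eq01 (R : realType) (f g : R -> R) : Prop :=
  {ae (@lebesgue_measure R), forall x, I01 x -> f x = g x}.

Definition Lp01 (R : realType) (p : R) (f : R -> R) : Prop :=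
  measurable_fun I01 f /\
  (@lebesgue_measure R).-integrable I01 (fun x => (`|f x| `^ p)%:E).

(* The class C^1_c(0,1) and the spaces W^{1,p}(0,1), W_0^{1,p}(0,1) follow
   Brezis, Functional Analysis, Sobolev Spaces and PDE, Chapter 8: weak
   derivatives are tested against C^1_c(0,1), and W_0^{1,p}(0,1) is the
   closure of C^1_c(0,1) in W^{1,p}(0,1).  Since a weak derivative is only
   determined almost everywhere, an element of these spaces is presented
   together with a representative [du] of its weak derivative. *)

Definition C1c01 (R : realType) (f : R -> R) : Prop :=
  [/\ forall x, derivable f x 1, continuous (derive1 f) &
      exists a b : R, [/\ 0 < a, b < 1 & forall x, ~~ (a <= x <= b) -> f x = 0]].

Definition weak_derivative01 (R : realType) (u du : R -> R) : Prop :=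
  forall phi : R -> R, C1c01 phi ->
    int01 (fun x => u x * derive1 phi x) = - int01 (fun x => du x * phi x).

Definition W1p (R : realType) (p : R) (u du : R -> R) : Prop :=
  [/\ Lp01 p u, Lp01 p du & weak_derivative01 u du].

Definition W1p_norm (R : realType) (p : R) (u du : R -> R) : R :=
  (int01 (fun x => `|u x| `^ p) + int01 (fun x => `|du x| `^ p)) `^ p^-1.

Definition W01p (R : realType) (p : R) (u du : R -> R) : Prop :=
  W1p p u du /\
  forall e : R, 0 < e -> exists2 phi : R -> R, C1c01 phi &
    W1p_norm p (fun x => phi x - u x) (fun x => derive1 phi x - du x) < e.

Definition grad_norm (R : realType) (k : R) (u du : R -> R) (x : R) : R :=
  Num.sqrt (k ^+ 2 * u x ^+ 2 + du x ^+ 2).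

(* For p < 2 the powers below may be taken at 0, where [powR] has the value 0;
   there the factors u, u' vanish as well, so each flux |s|^(p-2) s has its
   usual value 0. *)
Definition weak_solution (R : realType) (p k lambda : R) (u du : R -> R) : Prop :=
  forall v dv : R -> R, W01p p v dv ->
    k ^+ 2 * int01 (fun x => grad_norm k u du x `^ (p - 2) * u x * v x)
      + int01 (fun x => grad_norm k u du x `^ (p - 2) * du x * dv x)
    = lambda * int01 (fun x => `|u x| `^ (p - 2) * u x * v x).

Definition is_eigenfunction (R : realType) (p k lambda : R) (u : R -> R) : Prop :=
  ~ ae_eq01 u (cst 0) /\
  exists2 du : R -> R, W01p p u du & weak_solution p k lambda u du.

Definition is_eigenvalue (R : realType) (p k lambda : R) : Prop :=
  exists u : R -> R, is_eigenfunction p k lambda u.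

Definition simple_eigenvalue (R : realType) (p k lambda : R) : Prop :=
  exists2 u0 : R -> R, is_eigenfunction p k lambda u0 &
    forall u : R -> R, is_eigenfunction p k lambda u ->
      exists c : R, ae_eq01 u (fun x => c * u0 x).

Definition isolated_eigenvalue (R : realType) (p k lambda : R) : Prop :=
  is_eigenvalue p k lambda /\
  \forall mu \near lambda, is_eigenvalue p k mu -> mu = lambda.

Definition first_eigenvalue (R : realType) (p k lambda : R) : Prop :=
  is_eigenvalue p k lambda /\
  forall mu : R, is_eigenvalue p k mu -> lambda <= mu.

Definition second_eigenvalue (R : realType) (p k lambda1 lambda2 : R) : Prop :=
  [/\ first_eigenvalue p k lambda1, is_eigenvalue p k lambda2, lambda1 < lambda2 &
      forall mu : R, is_eigenvalue p k mu -> lambda1 < mu -> lambda2 <= mu].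

Definition lambda1_pLaplacian (R : realType) (p : R) : R :=
  inf [set q : R | exists u du : R -> R,
    [/\ W01p p u du, ~ ae_eq01 u (cst 0) &
        q = int01 (fun x => `|du x| `^ p) / int01 (fun x => `|u x| `^ p)]].

(* Main.v *)
(* Let P(q) = (k^2 + q^2)^((p-2)/2) q ([nflux]), an increasing bijection of R
   with inverse Q ([nslope]), let L(q) = (k^2 + q^2)^(p/2) / p and
   N(z) = p (z Q(z) - L(Q(z))) ([hamil]), so that N' = p Q and
   min N = N(0) = - |k|^p.  Between two consecutive zeros of a solution u, the
   quotient z = |grad_k u|^(p-2) u' / (|u|^(p-2) u) satisfies u' = Q(z) u and the
   autonomous equation z' = - (lambda + N z), along which |u|^p (lambda + N z) is
   constant.  Testing the equation with u gives lambda > |k|^p, so z decreases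
   from +oo to -oo and every nodal interval has the same length
   T(lambda) = \int_R dz / (lambda + N z) ([period]); the flux does not vanish at
   the zeros, which are therefore isolated, and u is determined up to a factor on
   each nodal interval.  Hence lambda is an eigenvalue iff lambda > |k|^p and
   n T(lambda) = 1 for some n >= 1, the converse by gluing n arches of alternating
   sign.  Since T is continuous and strictly decreasing, takes a value >= 1 and
   tends to 0, the eigenvalues are exactly the lambda_n with T(lambda_n) = 1/n.
   The lemma of du Bois-Reymond gives weak solutions enough regularity for this
   argument, and the lower bounds of (b) follow from |u'| <= |grad_k u| and a
   Poincare inequality. *)

Require Import Defs.
From mathcomp Require Import all_boot all_order all_algebra.
From mathcomp Require Import all_classical all_reals all_analysis.
From mathcomp Require Import measurable_realfun.
From mathcomp Require Import ring lra.

Set Implicit Arguments.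
Unset Strict Implicit.
Unset Printing Implicit Defensive.

Import Order.TTheory GRing.Theory Num.Theory.
Import numFieldNormedType.Exports.

Local Open Scope classical_set_scope.
Local Open Scope ring_scope.

(** * Derivatives and powers *)

(** The obstacle is low regularity. For k = 0 and p > 2 the function Q has an infinite derivative at
    0, so u' need not be differentiable and N need not have a second derivative. N is treated as p
    times the Legendre transform of L: its subgradient inequalities and the mere continuity of Q
    give N' = p Q. At a zero of u the quotient z is infinite, and no uniqueness theorem for initial
    value problems is invoked; the limits of the phase and of the conserved quantity at the ends of
    a nodal interval replace it. The properties of T are read off the phase functions: their
    differences are monotone in z, with known limits at both ends. T takes values >= 1 because on
    [0, 1] the sum lam + N exceeds lam - |k|^p by at most a multiple of z, which makes T grow at
    least logarithmically as lam decreases to |k|^p. In the Sobolev part, elementary inequalities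
    between powers replace Hölder's inequality, and test functions are used only through L^1
    approximation of a function and of its derivative. *)

Section calculus.
Context {R : realType}.
Implicit Types (f g : R -> R) (x y d : R).

(** Serves derivatives that come from estimates and not from differentiation rules: those of N, of y
    |y|, of a function differentiable off one point, and of primitives of integrable functions. *)
Lemma is_derive_eps f x d :
  (forall e, 0 < e -> \forall y \near x, `|f y - f x - d * (y - x)| <= e * `|y - x|) ->
  is_derive x 1 f d.
Proof.
move=> H.
have C : h^-1 *: (f (h *: 1 + x) - f x) @[h --> 0^'] --> d.
  apply/cvgrPdist_le => e e0.
  have /nbhs_ballP[r /= r0 hr] := H e e0.
  apply/nbhs_ballP; exists r => //= h.
  rewrite /ball/= sub0r normrN => hr0 hn0.
  have := hr (h + x); rewrite /ball/= opprD addrCA subrr addr0 normrN => /(_ hr0).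
  rewrite addrK scaler1 => Hh.
  rewrite -(ler_pM2r (_ : 0 < `|h|)) ?normr_gt0// -normrM.
  rewrite (_ : (d - h^-1 *: (f (h + x) - f x)) * h = - (f (h + x) - f x - d * h)) ?normrN//.
  by rewrite /GRing.scale/=; field.
apply: DeriveDef; first by apply/cvg_ex; exists d.
by rewrite /derive; apply/cvg_lim.
Qed.

Lemma is_derive_cont f x d : is_derive x 1 f d -> {for x, continuous f}.
Proof. by move=> [/derivable1_diffP/differentiable_continuous]. Qed.

Lemma cvg_powR (T : Type) (F : set_system T) {FF : Filter F} (g : T -> R) (l a : R) :
  0 < a -> (forall t, 0 <= g t) -> 0 <= l -> g t @[t --> F] --> l ->
  g t `^ a @[t --> F] --> l `^ a.
Proof.
move=> a0 g0; rewrite le_eqVlt => /predU1P[<-|l0] gl; last first.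
  have /is_derive_cont c := is_derive1_powR a l0.
  exact: (cvg_comp _ _ gl c).
rewrite powR0 ?gt_eqF//.
apply/cvgr0Pnorm_lt => e e0; move/cvgr0Pnorm_lt : gl => /(_ (e `^ a^-1)).
rewrite powR_gt0// => /(_ isT); apply: filterS => t.
rewrite !ger0_norm ?powR_ge0// => h.
have := gt0_ltr_powR a0 (g0 t) (powR_ge0 e a^-1) h.
by rewrite -powRrM mulVf ?gt_eqF// powRr1// ltW.
Qed.

(** At a = 0 both sides vanish whatever the value of the power there, so the identity applies also
    at zeros of u and of its gradient. *)
Lemma powRM2 (a p : R) : 0 < p -> 0 <= a -> a `^ (p - 2) * a ^+ 2 = a `^ p.
Proof.
move=> p0; rewrite le_eqVlt => /predU1P[<-|a0].
  by rewrite expr2 mulr0 mulr0 powR0// gt_eqF.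
by rewrite -powR_mulrn ?ltW// -powRD ?subrK// (gt_eqF a0) implybT.
Qed.

Lemma powRM1 (a p : R) : 1 < p -> 0 <= a -> a `^ (p - 2) * a = a `^ (p - 1).
Proof.
move=> p1; rewrite le_eqVlt => /predU1P[<-|a0].
  by rewrite mulr0 powR0// gt_eqF// subr_gt0.
rewrite -[X in _ * X]powRr1 ?ltW// -powRD ?(gt_eqF a0) ?implybT//.
by congr (_ `^ _); ring.
Qed.

Lemma powRM11 (a p : R) : 1 < p -> 0 <= a -> a `^ (p - 1) * a = a `^ p.
Proof. by move=> p1 a0; rewrite mulrC mulr_powRB1//; lra. Qed.

End calculus.

Section norm.
Context {R : realType}.
Implicit Types (k a b c : R).

(* [grad_norm k u du x] is convertible to [gradn k (u x) (du x)]. *)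
Definition gradn k a b := Num.sqrt (k ^+ 2 * a ^+ 2 + b ^+ 2).

Lemma gradn_arg_ge0 k a b : 0 <= k ^+ 2 * a ^+ 2 + b ^+ 2.
Proof. by apply: addr_ge0; [apply: mulr_ge0|]; exact: sqr_ge0. Qed.

Lemma gradn_ge0 k a b : 0 <= gradn k a b.
Proof. exact: sqrtr_ge0. Qed.

Lemma gradn_sq k a b : gradn k a b ^+ 2 = k ^+ 2 * a ^+ 2 + b ^+ 2.
Proof. by rewrite sqr_sqrtr// gradn_arg_ge0. Qed.

Lemma gradnM k a b c : 0 <= c -> gradn k (c * a) (c * b) = c * gradn k a b.
Proof.
move=> c0; rewrite /gradn !exprMn mulrCA -mulrDr sqrtrM ?sqr_ge0//.
by rewrite sqrtr_sqr ger0_norm.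
Qed.

Lemma gradnN k a b : gradn k (- a) (- b) = gradn k a b.
Proof. by rewrite /gradn !sqrrN. Qed.

Lemma gradnNr k a b : gradn k a (- b) = gradn k a b.
Proof. by rewrite /gradn sqrrN. Qed.

Lemma le_gradn_snd k a b : `|b| <= gradn k a b.
Proof.
rewrite -[leLHS](ger0_norm (normr_ge0 b)) -sqrtr_sqr real_normK ?num_real//.
by rewrite ler_wsqrtr// lerDr mulr_ge0 ?sqr_ge0.
Qed.

Lemma le_gradn_fst k a b : `|k| * `|a| <= gradn k a b.
Proof.
by rewrite -normrM -sqrtr_sqr exprMn ler_wsqrtr// lerDl sqr_ge0.
Qed.

Lemma gradn_le k a b : gradn k a b <= `|k| * `|a| + `|b|.
Proof.
rewrite -(@ler_pXn2r _ 2)// ?nnegrE ?gradn_ge0 ?addr_ge0 ?mulr_ge0// gradn_sq.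
rewrite -(real_normK (num_real a)) -(real_normK (num_real b)) -(real_normK (num_real k)).
have := normr_ge0 a; have := normr_ge0 b; have := normr_ge0 k.
by move: `|a| `|b| `|k| => x y z *; have := mulr_ge0 (mulr_ge0 (_ : 0 <= z) (_ : 0 <= x)) (_ : 0 <= y); nra.
Qed.

Lemma cvg_gradn (T : Type) (F : set_system T) {FF : Filter F} k (f g : T -> R) a b :
  f t @[t --> F] --> a -> g t @[t --> F] --> b ->
  gradn k (f t) (g t) @[t --> F] --> gradn k a b.
Proof.
move=> fa gb; apply: (cvg_comp _ Num.sqrt); last exact: sqrt_continuous.
by apply: cvgD; [apply: cvgM; [exact: cvg_cst|exact: (cvgM fa fa)]|exact: (cvgM gb gb)].
Qed.

End norm.

(** * The flux and its Legendre dual *)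

Section flux.
Context {R : realType}.
Variables (p k : R).
Hypothesis p1 : 1 < p.
Implicit Types (a b q z : R).

Let p0 : 0 < p. Proof. exact: lt_trans p1. Qed.
Let p10 : 0 < p - 1. Proof. by rewrite subr_gt0. Qed.

Definition nflux q := gradn k 1 q `^ (p - 2) * q.

Lemma nfluxN q : nflux (- q) = - nflux q.
Proof. by rewrite /nflux /gradn sqrrN mulrN. Qed.

(** With g the norm of (k, q), P(q) = g^(p-1) (q / g); for q >= 0 the first factor increases
    strictly and the second does not decrease. This form works for both signs of p - 2. *)
Lemma nflux_inc0 a b : 0 <= a -> a < b -> nflux a < nflux b.
Proof.
move=> a0 ab; have b0 : 0 < b by exact: le_lt_trans ab.
have B0 : 0 < gradn k 1 b.
  by apply: lt_le_trans (le_gradn_snd _ _ _); rewrite normr_gt0 gt_eqF.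
have [->|an0] := eqVneq a 0.
  by rewrite /nflux mulr0 mulr_gt0 ?powR_gt0.
have {an0}a0 : 0 < a by rewrite lt_def an0.
have A0 : 0 < gradn k 1 a.
  by apply: lt_le_trans (le_gradn_snd _ _ _); rewrite normr_gt0 gt_eqF.
have AB : gradn k 1 a < gradn k 1 b.
  rewrite -(@ltr_pXn2r _ 2)// ?nnegrE ?gradn_ge0// !gradn_sq; nra.
have H q : 0 < gradn k 1 q -> nflux q = gradn k 1 q `^ (p - 1) * (q / gradn k 1 q).
  move=> q0; rewrite /nflux -powRM1 ?ltW//; field; by rewrite gt_eqF.
rewrite !H//; apply: lt_le_trans (_ : gradn k 1 b `^ (p - 1) * (a / gradn k 1 a) <= _).
  rewrite ltr_pM2r ?divr_gt0//; apply: gt0_ltr_powR => //; rewrite nnegrE; exact: ltW.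
rewrite ler_pM2l ?powR_gt0// ler_pdivrMr// mulrAC ler_pdivlMr//.
rewrite -(@ler_pXn2r _ 2)// ?nnegrE ?mulr_ge0 ?(ltW a0) ?(ltW b0) ?gradn_ge0//.
rewrite !exprMn !gradn_sq.
have : 0 <= k ^+ 2 * (b ^+ 2 - a ^+ 2).
  by rewrite mulr_ge0 ?sqr_ge0// subr_ge0 ler_pXn2r ?nnegrE ?ltW.
by rewrite expr1n; lra.
Qed.

Lemma nflux0 : nflux 0 = 0. Proof. by rewrite /nflux mulr0. Qed.

Lemma nflux_inc a b : a < b -> nflux a < nflux b.
Proof.
move=> ab; have [a0|a0] := leP 0 a; first exact: nflux_inc0.
have [b0|b0] := leP b 0.
  by rewrite -ltrN2 -!nfluxN nflux_inc0 ?oppr_ge0// ltrN2.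
apply: (@lt_trans _ _ (nflux 0)); last exact: nflux_inc0.
by rewrite -ltrN2 -!nfluxN nflux_inc0// ?oppr_ge0 ?ltrN2// oppr0.
Qed.

(** The power g^(p-2) can be singular only where g = 0, that is for k = 0 and q = 0; there |P(q)| <=
    g^(p-1) squeezes P to 0. *)
Lemma nflux_cont : continuous nflux.
Proof.
move=> q; have [q0|q0] := ltP 0 (gradn k 1 q).
  apply: cvgM; last exact: cvg_id.
  have /is_derive_cont c := is_derive1_powR (p - 2) q0.
  have h : gradn k 1 x @[x --> q] --> gradn k 1 q.
    by apply: cvg_gradn; [exact: cvg_cst|exact: cvg_id].
  exact: cvg_comp h c.
have g0 : gradn k 1 q = 0 by apply/eqP; rewrite eq_le q0 gradn_ge0.
have q00 : q = 0.
  by apply/eqP; rewrite -normr_eq0 eq_le normr_ge0 andbT -g0 le_gradn_snd.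
rewrite /continuous_at q00 nflux0; apply/norm_cvg0P.
apply: (@squeeze_cvgr _ _ _ _ (cst 0) (fun x => gradn k 1 x `^ (p - 1))).
- apply: nearW => x; rewrite normr_ge0/= /nflux normrM ger0_norm ?powR_ge0//.
  by rewrite -powRM1// ?gradn_ge0// ler_wpM2l ?powR_ge0// le_gradn_snd.
- exact: cvg_cst.
- rewrite -[X in _ --> X](@powR0 _ (p - 1)) ?gt_eqF//.
  apply: cvg_powR => //; first by move=> ?; exact: gradn_ge0.
  have : gradn k 1 x @[x --> q] --> gradn k 1 q.
    by apply: cvg_gradn; [exact: cvg_cst|exact: cvg_id].
  by rewrite g0 q00.
Qed.

Lemma nflux_unbounded z : 0 <= z -> exists2 q, 0 <= q & z <= nflux q.
Proof.
(* As q exceeds |k|, q <= g <= 2 q; the last term of q gives g^(p-1) >= 2 z. Hence P(q) >= g^(p-1) /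
   2 >= z. *)
move=> z0; pose q := `|k| + 1 + (2 * z) `^ (p - 1)^-1.
have k0 := normr_ge0 k; have h0 := powR_ge0 (2 * z) (p - 1)^-1.
have q0 : 0 < q by rewrite /q; lra.
exists q; first exact: ltW.
have A0 : 0 < gradn k 1 q.
  by apply: lt_le_trans (le_gradn_snd _ _ _); rewrite normr_gt0 gt_eqF.
have A2 : gradn k 1 q <= 2 * q.
  apply: le_trans (gradn_le _ _ _) _; rewrite normr1 mulr1 (gtr0_norm q0) /q; lra.
have Aq : q <= gradn k 1 q by rewrite -[leLHS](gtr0_norm q0) le_gradn_snd.
have zq : 2 * z <= gradn k 1 q `^ (p - 1).
  have -> : 2 * z = ((2 * z) `^ (p - 1)^-1) `^ (p - 1).
    by rewrite -powRrM mulVf ?gt_eqF// powRr1// mulr_ge0.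
  apply: ge0_ler_powR; rewrite ?nnegrE ?gradn_ge0 ?(ltW p10)//.
  by apply: le_trans Aq; rewrite /q; lra.
have := powR_ge0 (gradn k 1 q) (p - 2).
rewrite /nflux -(powRM1 p1) ?gradn_ge0// in zq *; nra.
Qed.

Lemma nflux_surj z : exists q, nflux q = z.
Proof.
suff H y : 0 <= y -> exists q, nflux q = y.
  have [z0|z0] := leP 0 z; first exact: H.
  have [|q qz] := H (- z); first by rewrite oppr_ge0 ltW.
  by exists (- q); rewrite nfluxN qz opprK.
move=> y0; have [b b0 yb] := nflux_unbounded y0.
have [||q _ qy] := @IVT R nflux 0 b y b0.
- by apply: continuous_subspaceT; exact: nflux_cont.
- by rewrite nflux0 ge_min y0/= le_max yb orbT.
by exists q.
Qed.

Definition nslope z : R := xget 0 [set q | nflux q = z].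

Lemma nslopeK : cancel nslope nflux.
Proof. by move=> z; have [q qz] := nflux_surj z; rewrite /nslope; case: xgetP => // /(_ q). Qed.

Lemma nflux_le a b : (nflux a <= nflux b) = (a <= b).
Proof. by apply: le_mono => x y; exact: nflux_inc. Qed.

Lemma nflux_lt a b : (nflux a < nflux b) = (a < b).
Proof. by rewrite !ltNge nflux_le. Qed.

Lemma nfluxK : cancel nflux nslope.
Proof.
move=> q; have := nslopeK (nflux q); move: (nslope _) => r rq.
by apply/le_anti; rewrite -(nflux_le r q) -(nflux_le q r) rq lexx.
Qed.

Lemma nslope_le a b : (nslope a <= nslope b) = (a <= b).
Proof. by rewrite -nflux_le !nslopeK. Qed.

Lemma nslope_lt a b : (nslope a < nslope b) = (a < b).
Proof. by rewrite -nflux_lt !nslopeK. Qed.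

Lemma nslopeN z : nslope (- z) = - nslope z.
Proof. by rewrite -{1}(nslopeK z) -nfluxN nfluxK. Qed.

Lemma nslope0 : nslope 0 = 0.
Proof. by rewrite -{1}nflux0 nfluxK. Qed.

Lemma nslope_cont : continuous nslope.
Proof.
move=> z; apply/cvgrPdist_lt => e e0.
have h1 : nflux (nslope z - e) < z by rewrite -{2}(nslopeK z) nflux_lt; lra.
have h2 : z < nflux (nslope z + e) by rewrite -{1}(nslopeK z) nflux_lt; lra.
near=> y; rewrite distrC ltr_distl -(nflux_lt (nslope z - e)) -(nflux_lt (nslope y) (_ + _)) nslopeK.
apply/andP; split; near: y; [exact: lt_nbhsr|exact: lt_nbhsl].
Unshelve. all: by end_near. Qed.

Lemma nslope_pinfty : nslope z @[z --> +oo] --> +oo.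
Proof.
apply/cvgryPge => M; near=> z; rewrite -nflux_le nslopeK.
by near: z; apply: nbhs_pinfty_ge; exact: num_real.
Unshelve. all: by end_near. Qed.

(** The tangent line inequality for the convex function L, with slope P(a) at a. Cauchy-Schwarz for
    (k, a) and (k, b) gives k^2 + a b <= A B, and Young's inequality with exponents p and p / (p -
    1) bounds B A^(p-1). *)
Lemma young_grad a b :
  gradn k 1 a `^ p / p + nflux a * (b - a) <= gradn k 1 b `^ p / p.
Proof.
set A := gradn k 1 a; set B := gradn k 1 b.
have A0 : 0 <= A by exact: gradn_ge0.
have B0 : 0 <= B by exact: gradn_ge0.
have CS : k ^+ 2 + a * b <= A * B.
  have [h|h] := leP 0 (k ^+ 2 + a * b); last by apply: le_trans (ltW h) _; rewrite mulr_ge0.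
  rewrite -(@ler_pXn2r _ 2)// ?nnegrE ?mulr_ge0// exprMn !gradn_sq.
  rewrite expr1n !mulr1 -subr_ge0.
  rewrite (_ : _ - _ = k ^+ 2 * (a - b) ^+ 2); last by ring.
  by rewrite mulr_ge0 ?sqr_ge0.
have Y : B * A `^ (p - 1) <= B `^ p / p + A `^ p * (1 - p^-1).
  have := @conjugate_powR R B (A `^ (p - 1)) p (p / (p - 1)) B0 (powR_ge0 _ _) p0.
  rewrite divr_gt0// => /(_ isT) -/(_ _)/=.
  rewrite -powRrM (_ : (p - 1) * (p / (p - 1)) = p); last by field; rewrite gt_eqF.
  have -> : A `^ p / (p / (p - 1)) = A `^ p * (1 - p^-1).
    by field; rewrite !gt_eqF.
  by apply; field; rewrite !gt_eqF.
have -> : nflux a * (b - a) = A `^ (p - 2) * (k ^+ 2 + a * b) - A `^ p.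
  rewrite -(powRM2 p0 A0) gradn_sq /nflux; ring.
have : A `^ (p - 2) * (k ^+ 2 + a * b) <= B * A `^ (p - 1).
  rewrite -powRM1// mulrCA [B * A]mulrC ler_wpM2l ?powR_ge0//.
move: Y; rewrite mulrBr mulr1.
move: (B * _) (_ * (_ + _)) (B `^ p / p) (A `^ p) (A `^ p / p) => *; lra.
Qed.

Definition hamil z := p * (z * nslope z) - gradn k 1 (nslope z) `^ p.

Lemma hamilE z :
  hamil z = ((p - 1) * nslope z ^+ 2 - k ^+ 2) * gradn k 1 (nslope z) `^ (p - 2).
Proof.
rewrite /hamil -{1}(nslopeK z) -(powRM2 p0 (gradn_ge0 _ _ _)) gradn_sq /nflux; ring.
Qed.

Lemma hamilN z : hamil (- z) = hamil z.
Proof. by rewrite !hamilE nslopeN /gradn !sqrrN. Qed.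

(** Fenchel's inequality: N is the supremum over a of these affine functions of z, attained at a =
    Q(z). *)
Lemma hamil_grad_ge a z : p * (z * a) - gradn k 1 a `^ p <= hamil z.
Proof.
have := young_grad (nslope z) a; rewrite nslopeK -(ler_pM2l p0) mulrDr.
have pK (t : R) : p * (t / p) = t by rewrite mulrC divfK// gt_eqF.
rewrite !pK /hamil !mulrBr.
by move: (gradn _ _ _ `^ _) (gradn _ _ (nslope z) `^ _) (p * _) (p * _) => *; lra.
Qed.

Lemma hamil_sub_le a z : hamil a - hamil z <= p * (nslope a * (a - z)).
Proof. by have := hamil_grad_ge (nslope a) z; rewrite {2}/hamil; lra. Qed.

(** The subgradient inequalities at both points give p Q(z) (y - z) <= N(y) - N(z) <= p Q(y) (y -
    z), so the continuity of Q suffices. *)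
Lemma is_derive_hamil z : is_derive z 1 hamil (p * nslope z).
Proof.
apply: is_derive_eps => e e0.
have ep : 0 < e / p by rewrite divr_gt0.
have /cvgrPdist_lt/(_ _ ep) := @nslope_cont z.
apply: filterS => y; rewrite ltr_distlC => /andP[h1 h2].
have l1 := hamil_sub_le y z; have l2 := hamil_sub_le z y.
have h : p * `|nslope y - nslope z| * `|y - z| <= e * `|y - z|.
  by rewrite ler_wpM2r// mulrC -ler_pdivlMr// ler_distl !ltW.
move: l1 l2 h; move: (hamil y) (hamil z) (nslope y) (nslope z) => hy hz qy qz l1 l2 h.
clear h1 h2.
apply: le_trans h; rewrite -[leRHS]mulrA -normrM ler_norml; apply/andP; split.
  by apply: (@le_trans _ _ 0); [rewrite oppr_le0 mulr_ge0// ltW|lra].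
apply: le_trans (_ : p * ((qy - qz) * (y - z)) <= _); first by lra.
by rewrite ler_pM2l// ler_norm.
Qed.

Lemma hamil_cont : continuous hamil.
Proof. by move=> z; exact: is_derive_cont (is_derive_hamil z). Qed.

Lemma gradn10 : gradn k 1 0 = `|k|.
Proof. by rewrite /gradn expr1n mulr1 expr0n/= addr0 sqrtr_sqr. Qed.

Lemma hamil0 : hamil 0 = - `|k| `^ p.
Proof. by rewrite /hamil mul0r mulr0 sub0r nslope0 gradn10. Qed.

Lemma hamil_ge z : - `|k| `^ p <= hamil z.
Proof. by have := hamil_grad_ge 0 z; rewrite !mulr0 sub0r gradn10. Qed.

(** This linear bound above the minimum of N is what makes the period large when lam is close to
    |k|^p. *)
Lemma hamil_le_near0 z : 0 <= z -> z <= 1 ->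
  hamil z + `|k| `^ p <= p * nslope 1 * z.
Proof.
move=> z0 z1; have := hamil_sub_le z 0; rewrite hamil0 opprK subr0 mulrA.
move=> h; apply: le_trans h _; rewrite ler_wpM2r// ler_pM2l// nslope_le//.
Qed.

(** Fenchel's inequality with the trial slope t z^(1/(p-1)). The exponent p / (p - 1) exceeds 1,
    which makes 1 / (lam + N) integrable over the line. *)
Lemma hamil_growth : exists2 c, 0 < c &
  exists C, forall z, c * `|z| `^ (p / (p - 1)) <= hamil z + C.
Proof.
(* The constant t solves 2^p t^p = t: of the gain p t z^(p/(p-1)) the loss 2^p q^p takes only t
   z^(p/(p-1)), and the factor (p - 1) t remains. *)
pose B := 2 `^ p : R; pose t := B^-1 `^ (p - 1)^-1.
have B0 : 0 < B by rewrite powR_gt0.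
have t0 : 0 < t by rewrite powR_gt0// invr_gt0.
have tB : t `^ p * B = t.
  rewrite -(powRM11 p1 (ltW t0)) /t -powRrM mulVf ?gt_eqF// powRr1 ?invr_ge0 ?ltW//.
  by rewrite mulrAC mulVf ?gt_eqF// mul1r.
exists ((p - 1) * t); first by rewrite mulr_gt0.
exists (B * `|k| `^ p) => z; wlog z0 : z / 0 <= z => [H|].
  by have [/H//|/ltW z0] := leP 0 z; rewrite -normrN -hamilN H// oppr_ge0.
rewrite (ger0_norm z0).
have := hamil_grad_ge (t * z `^ (p - 1)^-1) z; set q := _ * _ `^ _.
have q0 : 0 <= q by rewrite mulr_ge0 ?powR_ge0 ?ltW.
have zz : z * z `^ (p - 1)^-1 = z `^ (p / (p - 1)).
  have -> : p / (p - 1) = 1 + (p - 1)^-1 by field; rewrite gt_eqF.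
  have h1 : 1 + (p - 1)^-1 != 0 by rewrite gt_eqF// addr_gt0// invr_gt0.
  by rewrite powRD ?powRr1// (negbTE h1).
have qp : q `^ p = t `^ p * z `^ (p / (p - 1)).
  by rewrite /q powRM ?powR_ge0 ?ltW// -powRrM [_^-1 * p]mulrC.
have hB : gradn k 1 q `^ p <= B * `|k| `^ p + B * q `^ p.
  have mx0 : 0 <= Num.max `|k| q by rewrite le_max normr_ge0.
  apply: le_trans (_ : (2 * Num.max `|k| q) `^ p <= _).
    apply: ge0_ler_powR; rewrite ?nnegrE ?gradn_ge0 ?mulr_ge0 ?(ltW p0)//.
    apply: le_trans (gradn_le _ _ _) _; rewrite normr1 mulr1 (ger0_norm q0).
    have : `|k| <= Num.max `|k| q by rewrite le_max lexx.
    have : q <= Num.max `|k| q by rewrite le_max lexx orbT.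
    lra.
  rewrite powRM// -/B -mulrDr ler_pM2l//.
  by rewrite /Num.max; case: ifP => _; rewrite ?lerDl ?lerDr powR_ge0.
have -> : z * q = t * z `^ (p / (p - 1)) by rewrite -zz /q; ring.
move: hB; rewrite qp [B * (_ * _)]mulrA [B * t `^ p]mulrC tB; lra.
Qed.

Section energy.
Variable lam : R.
Hypothesis lamk : `|k| `^ p < lam.

Lemma energy_gt0 z : 0 < lam + hamil z.
Proof. by have := hamil_ge z; move: lamk; lra. Qed.

(* u as a function of z under the normalization u^p (lam + N z) = 1. *)
Definition namp z := (lam + hamil z) `^ (- p^-1).

Lemma namp_gt0 z : 0 < namp z.
Proof. by rewrite powR_gt0// energy_gt0. Qed.

Lemma nampN z : namp (- z) = namp z.
Proof. by rewrite /namp hamilN. Qed.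

Lemma hamil_pinfty : hamil z @[z --> +oo] --> +oo.
Proof.
have [c c0 [C cC]] := hamil_growth; apply/cvgryPge => M; near=> z.
have z1 : 1 <= z by near: z; apply: nbhs_pinfty_ge; exact: num_real.
have zM : (M + C) / c <= z by near: z; apply: nbhs_pinfty_ge; exact: num_real.
have := cC z; rewrite ger0_norm; last by lra.
have : z <= z `^ (p / (p - 1)).
  by rewrite le1r_powR// ler_pdivlMr//; lra.
move: zM; rewrite ler_pdivrMr// -[z <= z `^ _](ler_pM2l c0); lra.
Unshelve. all: by end_near. Qed.

Lemma namp_pinfty : namp z @[z --> +oo] --> 0.
Proof.
apply/cvgr0Pnorm_lt => e e0; near=> z.
rewrite ger0_norm ?powR_ge0// -[e](powRr1 (ltW e0)) (_ : 1 = p * p^-1); last by rewrite divff// gt_eqF.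
rewrite powRrM /namp powRN -powR_inv1 ?powR_ge0// powRAC powR_inv1 ?ltW ?energy_gt0//.
apply: gt0_ltr_powR; rewrite ?invr_gt0// ?nnegrE ?invr_ge0 ?powR_ge0 ?(ltW (energy_gt0 _))//.
rewrite invf_plt ?posrE ?powR_gt0 ?energy_gt0//.
apply: (@lt_le_trans _ _ ((e `^ p)^-1 + 1)); first by rewrite ltrDl.
rewrite -lerBlDl; near: z.
by move/cvgryPge : hamil_pinfty; exact.
Unshelve. all: by end_near. Qed.

(* The slope at its zeros of an arch with u^p (lam + N z) = 1: u' = Q(z) u, and
   N(z) ~ (p - 1) Q(z)^p as z tends to +oo. *)
Definition dlim := (p - 1) `^ (- p^-1).

Lemma dlim_gt0 : 0 < dlim. Proof. by rewrite powR_gt0. Qed.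

(** In the variable r = 1 / Q(z) the energy is lam + N(z) = r^(-p) G(r), where G is continuous at 0
    and G(0) = p - 1; the product is therefore G(r)^(-1/p). *)
Lemma nslope_namp_pinfty : nslope z * namp z @[z --> +oo] --> dlim.
Proof.
pose G r := lam * `|r| `^ p + ((p - 1) - k ^+ 2 * r ^+ 2) * gradn k r 1 `^ (p - 2).
have G0 : G r @[r --> 0] --> p - 1.
  have -> : p - 1 = lam * `|0 : R| `^ p + ((p - 1) - k ^+ 2 * (0 * 0)) * gradn k 0 1 `^ (p - 2).
    rewrite normr0 powR0 ?gt_eqF// mul0r !mulr0 add0r subr0.
    by rewrite /gradn expr0n/= mulr0 add0r expr1n sqrtr1 powR1 mulr1.
  apply: cvgD.
    apply: cvgM; first exact: cvg_cst.
    apply: cvg_powR => //; apply: cvg_norm; exact: cvg_id.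
  apply: cvgM.
    apply: cvgB; first exact: cvg_cst.
    apply: cvgM; [exact: cvg_cst|exact: (cvgM cvg_id cvg_id)].
  have g0 : 0 < gradn k 0 1 :> R.
    by rewrite /gradn expr0n/= mulr0 add0r expr1n sqrtr1.
  have /is_derive_cont c := is_derive1_powR (p - 2) g0.
  have h : gradn k x 1 @[x --> (0 : R)] --> gradn k 0 1.
    by apply: cvg_gradn; [exact: cvg_id|exact: cvg_cst].
  exact: cvg_comp h c.
have E q : 0 < q -> lam + hamil (nflux q) = q `^ p * G q^-1.
  move=> q0; rewrite hamilE nfluxK /G.
  have qn0 : q != 0 by rewrite gt_eqF.
  have -> : gradn k 1 q = q * gradn k q^-1 1.
    by rewrite -gradnM ?ltW// mulfV// mulr1.
  rewrite powRM ?gradn_ge0 ?(ltW q0)// ger0_norm ?invr_ge0 ?(ltW q0)//.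
  have -> : q^-1 `^ p = (q `^ p)^-1.
    by rewrite -powR_inv1 ?(ltW q0)// -powRrM mulN1r powRN.
  rewrite -(powRM2 p0 (ltW q0)); move: (gradn _ _ _ `^ _) => g.
  have : q `^ (p - 2) != 0 by rewrite gt_eqF ?powR_gt0.
  by move: (q `^ (p - 2)) => r r0; field; rewrite qn0 r0.
have lG : (G r) `^ (- p^-1) @[r --> 0] --> dlim.
  have /is_derive_cont c := is_derive1_powR (- p^-1) p10.
  exact: cvg_comp G0 c.
have li : (nslope z)^-1 @[z --> +oo] --> 0.
  apply/cvgr0Pnorm_lt => e e0; near=> z.
  have : e^-1 + 1 <= nslope z by near: z; move/cvgryPge : nslope_pinfty; exact.
  have e1 : 0 < e^-1 by rewrite invr_gt0.
  move=> h; have z0 : 0 < nslope z by lra.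
  by rewrite ger0_norm ?invr_ge0 ?ltW// invf_plt ?posrE//; lra.
have := cvg_comp _ _ li lG; apply: cvg_trans; apply: near_eq_cvg; near=> z.
have z0 : 0 < nslope z.
  have : 1 <= nslope z by near: z; move/cvgryPge : nslope_pinfty; exact.
  lra.
have := energy_gt0 z.
rewrite /comp /namp -{1 3 4}(nslopeK z) E//; move: (nslope z) z0 => q q0.
rewrite pmulr_rgt0 ?powR_gt0// => G1.
rewrite powRM ?powR_ge0 ?ltW// mulrA -powRrM mulrN divff ?gt_eqF// powR_inv1 ?ltW//.
by rewrite nfluxK divff ?gt_eqF// mul1r.
Unshelve. all: by end_near. Qed.

(** Homogeneity of degree p - 1: for u = [namp z] and u' = Q(z) u the flux is u^(p-1) P(Q(z)) =
    u^(p-1) z. *)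
Lemma namp_flux z : namp z `^ (p - 1) * z =
  gradn k (namp z) (nslope z * namp z) `^ (p - 2) * (nslope z * namp z).
Proof.
have n0 := ltW (namp_gt0 z).
rewrite -{2}(nslopeK z) /nflux -(powRM1 p1 n0) -[X in gradn k X (nslope z * _)]mulr1.
by rewrite [nslope z * _]mulrC gradnM// powRM ?gradn_ge0//; ring.
Qed.

Lemma namp_flux_pinfty : namp z `^ (p - 1) * z @[z --> +oo] --> dlim `^ (p - 1).
Proof.
under eq_fun do rewrite namp_flux.
have g0 : gradn k 0 dlim = dlim.
  by rewrite /gradn expr0n/= mulr0 add0r sqrtr_sqr ger0_norm// ltW// dlim_gt0.
rewrite -(powRM1 p1 (ltW dlim_gt0)).
apply: cvgM; last exact: nslope_namp_pinfty.
have gt0 : 0 < gradn k 0 dlim by rewrite g0 dlim_gt0.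
have /is_derive_cont c := is_derive1_powR (p - 2) gt0.
rewrite -[X in X `^ _]g0.
have h : gradn k (namp z) (nslope z * namp z) @[z --> +oo] --> gradn k 0 dlim.
  by apply: cvg_gradn; [exact: namp_pinfty|exact: nslope_namp_pinfty].
exact: cvg_comp h c.
Qed.

End energy.
End flux.

(** * The period of the phase equation *)

Section mvt.
Context {R : realType}.
Implicit Types (f g : R -> R) (a b x y : R).
Local Notation mu := (@lebesgue_measure R).

Lemma MVT_is_derive f g a b : a < b ->
  (forall x, a <= x <= b -> is_derive x 1 f (g x)) ->
  exists2 c, a < c < b & f b - f a = g c * (b - a).
Proof.
move=> ab H; have [||c] := @MVT R f g a b ab.
- by move=> x; rewrite in_itv/= => /andP[ax xb]; apply: H; rewrite !ltW.
- apply: continuous_in_subspaceT => x; rewrite inE/= in_itv/= => xab.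
  exact: is_derive_cont (H x xab).
by rewrite in_itv/=; exists c.
Qed.

Lemma is_derive_incr f g : (forall x : R, is_derive x 1 f (g x)) ->
  (forall x, 0 < g x) -> {homo f : x y / x < y}.
Proof.
move=> H g0 x y xy; have [c _ E] := MVT_is_derive xy (fun z _ => H z).
by rewrite -subr_gt0 E mulr_gt0// subr_gt0.
Qed.

Lemma is_derive_ndecr f g : (forall x : R, is_derive x 1 f (g x)) ->
  (forall x, 0 <= g x) -> {homo f : x y / x <= y}.
Proof.
move=> H g0 x y; rewrite le_eqVlt => /predU1P[->//|xy].
have [c _ E] := MVT_is_derive xy (fun z _ => H z).
by rewrite -subr_ge0 E mulr_ge0// subr_ge0 ltW.
Qed.

(** Evenness reduces the integral to the half-line, where (1 + z)^(1-a) / (1 - a) is a primitive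
    that vanishes at infinity. *)
Lemma integrable_tail (a : R) : 1 < a ->
  mu.-integrable setT (fun z => ((1 + `|z|) `^ (- a))%:E).
Proof.
move=> a1; have a10 : 0 < a - 1 by rewrite subr_gt0.
have p0 (z : R) : 0 < 1 + `|z| by rewrite ltr_pwDl.
have cf : continuous (fun z : R => (1 + `|z|) `^ (- a)).
  move=> z; have /is_derive_cont c := is_derive1_powR (- a) (p0 z).
  have h : 1 + `|x| @[x --> z] --> 1 + `|z|.
    by apply: cvgD; [exact: cvg_cst|exact: cvg_norm].
  exact: cvg_comp h c.
apply/integrableP; split.
  by apply/measurable_EFinP; exact: continuous_measurable_fun.
rewrite (_ : (fun z => _) = (fun z => ((1 + `|z|) `^ (- a))%:E)); last first.
  by apply/funext => z; rewrite gee0_abs// lee_fin powR_ge0.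
rewrite (@ge0_symfun_integralT R (fun z => (1 + `|z|) `^ (- a)) (fun x => powR_ge0 _ _) cf); last first.
  by move=> x /=; rewrite normrN.
rewrite -set_itvcy.
have dF (x : R) : 0 <= x -> is_derive x 1 (fun z => - (a - 1)^-1 * (1 + z) `^ (1 - a)) ((1 + x) `^ (- a)).
  move=> x0; have q0 : 0 < 1 + x by lra.
  have d1 := is_deriveD (is_derive_cst (1 : R) x 1) (is_derive_id x 1).
  have d2 := is_derive1_comp (is_derive1_powR (1 - a) q0) d1.
  apply: (trigger_derive (is_deriveZ (- (a - 1)^-1) d2)).
  rewrite /GRing.scale/= add0r mulr1 (_ : 1 - a - 1 = - a); last by ring.
  by field; rewrite gt_eqF.
rewrite (@ge0_continuous_FTC2y R _ (fun z => - (a - 1)^-1 * (1 + z) `^ (1 - a)) 0 0).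
- by rewrite ltry.
- by move=> x _; exact: powR_ge0.
- exact: continuous_subspaceT.
- have h : (1 + z) `^ (a - 1) @[z --> +oo] --> +oo.
    apply/cvgryPge => M; near=> z.
    have z1 : (`|M| + 1) `^ (a - 1)^-1 <= z by near: z; apply: nbhs_pinfty_ge; exact: num_real.
    have M0 : 0 < `|M| + 1 by rewrite ltr_wpDl.
    apply: le_trans (ler_norm _) _; apply: (@le_trans _ _ (`|M| + 1)); first by rewrite lerDl.
    have -> : `|M| + 1 = ((`|M| + 1) `^ (a - 1)^-1) `^ (a - 1).
      by rewrite -powRrM mulVf ?gt_eqF// powRr1// ltW.
    have z0 := powR_ge0 (`|M| + 1) (a - 1)^-1.
    by apply: ge0_ler_powR; rewrite ?nnegrE ?(ltW a10)//; lra.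
  rewrite -[X in _ --> X](mulr0 (- (a - 1)^-1)).
  apply: cvgM; first exact: cvg_cst.
  apply/cvgr0Pnorm_lt => e e0; near=> z.
  have hz : e^-1 + 1 <= (1 + z) `^ (a - 1) by near: z; move/cvgryPge : h; exact.
  have e1 : 0 < e^-1 by rewrite invr_gt0.
  rewrite ger0_norm ?powR_ge0// -opprB powRN invf_plt ?posrE//; lra.
- by move=> x x0; have [] := dF x (ltW x0).
- apply: cvg_at_right_filter; exact: is_derive_cont (dF 0 (lexx 0)).
- move=> x; rewrite in_itv/= andbT => x0.
  rewrite derive1E; have [_ ->] := dF x (ltW x0).
  by rewrite ger0_norm// ltW.
Unshelve. all: by end_near. Qed.

Lemma cvg_int_pinfty (phi : R -> R) : mu.-integrable setT (EFin \o phi) ->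
  \int[mu]_(x in `]-oo, z]) phi x @[z --> +oo] --> \int[mu]_x phi x.
Proof.
move=> iphi; apply/cvg_pinftyP => u u_oo.
pose f_ n x := ((phi \_ `]-oo, u n]) x)%:E.
have D1 n : measurable_fun setT (f_ n).
  apply/measurable_EFinP; apply/(measurable_restrictT _ _).1 => //.
  apply: (measurable_funS measurableT) => //; apply/measurable_EFinP.
  exact: measurable_int iphi.
have D2 : measurable_fun setT (EFin \o phi) := measurable_int mu iphi.
have D3 : \forall x \ae mu, setT x -> f_ n x @[n --> \oo] --> (EFin \o phi) x.
  apply/aeW => x _; apply: cvg_near_cst; near=> n.
  rewrite /f_ patchE mem_set//= in_itv/=; near: n.
  by move/cvgryPge : u_oo; exact.
have D4 : mu.-integrable setT (abse \o (EFin \o phi)) by exact: integrable_abse.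
have D5 : \forall x \ae mu, forall n, setT x -> (`|f_ n x| <= (abse \o (EFin \o phi)) x)%E.
  apply/aeW => x n _; rewrite /f_ patchE/=; case: ifP => // _.
  by rewrite normr0 lee_fin.
have [|||||_ _ H] := @dominated_convergence _ _ R mu setT measurableT f_ (EFin \o phi)
  (abse \o (EFin \o phi)).
- exact: D1.
- exact: D2.
- exact: D3.
- exact: D4.
- exact: D5.
have : (\int[mu]_x f_ n x)%E @[n --> \oo] --> (\int[mu]_x phi x)%:E.
  by rewrite /Rintegral fineK//; exact: integrable_fin_num.
move=> /fine_cvg; apply: cvg_trans; apply: near_eq_cvg; apply: nearW => n /=.
by rewrite [in RHS]Rintegral_mkcond.
Unshelve. all: by end_near. Qed.

Lemma cvg_int_ninfty (phi : R -> R) : mu.-integrable setT (EFin \o phi) ->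
  \int[mu]_(x in `]-oo, z]) phi x @[z --> -oo] --> 0.
Proof.
move=> iphi; apply/cvg_ninftyP => u u_oo.
pose f_ n x := ((phi \_ `]-oo, u n]) x)%:E.
have D1 n : measurable_fun setT (f_ n).
  apply/measurable_EFinP; apply/(measurable_restrictT _ _).1 => //.
  apply: (measurable_funS measurableT) => //; apply/measurable_EFinP.
  exact: measurable_int iphi.
have D2 : measurable_fun setT (cst 0%E : R -> \bar R) by exact: measurable_cst.
have D3 : \forall x \ae mu, setT x -> f_ n x @[n --> \oo] --> (cst 0%E : R -> \bar R) x.
  apply/aeW => x _; apply: cvg_near_cst; near=> n.
  rewrite /f_ patchE memNset//= in_itv/=; apply/negP; rewrite -ltNge.
  apply: (@le_lt_trans _ _ (x - 1)); last by rewrite ltrBlDr ltrDl.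
  by near: n; move/cvgrNyPle : u_oo; exact.
have D4 : mu.-integrable setT (abse \o (EFin \o phi)) by exact: integrable_abse.
have D5 : \forall x \ae mu, forall n, setT x -> (`|f_ n x| <= (abse \o (EFin \o phi)) x)%E.
  apply/aeW => x n _; rewrite /f_ patchE/=; case: ifP => // _.
  by rewrite normr0 lee_fin.
have [|||||_ _ H] := @dominated_convergence _ _ R mu setT measurableT f_ (cst 0%E) (abse \o (EFin \o phi)).
- exact: D1.
- exact: D2.
- exact: D3.
- exact: D4.
- exact: D5.
have : (\int[mu]_x f_ n x)%E @[n --> \oo] --> 0%:E.
  by move: H; rewrite /= integral0.
move=> /fine_cvg; apply: cvg_trans; apply: near_eq_cvg; apply: nearW => n /=.
by rewrite [in RHS]Rintegral_mkcond.
Unshelve. all: by end_near. Qed.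

Lemma is_derive_int (phi : R -> R) : mu.-integrable setT (EFin \o phi) ->
  continuous phi -> forall z : R, is_derive z 1 (fun y => \int[mu]_(x in `]-oo, y]) phi x) (phi z).
Proof.
move=> iphi cphi z.
have [||||d1 d2] := @continuous_FTC1 R phi -oo%O z (z + 1).
- by rewrite ltrDl.
- by apply: integrableS iphi.
- by rewrite ltNyr.
- exact: cphi.
by apply: (DeriveDef d1); rewrite -derive1E; exact: d2.
Qed.

End mvt.

Section period.
Context {R : realType}.
Variables (p k : R).
Hypothesis p1 : 1 < p.
Local Notation mu := (@lebesgue_measure R).
Let p0 : 0 < p. Proof. exact: lt_trans p1. Qed.
Let p10 : 0 < p - 1. Proof. by rewrite subr_gt0. Qed.

Definition rate lam z := (lam + hamil p k z)^-1.
Definition period lam := \int[mu]_z rate lam z.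
(* Along a solution of z' = - (lam + N z), the phase decreases at unit speed. *)
Definition phase lam z := \int[mu]_(x in `]-oo, z]) rate lam x.

Lemma rate_gt0 lam z : `|k| `^ p < lam -> 0 < rate lam z.
Proof. by move=> h; rewrite invr_gt0 energy_gt0. Qed.

Lemma rate_cont lam : `|k| `^ p < lam -> continuous (rate lam).
Proof.
move=> h z; apply: cvgV; first by rewrite gt_eqF ?energy_gt0.
by apply: cvgD; [exact: cvg_cst|exact: hamil_cont].
Qed.

Lemma rate_integrable lam : `|k| `^ p < lam -> mu.-integrable setT (EFin \o rate lam).
Proof.
move=> h; have [c c0 [C cC]] := hamil_growth k p1.
have [a aE] : exists a, a = p / (p - 1) by eexists.
rewrite -aE in cC; have a1 : 1 < a by rewrite aE ltr_pdivlMr//; lra.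
have a0 : 0 < a by lra.
have K0 : 0 < lam - `|k| `^ p by rewrite subr_gt0.
(* The energy is at least lam - |k|^p and, up to a constant, at least c |z|^a; [B] combines the two
   bounds into (1 + |z|)^a <= B (lam + N). The factor 2^a comes from (1 + |z|)^a <= 2^a (1 +
   |z|^a). *)
pose B := 2 `^ a * ((lam - `|k| `^ p)^-1 + c^-1 * (1 + `|C - lam| / (lam - `|k| `^ p))).
have := integrableZl measurableT B (integrable_tail a1).
apply: le_integrable => //.
  by apply/measurable_EFinP; apply: continuous_measurable_fun; exact: rate_cont.
move=> z _ /=; rewrite lee_fin.
rewrite ger0_norm ?(ltW (rate_gt0 _ _))//; apply: le_trans (ler_norm _).
have e0 := energy_gt0 p1 h z; set e := lam + _ in e0.
have z0 : 0 < 1 + `|z| by rewrite ltr_pwDl.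
rewrite powRN ler_pdivlMr ?powR_gt0// /rate mulrC ler_pdivrMr//.
have eK : lam - `|k| `^ p <= e by rewrite /e; have := hamil_ge k p1 z; lra.
have H1 : 1 <= e / (lam - `|k| `^ p) by rewrite ler_pdivlMr// mul1r.
have H2 : `|z| `^ a <= c^-1 * (e * (1 + `|C - lam| / (lam - `|k| `^ p))).
  rewrite -(ler_pM2l c0) [leRHS]mulrA divff ?gt_eqF// mul1r.
  apply: le_trans (cC z) _; rewrite mulrDr mulr1 mulrCA.
  have : `|C - lam| <= `|C - lam| * (e / (lam - `|k| `^ p)) by rewrite ler_peMr.
  by have := ler_norm (C - lam); rewrite /e; lra.
apply: (@le_trans _ _ (2 `^ a * (1 + `|z| `^ a))).
  have m0 : 0 <= Num.max 1 `|z| by rewrite le_max ler01.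
  apply: (@le_trans _ _ ((2 * Num.max 1 `|z|) `^ a)).
    apply: ge0_ler_powR; rewrite ?nnegrE ?mulr_ge0 ?(ltW a0) ?(ltW z0)//.
    have : 1 <= Num.max 1 `|z| by rewrite le_max lexx.
    have : `|z| <= Num.max 1 `|z| by rewrite le_max lexx orbT.
    lra.
  rewrite powRM// ler_pM2l ?powR_gt0// /Num.max; case: ifP => _.
    by rewrite lerDr.
  by rewrite powR1 lerDl powR_ge0.
rewrite /B -mulrA ler_pM2l ?powR_gt0//; apply: le_trans (lerD H1 H2) _.
by rewrite -/e; rewrite le_eqVlt; apply/orP; left; apply/eqP; ring.
Qed.

Section one.
Variable lam : R.
Hypothesis lamk : `|k| `^ p < lam.

Lemma is_derive_phase (z : R) : is_derive z 1 (phase lam) (rate lam z).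
Proof. by apply: is_derive_int; [exact: rate_integrable|exact: rate_cont]. Qed.

Lemma phase_incr : {homo phase lam : x y / x < y}.
Proof. by apply: (is_derive_incr is_derive_phase) => z; exact: rate_gt0. Qed.

Lemma phase_pinfty : phase lam z @[z --> +oo] --> period lam.
Proof. exact: cvg_int_pinfty (rate_integrable lamk). Qed.

Lemma phase_ninfty : phase lam z @[z --> -oo] --> 0.
Proof. exact: cvg_int_ninfty (rate_integrable lamk). Qed.

Lemma phase_gt0 z : 0 < phase lam z.
Proof.
apply: le_lt_trans (phase_incr (_ : z - 1 < z)); last by rewrite ltrBlDr ltrDl.
by apply: Rintegral_ge0 => x _; exact/ltW/rate_gt0.
Qed.

Lemma phase_lt z : phase lam z < period lam.
Proof.
apply: lt_le_trans (phase_incr (_ : z < z + 1)) _; first by rewrite ltrDl.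
apply: (cvgr_to_ge phase_pinfty); near=> y.
have : z + 1 <= y by near: y; apply: nbhs_pinfty_ge; exact: num_real.
by rewrite le_eqVlt => /predU1P[->//|/phase_incr/ltW].
Unshelve. all: by end_near. Qed.

Lemma period_gt0 : 0 < period lam.
Proof. exact: lt_trans (phase_gt0 0) (phase_lt 0). Qed.

End one.

Lemma lim_sub_ge (G g : R -> R) L : (forall x : R, is_derive x 1 G (g x)) ->
  (forall x, 0 <= g x) -> G x @[x --> +oo] --> L -> forall x, G x <= L.
Proof.
move=> dG g0 GL x; apply: (cvgr_to_ge GL); near=> y.
apply: (is_derive_ndecr dG g0); near: y; apply: nbhs_pinfty_ge; exact: num_real.
Unshelve. all: by end_near. Qed.

Lemma lim_sub_le (G g : R -> R) L : (forall x : R, is_derive x 1 G (g x)) ->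
  (forall x, 0 <= g x) -> G x @[x --> -oo] --> L -> forall x, L <= G x.
Proof.
move=> dG g0 GL x; apply: (cvgr_to_le GL); near=> y.
apply: (is_derive_ndecr dG g0); near: y; apply: nbhs_ninfty_le; exact: num_real.
Unshelve. all: by end_near. Qed.

Lemma rate_decr lam nu (z : R) : `|k| `^ p < lam -> lam < nu -> rate nu z < rate lam z.
Proof.
move=> h lm; rewrite /rate ltf_pV2 ?posrE ?(energy_gt0 p1 h) ?(energy_gt0 p1 (lt_trans h lm))//.
by rewrite ltrD2r.
Qed.

Lemma is_derive_phaseB lam nu (z : R) : `|k| `^ p < lam -> lam < nu ->
  is_derive z 1 (fun x => phase lam x - phase nu x) (rate lam z - rate nu z).
Proof.
move=> h lm; have := is_derive_phase h z; have := is_derive_phase (lt_trans h lm) z.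
move=> d2 d1; exact: is_deriveB.
Qed.

(** The difference of the two phases increases strictly in z, from 0 at -oo to the difference of the
    periods at +oo. *)
Lemma period_decr lam nu : `|k| `^ p < lam -> lam < nu -> period nu < period lam.
Proof.
move=> h lm; have h2 := lt_trans h lm.
have dG z := is_derive_phaseB z h lm.
have g0 z : 0 < rate lam z - rate nu z by rewrite subr_gt0 rate_decr.
have G1 : phase lam z - phase nu z @[z --> +oo] --> period lam - period nu.
  by apply: cvgB; exact: phase_pinfty.
have G2 : phase lam z - phase nu z @[z --> -oo] --> 0.
  by rewrite -[0](subr0 0); apply: cvgB; exact: phase_ninfty.
rewrite -subr_gt0; apply: lt_le_trans (lim_sub_ge dG _ G1 1); last by move=> x; exact: ltW.
apply: le_lt_trans (is_derive_incr dG g0 (ltr01 : 0 < 1)).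
by apply: (lim_sub_le dG _ G2) => x; exact: ltW.
Qed.

(** Since 1/s - 1/t = (t - s) / (s t), the difference of the rates is at most c times the rate at
    [l0]. Hence c times the phase at [l0], minus the difference of the phases, is nondecreasing in
    z, and its limits are compared. *)
Lemma period_lipschitz l0 lam nu : `|k| `^ p < l0 -> l0 <= lam -> lam < nu ->
  period lam - period nu <= (nu - lam) / (l0 - `|k| `^ p) * period l0.
Proof.
move=> h l0l lm; have hl : `|k| `^ p < lam by exact: lt_le_trans l0l.
have hm := lt_trans hl lm; have K0 : 0 < l0 - `|k| `^ p by rewrite subr_gt0.
set c := _ / _.
pose G z := c * phase l0 z - (phase lam z - phase nu z).
have dG (z : R) : is_derive z 1 G (c * rate l0 z - (rate lam z - rate nu z)).
  have d1 := is_derive_phaseB z hl lm; have d0 := is_derive_phase h z.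
  have d2 := is_deriveZ c d0; exact: is_deriveB.
have g0 z : 0 <= c * rate l0 z - (rate lam z - rate nu z).
  have e0 := energy_gt0 p1 h z; have el := energy_gt0 p1 hl z; have em := energy_gt0 p1 hm z.
  have r1 : rate lam z <= rate l0 z.
    by move: l0l; rewrite le_eqVlt => /predU1P[->//|l0l]; exact/ltW/rate_decr.
  have r2 : rate nu z <= (l0 - `|k| `^ p)^-1.
    by rewrite lef_pV2 ?posrE//; have := hamil_ge k p1 z; lra.
  have -> : rate lam z - rate nu z = (nu - lam) * (rate lam z * rate nu z).
    by rewrite /rate; field; rewrite !gt_eqF.
  rewrite subr_ge0 /c -mulrA ler_pM2l ?subr_gt0// mulrC.
  by apply: ler_pM => //; exact/ltW/rate_gt0.
have G1 : G z @[z --> +oo] --> c * period l0 - (period lam - period nu).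
  apply: cvgB; last by apply: cvgB; exact: phase_pinfty.
  by apply: cvgM; [exact: cvg_cst|exact: phase_pinfty].
have G2 : G z @[z --> -oo] --> 0.
  rewrite -[0](subr0 0) -{1}(mulr0 c) -{2}(subr0 0).
  apply: cvgB; last by apply: cvgB; exact: phase_ninfty.
  by apply: cvgM; [exact: cvg_cst|exact: phase_ninfty].
rewrite -subr_ge0; apply: le_trans (lim_sub_ge dG g0 G1 0).
exact: (lim_sub_le dG g0 G2).
Qed.

(** Beyond a large M the tails are dominated by those at the fixed level [l0], and on [-M, M] a
    large lam makes the rate small; each of the three parts is at most d / 3. *)
Lemma period_small d : 0 < d -> exists2 lam, `|k| `^ p < lam & period lam < d.
Proof.
move=> d0; pose l0 := `|k| `^ p + 1.
have h0 : `|k| `^ p < l0 by rewrite ltrDl.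
have d3 : 0 < d / 3 by rewrite divr_gt0.
have [M [M0 M1 M2]] : exists M, [/\ 0 < M, period l0 - phase l0 M < d / 3 & phase l0 (- M) < d / 3].
  have H1 : \forall M \near +oo, period l0 - phase l0 M < d / 3.
    move/cvgrPdist_lt : (phase_pinfty h0) => /(_ _ d3); apply: filterS => x.
    by apply: le_lt_trans; rewrite ler_norm.
  have H2 : \forall M \near +oo, phase l0 (- M) < d / 3.
    have /cvgNy_compNP/cvgr0Pnorm_lt/(_ _ d3) := phase_ninfty h0; apply: filterS => x.
    by apply: le_lt_trans; rewrite ler_norm.
  near (pinfty_nbhs R) => M; exists M; split; near: M => //.
  by apply: nbhs_pinfty_gt; exact: num_real.
(* The term 6 M / d bounds the rate by d / (6 M), hence the part over [-M, M] by d / 3. *)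
pose lam := l0 + 6 * M / d + 1.
have q0 : 0 < 6 * M / d by rewrite divr_gt0// mulr_gt0.
have l0l : l0 < lam by rewrite /lam; lra.
have hl := lt_trans h0 l0l.
exists lam => //.
have dG z := is_derive_phaseB z h0 l0l.
have g0 z : 0 <= rate l0 z - rate lam z by rewrite subr_ge0 ltW// rate_decr.
have G1 : phase l0 z - phase lam z @[z --> +oo] --> period l0 - period lam.
  by apply: cvgB; exact: phase_pinfty.
have G2 : phase l0 z - phase lam z @[z --> -oo] --> 0.
  by rewrite -[0](subr0 0); apply: cvgB; exact: phase_ninfty.
have B1 := lim_sub_ge dG g0 G1 M; have B2 := lim_sub_le dG g0 G2 (- M).
have MM : - M < M by lra.
have [z _ E] := MVT_is_derive MM (fun z _ => is_derive_phase hl z).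
have r : rate lam z <= d / (6 * M).
  rewrite -[leRHS]invf_div lef_pV2 ?posrE ?energy_gt0//.
  by have := hamil_ge k p1 z; rewrite /lam /l0; lra.
have : phase lam M - phase lam (- M) <= d / 3.
  rewrite E; apply: (@le_trans _ _ (d / (6 * M) * (M - - M))).
    by rewrite ler_pM2r//; lra.
  by rewrite le_eqVlt; apply/orP; left; apply/eqP; field; rewrite gt_eqF.
lra.
Unshelve. all: by end_near. Qed.

(** On [0, 1] the energy is at most e + C z, so the phase grows there by at least ln ((e + C) / e) /
    C. With e = C exp(-C) the quotient is 1 + exp C, and the growth is at least 1. *)
Lemma period_large : exists2 lam, `|k| `^ p < lam & 1 <= period lam.
Proof.
pose C := p * nslope p k 1.
have C0 : 0 < C.
  by rewrite mulr_gt0// -(nslope0 k p1) nslope_lt.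
pose e := C * expR (- C); have e0 : 0 < e by rewrite mulr_gt0 ?expR_gt0.
pose lam := `|k| `^ p + e.
have h : `|k| `^ p < lam by rewrite ltrDl.
exists lam => //.
pose G z := phase lam z - C^-1 * ln (e + C * z).
have dG (z : R) : 0 <= z <= 1 -> is_derive z 1 G (rate lam z - (e + C * z)^-1).
  move=> /andP[z0 z1].
  have pz : 0 < e + C * z by rewrite ltr_pwDl// mulr_ge0// ltW.
  have d1 := is_derive_phase h z; have d2 := is_derive1_ln pz.
  have d3 : is_derive z 1 (fun x => e + C * x) C.
    have d4 := is_deriveD (is_derive_cst e z 1) (is_deriveZ C (is_derive_id z 1)).
    by apply: (trigger_derive d4); rewrite add0r /GRing.scale/= mulr1.
  have d4 := @is_derive1_comp R (@ln R) (fun x => e + C * x) z _ _ d2 d3.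
  have d5 := is_deriveZ C^-1 d4.
  apply: (trigger_derive (is_deriveB d1 d5)).
  by rewrite /GRing.scale/=; field; rewrite !gt_eqF.
have [z /andP[z0 z1] E] := MVT_is_derive ltr01 dG.
have : 0 <= G 1 - G 0.
  rewrite E subr0 mulr1 subr_ge0 /rate lef_pV2 ?posrE ?energy_gt0//.
    by have := hamil_le_near0 k p1 (ltW z0) (ltW z1); rewrite /lam -/C; lra.
  by rewrite ltr_pwDl// mulr_ge0 ?ltW.
rewrite /G mulr0 addr0 mulr1.
have := phase_lt h 1; have := phase_gt0 h 0.
suff : 1 <= C^-1 * (ln ((e + C) / e)).
  by rewrite ln_div ?posrE ?addr_gt0// mulrBr; lra.
rewrite mulrC ler_pdivlMr// mul1r -ler_expR lnK ?posrE ?divr_gt0 ?addr_gt0//.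
rewrite mulrDl divff ?gt_eqF// /e expRN invfM invrK mulrA divff ?gt_eqF// mul1r.
by rewrite lerDr.
Qed.

Lemma period_surj d : 0 < d -> d <= 1 -> exists2 lam, `|k| `^ p < lam & period lam = d.
Proof.
move=> d0 d1; have [a ka a1] := period_large; have [b kb bd] := period_small d0.
have ab : a <= b.
  rewrite leNgt; apply/negP => /(period_decr kb); lra.
have [||l] := @IVT R period a b d ab.
- apply: continuous_in_subspaceT => x; rewrite inE/= in_itv/= => /andP[ax _].
  have kx : `|k| `^ p < x by exact: lt_le_trans ax.
  (* The Lipschitz estimate is needed on both sides of x, hence a base level strictly between |k|^p
     and x. *)
  pose l0 := (`|k| `^ p + x) / 2.
  have h0 : `|k| `^ p < l0 by rewrite /l0; lra.
  have l0x : l0 < x by rewrite /l0; lra.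
  pose c := period l0 / (l0 - `|k| `^ p).
  have c0 : 0 < c by rewrite divr_gt0 ?subr_gt0// period_gt0.
  have L y z : l0 <= y -> y <= z -> `|period y - period z| <= (z - y) * c.
    move=> ly; rewrite le_eqVlt => /predU1P[->|yz]; first by rewrite !subrr normr0 mul0r.
    have := period_lipschitz h0 ly yz; rewrite mulrAC -mulrA /c.
    by rewrite ger0_norm// subr_ge0 ltW// period_decr// (lt_le_trans h0).
  apply/cvgrPdist_lt => e e0; near=> y.
  have yl0 : l0 <= y by apply/ltW; near: y; exact: lt_nbhsr.
  have yx : `|x - y| < e / c.
    by near: y; apply: (@nbhsx_ballx _ _ x (e / c)); rewrite divr_gt0.
  apply: (@le_lt_trans _ _ (`|x - y| * c)); last by rewrite -ltr_pdivlMr.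
  have [xy|yx'] := leP x y.
    rewrite [X in _ <= X * _]distrC; apply: le_trans (L _ _ (ltW l0x) xy) _.
    by rewrite ger0_norm ?subr_ge0.
  by rewrite distrC; apply: le_trans (L _ _ yl0 (ltW yx')) _; rewrite ler_wpM2r ?ler_norm// ltW.
- by rewrite ge_min (ltW bd) orbT/= le_max (le_trans d1 a1).
by rewrite in_itv/= => /andP[al _] ld; exists l => //; exact: lt_le_trans al.
Unshelve. all: by end_near. Qed.

End period.

(** * Gluing arches *)

Section glue.
Context {R : realType}.
Implicit Types (f g : R -> R) (c v x : R).

(** The value at the junction is prescribed apart from the two branches, because a branch built from
    the phase equation has only a limit there. *)
Definition glue c v f g x := if x == c then v else if x < c then f x else g x.

Lemma glue_eq c v f g : glue c v f g c = v.
Proof. by rewrite /glue eqxx. Qed.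

Lemma glue_lt c v f g x : x < c -> glue c v f g x = f x.
Proof. by move=> xc; rewrite /glue lt_eqF// xc. Qed.

Lemma glue_gt c v f g x : c < x -> glue c v f g x = g x.
Proof. by move=> xc; rewrite /glue gt_eqF// ltNge ltW. Qed.

Lemma near_glue_lt c v f g x : x < c -> \forall y \near x, f y = glue c v f g y.
Proof. by move=> xc; near=> y; rewrite glue_lt//; near: y; exact: lt_nbhsl.
Unshelve. all: by end_near. Qed.

Lemma near_glue_gt c v f g x : c < x -> \forall y \near x, g y = glue c v f g y.
Proof. by move=> xc; near=> y; rewrite glue_gt//; near: y; exact: lt_nbhsr.
Unshelve. all: by end_near. Qed.

Lemma near_cont f g x : (\forall y \near x, f y = g y) ->
  {for x, continuous f} -> {for x, continuous g}.
Proof.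
move=> fg; have := nbhs_singleton fg => fgx; rewrite /prop_for /continuous_at -fgx.
by apply: cvg_trans; apply: near_eq_cvg; apply: filterS fg => y ->.
Qed.

Lemma glue_cont c v f g x : (x < c -> {for x, continuous f}) ->
  (c < x -> {for x, continuous g}) ->
  (x = c -> f y @[y --> c^'-] --> v /\ g y @[y --> c^'+] --> v) ->
  {for x, continuous (glue c v f g)}.
Proof.
move=> H1 H2 H3; case: (ltgtP x c) => xc.
- exact: near_cont (near_glue_lt v f g xc) (H1 xc).
- exact: near_cont (near_glue_gt v f g xc) (H2 xc).
have [fv gv] := H3 xc; rewrite xc; apply/left_right_continuousP; rewrite glue_eq; split.
  apply: cvg_trans fv; apply: near_eq_cvg; near=> y; rewrite glue_lt//.
apply: cvg_trans gv; apply: near_eq_cvg; near=> y; rewrite glue_gt//.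
Unshelve. all: by end_near. Qed.

(** By the mean value theorem, a derivative that extends continuously to x is the derivative at x.
    This settles differentiability at the junctions. *)
Lemma is_derive_lim (F G : R -> R) x : {for x, continuous F} ->
  {for x, continuous G} ->
  (\forall y \near x, y != x -> is_derive y 1 F (G y)) -> is_derive x 1 F (G x).
Proof.
move=> cF cG dF; apply: is_derive_eps => e e0.
have /cvgrPdist_le/(_ _ e0) cGe := cG.
have /nbhs_ballP[r /= r0 hr] : nbhs x [set y | (y != x -> is_derive y 1 F (G y)) /\ `|G x - G y| <= e].
  exact: filterI.
have hr' y : `|x - y| < r -> (y != x -> is_derive y 1 F (G y)) /\ `|G x - G y| <= e by move=> xy; exact: hr.
apply/nbhs_ballP; exists r => //= y; rewrite /ball/= => xyr.
have cont z : `|x - z| < r -> {for z, continuous F}.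
  move=> zr; have [->//|zx] := eqVneq z x.
  by have [/(_ zx)/is_derive_cont] := hr' z zr.
case: (ltgtP x y) => xy; last by rewrite xy !subrr mulr0 subr0 normr0 mulr0.
- have sub z : x <= z <= y -> `|x - z| < r.
    move=> /andP[xz zy]; apply: le_lt_trans xyr.
    by rewrite ![`|x - _|]distrC !ger0_norm ?lerD2r// subr_ge0// (le_trans xz).
  have [||z] := @MVT R F G x y xy.
  + move=> z; rewrite in_itv/= => /andP[xz zy].
    by have [] := hr' z (sub z _); rewrite ?(ltW xz) ?(ltW zy)// gt_eqF// => /(_ isT).
  + apply: continuous_in_subspaceT => z; rewrite inE/= in_itv/= => xzy; exact: cont (sub z xzy).
  rewrite in_itv/= => /andP[xz zy] ->; rewrite -mulrBl normrM ler_wpM2r//.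
  by rewrite distrC; have [] := hr' z (sub z _); rewrite ?(ltW xz) ?(ltW zy).
- have sub z : y <= z <= x -> `|x - z| < r.
    move=> /andP[xz zy]; apply: le_lt_trans xyr.
    by rewrite !ger0_norm ?subr_ge0 ?(ltW xy)// lerB.
  have [||z] := @MVT R F G y x xy.
  + move=> z; rewrite in_itv/= => /andP[yz zx].
    by have [] := hr' z (sub z _); rewrite ?(ltW yz) ?(ltW zx)// lt_eqF// => /(_ isT).
  + apply: continuous_in_subspaceT => z; rewrite inE/= in_itv/= => xzy; exact: cont (sub z xzy).
  rewrite in_itv/= => /andP[yz zx] E.
  have -> : F y - F x - G x * (y - x) = (G z - G x) * (y - x).
    by rewrite -[F y - F x]opprB E; ring.
  rewrite normrM ler_wpM2r//.
  by rewrite distrC; have [] := hr' z (sub z _); rewrite ?(ltW yz) ?(ltW zx).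
Qed.

Lemma glue_derive c v w f g f' g' x :
  {for x, continuous (glue c v f g)} -> {for x, continuous (glue c w f' g')} ->
  (\forall y \near x, y < c -> is_derive y 1 f (f' y)) ->
  (\forall y \near x, c < y -> is_derive y 1 g (g' y)) ->
  is_derive x 1 (glue c v f g) (glue c w f' g' x).
Proof.
move=> c1 c2 df dg.
have D : \forall y \near x, y != c -> is_derive y 1 (glue c v f g) (glue c w f' g' y).
  near=> y; case: ltgtP => // yc _.
    rewrite glue_lt//; apply: near_eq_is_derive (near_glue_lt v f g yc) _.
    by move: yc; near: y.
  rewrite glue_gt//; apply: near_eq_is_derive (near_glue_gt v f g yc) _.
  by move: yc; near: y.
have [xc|xc] := eqVneq x c; last by have := nbhs_singleton D; exact.
by apply: is_derive_lim => //; rewrite xc in D *.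
Unshelve. all: by end_near. Qed.

End glue.

(** * One arch, and chains of arches of alternating sign *)

Section base.
Context {R : realType}.
Variables (p k lam : R).
Hypothesis p1 : 1 < p.
Hypothesis lamk : `|k| `^ p < lam.
Let p0 : 0 < p. Proof. exact: lt_trans p1. Qed.
Let p10 : 0 < p - 1. Proof. by rewrite subr_gt0. Qed.
Local Notation T := (period p k lam).
Local Notation phase := (phase p k lam).
Local Notation namp := (namp p k lam).
Local Notation nslope := (nslope p k).
Local Notation dlim := (dlim p).
Local Notation hamil := (hamil p k).

Definition unphase x := xget 0 [set z | phase z = x].

Lemma phaseK : cancel phase unphase.
Proof.
move=> z; rewrite /unphase; case: xgetP => [y _ /= yz|/(_ z) []//].
by apply: (inc_inj _ yz) => a b; rewrite (le_mono (phase_incr p1 lamk)).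
Qed.

Lemma unphaseK x : 0 < x < T -> phase (unphase x) = x.
Proof.
move=> /andP[x0 xT]; rewrite /unphase; case: xgetP => [//|Hx]; exfalso.
have [a ax] : exists a, phase a < x.
  have /cvgr0Pnorm_lt/(_ _ x0) := phase_ninfty p1 lamk => H.
  near (ninfty_nbhs R) => a; exists a.
  apply: le_lt_trans (ler_norm _) _; near: a; exact: H.
have [b bx] : exists b, x < phase b.
  have Tx : 0 < T - x by rewrite subr_gt0.
  have /cvgrPdist_lt/(_ _ Tx) := phase_pinfty p1 lamk => H.
  near (pinfty_nbhs R) => b; exists b.
  suff : T - phase b < T - x by lra.
  apply: le_lt_trans (ler_norm _) _; near: b; exact: H.
have ab : a < b by rewrite -(leW_mono (le_mono (phase_incr p1 lamk))) (lt_trans ax).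
have [||z _ /Hx//] := @IVT R phase a b x (ltW ab).
- apply: continuous_subspaceT => z; exact: is_derive_cont (is_derive_phase p1 lamk z).
- by rewrite ge_min (ltW ax)/= le_max (ltW bx) orbT.
Unshelve. all: by end_near. Qed.

(** The arch starts at z = +oo with phase T, and the phase decreases at unit speed; so the phase at
    x is T - x, and z reaches -oo at x = T. *)
Definition zsol x := unphase (T - x).

Lemma zsol_phase x : 0 < x < T -> phase (zsol x) = T - x.
Proof. by move=> /andP[x0 xT]; rewrite unphaseK//; lra. Qed.

Lemma is_derive_zsol (x : R) : 0 < x < T ->
  is_derive x 1 zsol (- (lam + hamil (zsol x))).
Proof.
move=> x0T; have e0 := energy_gt0 p1 lamk (zsol x).
have d1 : is_derive (phase (zsol x)) 1 unphase (rate p k lam (zsol x))^-1.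
  apply: is_derive_inverse.
  - by near=> z; exact: phaseK.
  - by near=> z; exact: is_derive_cont (is_derive_phase p1 lamk z).
  - exact: is_derive_phase.
  - by rewrite gt_eqF// rate_gt0.
rewrite zsol_phase// in d1.
have d2 : is_derive x 1 (fun y => T - y) (- 1).
  by apply: (trigger_derive (is_deriveB (is_derive_cst T x 1) (is_derive_id x 1))); rewrite sub0r.
apply: (trigger_derive (@is_derive1_comp R unphase (fun y => T - y) x _ _ d1 d2)).
by rewrite /rate invrK mulrN1.
Unshelve. all: by end_near. Qed.

Lemma zsol_right : zsol x @[x --> 0^'+] --> +oo.
Proof.
apply/cvgryPge => M; near=> x.
have x0 : 0 < x by [].
have xM : x < T - phase M by near: x; apply: nbhs_right_lt; rewrite subr_gt0 phase_lt.
have xT : x < T by have := phase_gt0 p1 lamk M; lra.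
rewrite -(le_mono (phase_incr p1 lamk)) zsol_phase ?x0//; lra.
Unshelve. all: by end_near. Qed.

Lemma zsol_left : zsol x @[x --> T^'-] --> -oo.
Proof.
apply/cvgrNyPle => M; near=> x.
have xT : x < T by [].
have xM : T - phase M < x by near: x; apply: nbhs_left_gt; rewrite ltrBlDr ltrDl phase_gt0.
have x0 : 0 < x by have := phase_lt p1 lamk M; lra.
rewrite -(le_mono (phase_incr p1 lamk)) zsol_phase ?x0//; lra.
Unshelve. all: by end_near. Qed.

Lemma is_derive_namp (z : R) : is_derive z 1 namp (- nslope z * namp z / (lam + hamil z)).
Proof.
have e0 := energy_gt0 p1 lamk z.
have d1 := is_deriveD (is_derive_cst lam z 1) (is_derive_hamil k p1 z).
apply: (trigger_derive (@is_derive1_comp R (fun x => x `^ (- p^-1)) (fun z => lam + hamil z) z _ _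
  (is_derive1_powR (- p^-1) e0) d1)).
rewrite add0r powRB ?(gt_eqF e0) ?implybT// powRr1 ?(ltW e0)//.
rewrite -[namp z]/((lam + hamil z) `^ (- p^-1)).
by field; rewrite !gt_eqF.
Qed.

(** The derivative that the equation prescribes for the flux of the arch, as a function of z. *)
Definition nh z := k ^+ 2 * gradn k (namp z) (nslope z * namp z) `^ (p - 2) * namp z
  - lam * namp z `^ (p - 1).

Lemma is_derive_umid (x : R) : 0 < x < T ->
  is_derive x 1 (namp \o zsol) (nslope (zsol x) * namp (zsol x)).
Proof.
move=> x0T; have e0 := energy_gt0 p1 lamk (zsol x).
apply: (trigger_derive (is_derive1_comp (is_derive_namp (zsol x)) (is_derive_zsol x0T))).
by field; rewrite gt_eqF.
Qed.

(** With u = [namp (zsol x)], the product rule gives u^(p-1) ((p - 1) Q z - lam - N). Since N = ((p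
    - 1) Q^2 - k^2) g^(p-2) and z = g^(p-2) Q, where g is the norm of (k, Q), the terms with p - 1
    cancel. *)
Lemma is_derive_wmid (x : R) : 0 < x < T ->
  is_derive x 1 (fun x => namp (zsol x) `^ (p - 1) * zsol x) (nh (zsol x)).
Proof.
move=> x0T; have e0 := energy_gt0 p1 lamk (zsol x).
have n0 := namp_gt0 p1 lamk (zsol x).
have d1 := @is_derive1_comp R (fun y => y `^ (p - 1)) (namp \o zsol) x _ _
  (is_derive1_powR (p - 1) n0) (is_derive_umid x0T).
have d2 := is_deriveM d1 (is_derive_zsol x0T).
apply: (trigger_derive d2); rewrite /GRing.scale/= /nh.
rewrite (_ : p - 1 - 1 = p - 2); last by ring.
have -> : gradn k (namp (zsol x)) (nslope (zsol x) * namp (zsol x)) =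
    namp (zsol x) * gradn k 1 (nslope (zsol x)).
  by rewrite [nslope _ * _]mulrC -gradnM ?ltW// mulr1.
rewrite powRM ?gradn_ge0 ?ltW// -!(powRM1 p1 (ltW n0)) hamilE//.
have gz : gradn k 1 (nslope (zsol x)) `^ (p - 2) * nslope (zsol x) = zsol x.
  exact: nslopeK.
have alg (a n g q : R) : a * n * - (lam + ((p - 1) * q ^+ 2 - k ^+ 2) * g)
    + g * q * ((p - 1) * a * (q * n)) = k ^+ 2 * (a * g) * n - lam * (a * n).
  by ring.
by rewrite -(alg _ _ _ (nslope (zsol x))) gz.
Qed.

Lemma nh_pinfty : nh z @[z --> +oo] --> 0.
Proof.
have g0 : gradn k 0 dlim = dlim.
  by rewrite /gradn expr0n/= mulr0 add0r sqrtr_sqr ger0_norm// ltW// dlim_gt0.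
have gt0 : 0 < gradn k 0 dlim by rewrite g0 dlim_gt0.
have /is_derive_cont c := is_derive1_powR (p - 2) gt0.
have h : gradn k (namp z) (nslope z * namp z) @[z --> +oo] --> gradn k 0 dlim.
  by apply: cvg_gradn; [exact: namp_pinfty|exact: nslope_namp_pinfty].
have hc := cvg_comp _ _ h c.
rewrite (_ : 0 = k ^+ 2 * gradn k 0 dlim `^ (p - 2) * 0 - lam * 0 `^ (p - 1)); last first.
  by rewrite powR0 ?gt_eqF// !mulr0 subr0.
apply: cvgB.
  apply: cvgM; last exact: namp_pinfty.
  by apply: cvgM; [exact: cvg_cst|exact: hc].
apply: cvgM; first exact: cvg_cst.
apply: cvg_powR => //; last exact: namp_pinfty.
by move=> z; rewrite ltW// namp_gt0.
Qed.

Lemma nhN z : nh (- z) = nh z.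
Proof. by rewrite /nh (nampN k p1) (nslopeN k p1) mulNr gradnNr. Qed.

Lemma cvg_even (f : R -> R) (l : R) : (forall z, f (- z) = f z) -> f z @[z --> +oo] --> l ->
  f z @[z --> -oo] --> l.
Proof. by move=> ev fl; apply/cvgNy_compNP; rewrite (_ : _ \o _ = f)//; apply/funext => z /=. Qed.

Lemma cvg_odd (f : R -> R) (l : R) : (forall z, f (- z) = - f z) -> f z @[z --> +oo] --> l ->
  f z @[z --> -oo] --> - l.
Proof.
move=> ev fl; apply/cvgNy_compNP; rewrite (_ : _ \o _ = \- f); first exact: cvgN.
by apply/funext => z /=.
Qed.

(* One arch, its slope, its flux and the derivative of its flux, extended to
   functions of class C^1 on the line. *)
Definition ubase := glue 0 0 (fun x => dlim * x) (glue T 0 (namp \o zsol) (fun x => - dlim * (x - T))).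
Definition dbase := glue 0 dlim (cst dlim)
  (glue T (- dlim) (fun x => nslope (zsol x) * namp (zsol x)) (cst (- dlim))).
Definition wbase := glue 0 (dlim `^ (p - 1)) (cst (dlim `^ (p - 1)))
  (glue T (- dlim `^ (p - 1)) (fun x => namp (zsol x) `^ (p - 1) * zsol x) (cst (- dlim `^ (p - 1)))).
Definition hbase := glue 0 0 (cst 0) (glue T 0 (nh \o zsol) (cst 0)).

(** Inside (0, T) each of the four functions of the arch is a function [Phi] of z, so continuity at
    0 and at T amounts to the limits of [Phi] at +oo and at -oo. *)
Lemma base_cont v1 v2 (l r m Phi : R -> R) :
  continuous l -> continuous r -> l 0 = v1 -> r T = v2 ->
  m = Phi \o zsol -> (continuous Phi) ->
  Phi z @[z --> +oo] --> v1 -> Phi z @[z --> -oo] --> v2 ->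
  continuous (glue 0 v1 l (glue T v2 m r)).
Proof.
move=> cl cr l0 rT -> cPhi P1 P2 x; have T0 := period_gt0 p1 lamk.
have mid y : 0 < y < T -> {for y, continuous (Phi \o zsol)}.
  by move=> y0T; apply: continuous_comp; [exact: is_derive_cont (is_derive_zsol y0T)|exact: cPhi].
apply: glue_cont => [_|x0|_]; first exact: cl.
  apply: glue_cont => [xT|_|_]; [by apply: mid; rewrite x0|exact: cr|split].
    exact: cvg_comp zsol_left P2.
  by rewrite -rT; apply: cvg_at_right_filter; exact: cr.
split; first by rewrite -l0; apply: cvg_at_left_filter; exact: cl.
apply: cvg_trans (cvg_comp _ _ zsol_right P1); apply: near_eq_cvg; near=> y.
by rewrite glue_lt//; near: y; exact: nbhs_right_lt.
Unshelve. all: by end_near. Qed.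

Lemma base_derive v1 v2 w1 w2 (l r m l' r' m' : R -> R) :
  continuous (glue 0 v1 l (glue T v2 m r)) ->
  continuous (glue 0 w1 l' (glue T w2 m' r')) ->
  (forall x : R, is_derive x 1 l (l' x)) -> (forall x : R, is_derive x 1 r (r' x)) ->
  (forall x : R, 0 < x < T -> is_derive x 1 m (m' x)) ->
  forall x : R, is_derive x 1 (glue 0 v1 l (glue T v2 m r)) (glue 0 w1 l' (glue T w2 m' r') x).
Proof.
move=> c1 c2 dl dr dm x; apply: glue_derive; [exact: c1|exact: c2|..].
  by near=> y => _; exact: dl.
near=> y => y0.
have e1 := near_glue_gt v1 l (glue T v2 m r) y0.
have e2 := near_glue_gt w1 l' (glue T w2 m' r') y0.
apply: glue_derive.
- apply: near_cont (c1 y); apply: filterS e1 => z ->//.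
- apply: near_cont (c2 y); apply: filterS e2 => z ->//.
- by near=> z => zT; apply: dm; rewrite zT andbT; near: z; exact: lt_nbhsr.
- by near=> z => _; exact: dr.
Unshelve. all: by end_near. Qed.

Lemma namp_cont : continuous namp.
Proof. by move=> z; exact: is_derive_cont (is_derive_namp z). Qed.

Lemma gradn_cont : continuous (fun z => gradn k (namp z) (nslope z * namp z)).
Proof.
move=> z; apply: cvg_gradn; first exact: namp_cont.
by apply: cvgM; [exact: nslope_cont|exact: namp_cont].
Qed.

Lemma nh_cont : continuous nh.
Proof.
move=> z; have n0 := namp_gt0 p1 lamk z.
apply: cvgB; last first.
  apply: cvgM; first exact: cvg_cst.
  have n00 t : 0 <= namp t := ltW (namp_gt0 p1 lamk t).
  exact: (cvg_powR p10 n00 (n00 z) (@namp_cont z)).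
(* For k = 0 the gradient vanishes at z = 0, where its power p - 2 may be discontinuous; the factor
   k^2 removes that term. *)
have [k0|kn0] := eqVneq k 0.
  have k20 : k ^+ 2 = 0 by rewrite k0 expr0n.
  rewrite [X in _ --> X](_ : _ = 0); last by rewrite k20 !mul0r.
  by apply: cvg_near_cst; near=> t; rewrite k20 !mul0r.
have g0 : 0 < gradn k (namp z) (nslope z * namp z).
  apply: lt_le_trans (le_gradn_fst _ _ _).
  by rewrite mulr_gt0 ?normr_gt0// gt_eqF.
apply: cvgM; last exact: namp_cont.
apply: cvgM; first exact: cvg_cst.
have /is_derive_cont c := is_derive1_powR (p - 2) g0.
exact: cvg_comp (@gradn_cont z) c.
Unshelve. all: by end_near. Qed.

Lemma dbase_cont : continuous dbase.
Proof.
apply: (@base_cont _ _ _ _ _ (fun z => nslope z * namp z)) => //.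
- by move=> x; exact: cvg_cst.
- by move=> x; exact: cvg_cst.
- by move=> z; apply: cvgM; [exact: nslope_cont|exact: namp_cont].
- exact: nslope_namp_pinfty.
- apply: cvg_odd; last exact: nslope_namp_pinfty.
  by move=> z; rewrite nslopeN// nampN// mulNr.
Qed.

Lemma ubase_cont : continuous ubase.
Proof.
apply: (@base_cont _ _ _ _ _ namp) => //.
- by move=> x; apply: cvgM; [exact: cvg_cst|exact: cvg_id].
- move=> x; apply: cvgM; first exact: cvg_cst.
  by apply: cvgB; [exact: cvg_id|exact: cvg_cst].
- by rewrite mulr0.
- by rewrite subrr mulr0.
- exact: namp_cont.
- exact: namp_pinfty.
- by apply: cvg_even; [move=> z; exact: nampN|exact: namp_pinfty].
Qed.

Lemma wbase_cont : continuous wbase.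
Proof.
apply: (@base_cont _ _ _ _ _ (fun z => namp z `^ (p - 1) * z)) => //.
- by move=> x; exact: cvg_cst.
- by move=> x; exact: cvg_cst.
- move=> z; apply: cvgM; last exact: cvg_id.
  have n00 t : 0 <= namp t := ltW (namp_gt0 p1 lamk t).
  exact: (cvg_powR p10 n00 (n00 z) (@namp_cont z)).
- exact: namp_flux_pinfty.
- apply: cvg_odd; last exact: namp_flux_pinfty.
  by move=> z; rewrite nampN// mulrN.
Qed.

Lemma hbase_cont : continuous hbase.
Proof.
apply: (@base_cont _ _ _ _ _ nh) => //.
- by move=> x; exact: cvg_cst.
- by move=> x; exact: cvg_cst.
- exact: nh_cont.
- exact: nh_pinfty.
- by apply: cvg_even; [exact: nhN|exact: nh_pinfty].
Qed.

Lemma is_derive_ubase (x : R) : is_derive x 1 ubase (dbase x).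
Proof.
apply: base_derive; [exact: ubase_cont|exact: dbase_cont|..].
- move=> y; apply: (trigger_derive (is_deriveZ dlim (is_derive_id y 1))).
  by rewrite /GRing.scale/= mulr1.
- move=> y; have d := is_deriveB (is_derive_id y 1) (is_derive_cst T y 1).
  by apply: (trigger_derive (is_deriveZ (- dlim) d)); rewrite /GRing.scale/= subr0 mulr1.
- exact: is_derive_umid.
Qed.

Lemma is_derive_wbase (x : R) : is_derive x 1 wbase (hbase x).
Proof.
apply: base_derive; [exact: wbase_cont|exact: hbase_cont|..].
- exact: is_derive_wmid.
Qed.

(** The flux [w] and its derivative [h] are separate functions because u' need not be
    differentiable. Regularity is asked on the whole line, so that arches can be shifted and glued,
    and the equation only inside (0, b). *)
Definition csol b (u d w h : R -> R) :=
  [/\ [/\ forall x : R, is_derive x 1 u (d x), continuous d,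
        forall x : R, is_derive x 1 w (h x) & continuous h],
      forall x, 0 < x < b -> w x = gradn k (u x) (d x) `^ (p - 2) * d x &
      forall x, 0 < x < b -> h x = (k ^+ 2 * gradn k (u x) (d x) `^ (p - 2)
        - lam * `|u x| `^ (p - 2)) * u x].

Lemma base_csol : csol T ubase dbase wbase hbase.
Proof.
have mid (v1 v2 : R) (l r m : R -> R) x : 0 < x < T -> glue 0 v1 l (glue T v2 m r) x = m x.
  by move=> /andP[x0 xT]; rewrite glue_gt// glue_lt.
split; first by split; [exact: is_derive_ubase|exact: dbase_cont|exact: is_derive_wbase|exact: hbase_cont].
  by move=> x x0T; rewrite /ubase /dbase /wbase !mid//= namp_flux.
move=> x x0T; rewrite /ubase /dbase /hbase !mid//= /nh.
have n0 := namp_gt0 p1 lamk (zsol x).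
by rewrite gtr0_norm// -(powRM1 p1 (ltW n0)); ring.
Qed.

Lemma ubase_mid x : 0 < x < T -> ubase x = namp (zsol x).
Proof. by move=> /andP[x0 xT]; rewrite /ubase glue_gt// glue_lt. Qed.

(** The equation is odd, so [s] times an arch is again a solution when [s] is 1 or -1. Taking for
    [s] the sign of the slope at b makes slope and flux agree at the junction. *)
Lemma csol_glue b (s : R) u d w h : 0 < b -> s ^+ 2 = 1 -> csol b u d w h ->
  u b = 0 -> d b = s * dlim -> w b = s * dlim `^ (p - 1) -> h b = 0 ->
  csol (b + T) (glue b 0 u (fun x => s * ubase (x - b)))
    (glue b (s * dlim) d (fun x => s * dbase (x - b)))
    (glue b (s * dlim `^ (p - 1)) w (fun x => s * wbase (x - b)))
    (glue b 0 h (fun x => s * hbase (x - b))).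
Proof.
move=> b0 s1 [[du cd dw ch] wE hE] ub db wb hb.
have [[du0 cd0 dw0 ch0] wE0 hE0] := base_csol.
have T0 := period_gt0 p1 lamk.
have shift (f g : R -> R) : (forall x : R, is_derive x 1 f (g x)) ->
    forall x : R, is_derive x 1 (fun x => s * f (x - b)) (s * g (x - b)).
  move=> df x; have d1 := is_deriveB (is_derive_id x 1) (is_derive_cst b x 1).
  have d2 := is_deriveZ s (@is_derive1_comp R f (fun x => x - b) x _ _ (df _) d1).
  by apply: (trigger_derive d2); rewrite /GRing.scale/= subr0 mulr1.
have cshift (f : R -> R) : continuous f -> continuous (fun x => s * f (x - b)).
  move=> cf x; apply: cvgM; first exact: cvg_cst.
  have h1 : y - b @[y --> x] --> x - b by apply: cvgB; [exact: cvg_id|exact: cvg_cst].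
  exact: cvg_comp h1 (cf _).
have gc (f g : R -> R) v : continuous f -> continuous g -> f b = v -> s * g 0 = v ->
    continuous (glue b v f (fun x => s * g (x - b))).
  move=> cf cg fb g0 x; apply: glue_cont => [_|_|_]; [exact: cf|exact: cshift|split].
    by rewrite -fb; apply: cvg_at_left_filter; exact: cf.
  by rewrite -g0 -(subrr b); apply: cvg_at_right_filter; exact: (cshift _ cg b).
have gd (f g f' g' : R -> R) v v' : (forall x : R, is_derive x 1 f (f' x)) ->
    (forall x : R, is_derive x 1 g (g' x)) -> continuous f' -> continuous g' ->
    f b = v -> s * g 0 = v -> f' b = v' -> s * g' 0 = v' -> forall x : R,
    is_derive x 1 (glue b v f (fun x => s * g (x - b))) (glue b v' f' (fun x => s * g' (x - b)) x).
  move=> df dg cf' cg' fb g0 f'b g'0 x; apply: glue_derive.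
  - apply: gc => // y; [exact: is_derive_cont (df y)|exact: is_derive_cont (dg y)].
  - exact: gc.
  - by near=> y => _; exact: df.
  - by near=> y => _; exact: shift.
have u0 : ubase 0 = 0 by rewrite /ubase glue_eq.
have d0 : dbase 0 = dlim by rewrite /dbase glue_eq.
have w0 : wbase 0 = dlim `^ (p - 1) by rewrite /wbase glue_eq.
have h0 : hbase 0 = 0 by rewrite /hbase glue_eq.
have sn : `|s| = 1 by apply/eqP; rewrite -sqr_norm_eq1 s1.
have gs x y : gradn k (s * x) (s * y) = gradn k x y.
  by rewrite /gradn !exprMn s1 !mul1r.
have gb : gradn k 0 dlim = dlim.
  by rewrite /gradn expr0n/= mulr0 add0r sqrtr_sqr ger0_norm// ltW// dlim_gt0.
split.
- split.
  + by apply: gd; rewrite // ?u0 ?d0 ?mulr0.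
  + by apply: gc; rewrite // d0.
  + by apply: gd; rewrite // ?w0 ?h0 ?mulr0.
  + by apply: gc; rewrite // h0 mulr0.
- move=> x /andP[x0 xb]; case: (ltgtP x b) => xb'.
  + by rewrite !glue_lt// wE// x0.
  + by rewrite !glue_gt// gs wE0; [ring|lra].
  + have gs0 : gradn k 0 (s * dlim) = dlim by rewrite -[X in gradn k X](mulr0 s) gs gb.
    by rewrite xb' !glue_eq gs0 -(powRM1 p1 (ltW (dlim_gt0 p1))); ring.
- move=> x /andP[x0 xb]; case: (ltgtP x b) => xb'.
  + by rewrite !glue_lt// hE// x0.
  + by rewrite !glue_gt// gs hE0 ?normrM ?sn ?mul1r; [ring|lra].
  + by rewrite xb' !glue_eq mulr0.
Unshelve. all: by end_near. Qed.

(** After n arches the slope has the sign (-1)^n, which is the sign of the next arch. The formula on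
    the first nodal interval later shows that u is not zero, and it is the reference arch for
    simplicity. *)
Lemma csol_exists n : (0 < n)%N -> exists u d w h, [/\ csol (n%:R * T) u d w h,
  [/\ u 0 = 0, forall x, 0 < x < T -> u x = namp (zsol x) & u (n%:R * T) = 0],
  d (n%:R * T) = (- 1) ^+ n * dlim, w (n%:R * T) = (- 1) ^+ n * dlim `^ (p - 1) &
  h (n%:R * T) = 0].
Proof.
have T0 := period_gt0 p1 lamk.
have endE (v1 v2 : R) (l r m : R -> R) : glue 0 v1 l (glue T v2 m r) T = v2.
  by rewrite glue_gt// glue_eq.
case: n => // n _; elim: n => [|n [u [d [w [h [S [u0 uE ub] db wb hb]]]]]].
  exists ubase, dbase, wbase, hbase; rewrite mul1r expr1 !mulN1r; split.
  - exact: base_csol.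
  - split; [by rewrite /ubase glue_eq|by move=> x; exact: ubase_mid|exact: endE].
  - exact: endE.
  - exact: endE.
  - exact: endE.
set b := n.+1%:R * T in S ub db wb hb.
have b0 : 0 < b by rewrite mulr_gt0.
have Tb : T <= b by rewrite /b -[leLHS]mul1r ler_pM2r// ler1n.
have bT : n.+2%:R * T = b + T by rewrite /b -[n.+2]addn1 natrD mulrDl mul1r.
have s1 : ((- 1) ^+ n.+1) ^+ 2 = 1 :> R by rewrite sqrr_sign.
have := csol_glue b0 s1 S ub db wb hb; rewrite bT => S'.
do 4 eexists; split; first exact: S'.
- split.
  + by rewrite glue_lt.
  + by move=> x /andP[x0 xT]; rewrite glue_lt ?uE ?x0//; exact: lt_le_trans Tb.
  + by rewrite glue_gt ?ltrDl// addrAC subrr add0r [ubase _]endE mulr0.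
- by rewrite glue_gt ?ltrDl// addrAC subrr add0r [dbase _]endE [in RHS]exprS mulN1r mulrN mulNr.
- by rewrite glue_gt ?ltrDl// addrAC subrr add0r [wbase _]endE [in RHS]exprS mulN1r mulrN mulNr.
- by rewrite glue_gt ?ltrDl// addrAC subrr add0r [hbase _]endE mulr0.
Qed.

End base.

(** * Integrals and primitives on the unit interval *)

Section integral.
Context {R : realType}.
Local Notation mu := (@lebesgue_measure R).
Local Notation Int A f := (mu.-integrable A (EFin \o f)).
Implicit Types (f g : R -> R) (A B : set (measurableTypeR R)).

Lemma ae_imp (P Q : R -> Prop) : (forall x, P x -> Q x) ->
  {ae mu, forall x, P x} -> {ae mu, forall x, Q x}.
Proof.
by move=> PQ; apply: filterS; first exact: (ae_filter_ringOfSetsType mu).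
Qed.

Lemma ae_imp2 (P Q S : R -> Prop) : (forall x, P x -> Q x -> S x) ->
  {ae mu, forall x, P x} -> {ae mu, forall x, Q x} -> {ae mu, forall x, S x}.
Proof.
by move=> PQS; apply: filterS2; first exact: (ae_filter_ringOfSetsType mu).
Qed.

Lemma measurable_I01 : measurable (@I01 R : set (measurableTypeR R)).
Proof. exact: measurable_itv. Qed.

Lemma mu_I01 : mu (@I01 R) = 1%E.
Proof. by rewrite /I01 lebesgue_measure_itv/= lte01 oppr0 adde0. Qed.

Lemma IntS A B f : measurable A -> measurable B -> B `<=` A -> Int A f -> Int B f.
Proof. by move=> mA mB BA; exact: integrableS. Qed.

Lemma Int_meas A f : Int A f -> measurable_fun A f.
Proof. by move=> /measurable_int/measurable_EFinP. Qed.

Lemma IntD A f g : measurable A -> Int A f -> Int A g -> Int A (fun x => f x + g x).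
Proof. by move=> mA fi gi; exact: (integrableD mA fi gi). Qed.

Lemma IntB A f g : measurable A -> Int A f -> Int A g -> Int A (fun x => f x - g x).
Proof. by move=> mA fi gi; exact: (integrableB mA fi gi). Qed.

Lemma IntZ A f (c : R) : measurable A -> Int A f -> Int A (fun x => c * f x).
Proof. by move=> mA fi; exact: (integrableZl mA c fi). Qed.

Lemma IntN A f : Int A f -> Int A (fun x => - f x).
Proof. exact: integrableN. Qed.

Lemma Int_norm A f : Int A f -> Int A (fun x => `|f x|).
Proof. exact: integrable_abse. Qed.

Lemma Int_le A f g : measurable A -> measurable_fun A f -> Int A g ->
  (forall x, A x -> `|f x| <= g x) -> Int A f.
Proof.
move=> mA mf gi fg; apply: le_integrable (gi) => //; first exact/measurable_EFinP.
by move=> x Ax /=; rewrite lee_fin (le_trans (fg x Ax))// ler_norm.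
Qed.

Lemma Int_cst A (c : R) : measurable A -> (mu A < +oo)%E -> Int A (cst c).
Proof.
move=> mA fA; apply: measurable_bounded_integrable => //.
exists `|c|; split; first exact: num_real.
by move=> y cy x _ /=; exact: ltW.
Qed.

Lemma mu_itv_fin (a b : R) : (mu `]a, b[%classic < +oo)%E.
Proof. by rewrite lebesgue_measure_itv/=; case: ifP => _; rewrite -?EFinB ltry. Qed.

Lemma Int_cst_itv (a b c : R) : Int `]a, b[%classic (cst c).
Proof. by apply: Int_cst => //; exact: mu_itv_fin. Qed.

Lemma Int_cont (a b : R) f : continuous f -> Int `]a, b[%classic f.
Proof.
move=> cf; apply: (@IntS `[a, b]%classic) => //; first exact: subset_itv_oo_cc.
apply: continuous_compact_integrable; first exact: segment_compact.
exact: continuous_subspaceT.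
Qed.

Lemma bounded_itv (a b : R) f : continuous f -> exists2 M, 0 < M & forall x, a <= x <= b -> `|f x| <= M.
Proof.
move=> cf; have cnf : {within `[a, b], continuous (fun x => `|f x|)}.
  by apply: continuous_subspaceT => x; apply: cvg_norm; exact: cf.
have [ab|ba] := leP a b; last by exists 1 => // x; lra.
have [c _ H] := EVT_max ab cnf; exists (`|f c| + 1); first by rewrite ltr_wpDl.
by move=> x xab; apply: le_trans (H x _) _; rewrite ?in_itv//= lerDl.
Qed.

Lemma Int_mul_bounded A f g (M : R) : measurable A -> Int A f -> measurable_fun A g ->
  (forall x, A x -> `|g x| <= M) -> Int A (fun x => f x * g x).
Proof.
move=> mA fi mg gM; apply: (@Int_le _ _ (fun x => M * `|f x|)) => //.
- by apply: measurable_funM => //; exact: Int_meas.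
- exact: IntZ (Int_norm fi).
by move=> x Ax; rewrite normrM mulrC ler_wpM2r// gM.
Qed.

Lemma ae_eq_Rintegral A f g : measurable A -> measurable_fun A f -> measurable_fun A g ->
  {ae mu, forall x, A x -> f x = g x} -> \int[mu]_(x in A) f x = \int[mu]_(x in A) g x.
Proof.
move=> mA mf mg fg; congr fine; apply: ae_eq_integral => //; [exact/measurable_EFinP..|].
by apply: ae_imp fg => x fgx Ax /=; rewrite fgx.
Qed.

Lemma ae_ge0_Rintegral A f : measurable A -> measurable_fun A f ->
  {ae mu, forall x, A x -> 0 <= f x} -> 0 <= \int[mu]_(x in A) f x.
Proof.
move=> mA mf f0; rewrite (@ae_eq_Rintegral _ _ (fun x => `|f x|))//.
- by apply: Rintegral_ge0.
- exact: measurableT_comp.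
- by apply: ae_imp f0 => x h Ax; rewrite ger0_norm// h.
Qed.

Lemma ae_le_Rintegral A f g : measurable A -> Int A f -> Int A g ->
  {ae mu, forall x, A x -> f x <= g x} ->
  \int[mu]_(x in A) f x <= \int[mu]_(x in A) g x.
Proof.
move=> mA fi gi fg; rewrite -subr_ge0 -RintegralB//; apply: ae_ge0_Rintegral => //.
  by apply: measurable_funB; exact: Int_meas.
by apply: ae_imp fg => x h Ax; rewrite subr_ge0 h.
Qed.

Lemma Rintegral_cst_itv (a b c : R) : a <= b -> \int[mu]_(x in `]a, b[) c = c * (b - a).
Proof.
move=> ab; rewrite Rintegral_cst//; congr (_ * _).
have H := @lebesgue_measure_itv R `]a, b[; apply: etrans (congr1 fine H) _.
rewrite /= lte_fin; case: ltP => [//|ba].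
have -> : a = b by apply/le_anti; rewrite ab ba.
by rewrite subrr.
Qed.

Lemma Rintegral_split f (a c b : R) : a <= c -> c <= b -> Int `]a, b[ f ->
  \int[mu]_(x in `]a, b[) f x = \int[mu]_(x in `]a, c[) f x + \int[mu]_(x in `]c, b[) f x.
Proof.
rewrite le_eqVlt => /predU1P[<- _ _|ac].
  by rewrite set_itvoo0 ?lexx// Rintegral_set0 add0r.
rewrite le_eqVlt => /predU1P[<- _|cb fi].
  by rewrite [in X in _ + X]set_itvoo0 ?lexx// Rintegral_set0 addr0.
have s1 : Int `]a, c[ f.
  by apply: IntS fi => //; apply: subset_itvl; rewrite bnd_simp ltW.
have s1' : Int `]a, c] f.
  by apply: IntS fi => //; apply: subset_itvl; rewrite bnd_simp.
have E := @Rintegral_itvB R f (BRight a) (BLeft b) c fi.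
by rewrite (Rintegral_itv_bndo_bndc s1) -E ?bnd_simp ?(ltW ac)//; ring.
Qed.

Lemma FTC_itv f (g : R -> R) (a b : R) : a <= b -> (forall x : R, is_derive x 1 f (g x)) -> continuous g ->
  \int[mu]_(x in `]a, b[) g x = f b - f a.
Proof.
rewrite le_eqVlt => /predU1P[<- _ _|ab df cg]; first by rewrite set_itvoo0 ?lexx// Rintegral_set0 subrr.
have gi : Int `[a, b] g.
  by apply: continuous_compact_integrable; [exact: segment_compact|exact: continuous_subspaceT].
have fc x : f y @[y --> x] --> f x by exact: is_derive_cont (df x).
have H : (\int[mu]_(x in `[a, b]) (g x)%:E = (f b)%:E - (f a)%:E)%E.
  apply: continuous_FTC2 => //; first exact: continuous_subspaceT.
    split; first by move=> x _; have [] := df x.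
      exact: cvg_at_right_filter.
    exact: cvg_at_left_filter.
  by move=> x _; rewrite derive1E; have [_ ->] := df x.
rewrite (Rintegral_itv_bndo_bndc (Int_cont _ _ cg)) Rintegral_itv_obnd_cbnd.
  by rewrite /Rintegral H.
by apply: IntS gi => //; apply: subset_itvr; rewrite bnd_simp.
Qed.

Lemma le_Rintegral_set A B f : measurable A -> measurable B -> A `<=` B ->
  (forall x, 0 <= f x) -> Int B f -> \int[mu]_(x in A) f x <= \int[mu]_(x in B) f x.
Proof.
move=> mA mB AB f0 fi; rewrite /Rintegral fine_le//.
- by apply: integrable_fin_num => //; exact: IntS fi.
- exact: integrable_fin_num.
have mf : measurable_fun B (EFin \o f) := measurable_int mu fi.
by apply: (@ge0_subset_integral _ _ R mu A B mA mB (EFin \o f) mf _ AB) => x _; rewrite lee_fin.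
Qed.

Lemma ae0_Rintegral A f : measurable A -> Int A f -> \int[mu]_(x in A) `|f x| = 0 ->
  {ae mu, forall x, A x -> f x = 0}.
Proof.
move=> mA fi f0; have mf : measurable_fun A (EFin \o f) := measurable_int mu fi.
have : (\int[mu]_(x in A) `|(EFin \o f) x|)%E = 0.
  have := integrable_fin_num mA (Int_norm fi); rewrite fin_numE => /andP[_ _].
  have /fineK <- := integrable_fin_num mA (Int_norm fi).
  by rewrite (_ : fine _ = 0).
move/(ae_eq_integral_abs _ mA mf); apply: ae_imp => x h Ax.
by have /= := h Ax; case.
Qed.

End integral.

Section primitive.
Context {R : realType}.
Local Notation mu := (@lebesgue_measure R).
Local Notation Int A f := (mu.-integrable A (EFin \o f)).
Implicit Types (f g : R -> R) (a b x : R).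

(** The density is cut off outside (0, 1), so that the primitive is continuous from both sides at 0
    and at 1. *)
Definition prim f x := \int[mu]_(t in `]0, x[) (f \_ I01) t.

Lemma Int_restrict f : Int I01 f -> Int setT (f \_ I01).
Proof.
move=> fi; have := (integrable_mkcond _ (measurable_I01 (R := R))).1 fi.
by rewrite restrict_EFin.
Qed.

Lemma prim_itv f b : b <= 1 -> prim f b = \int[mu]_(t in `]0, b[) f t.
Proof.
move=> b1; apply: eq_Rintegral => t; rewrite inE/= in_itv/= => /andP[t0 tb].
by rewrite patchE mem_set// /I01/= in_itv/= t0 (lt_le_trans tb).
Qed.

Lemma prim0 f : prim f 0 = 0.
Proof. by rewrite /prim set_itvoo0 ?lexx// Rintegral_set0. Qed.

Lemma prim_le0 f x : x <= 0 -> prim f x = 0.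
Proof. by move=> x0; rewrite /prim set_itv_ge ?Rintegral_set0// bnd_simp -leNgt. Qed.

Lemma primB f a b : 0 <= a -> a <= b -> b <= 1 -> Int I01 f ->
  prim f b - prim f a = \int[mu]_(t in `]a, b[) f t.
Proof.
move=> a0 ab b1 fi; rewrite !prim_itv ?(le_trans ab)//.
rewrite (@Rintegral_split R f 0 a b)//; first by rewrite addrAC subrr add0r.
by apply: IntS fi => //; [exact: measurable_I01|apply: subset_itvl; rewrite bnd_simp].
Qed.

Lemma prim_cont f x : Int I01 f -> 0 <= x <= 1 -> {for x, continuous (prim f)}.
Proof.
move=> fi /andP[x0 x1]; have fT := Int_restrict fi.
have f12 : Int `[-1, 2]%classic (f \_ I01) by exact: IntS fT.
have N12 : (-1 : R) <= 2 by lra.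
have c := parameterized_integral_continuous N12 f12.
have Ix : x \in (`]-1, 2[ : interval R) by rewrite in_itv/=; apply/andP; split; lra.
have : {for x, continuous (fun y => parameterized_integral mu (-1) y (f \_ I01))}.
  by move: c => /(continuous_within_itvP _ (_ : (-1 : R) < 2))[|c _ _]; [lra|exact: c].
have E : \forall y \near x, parameterized_integral mu (-1) y (f \_ I01) = prim f y.
  near=> y.
  have y1 : -1 < y by near: y; apply: lt_nbhsr; lra.
  have y2 : y < 2 by near: y; apply: lt_nbhsl; lra.
  have yI : Int `]-1, y[%classic (f \_ I01) by apply: (IntS _ _ _ fT).
  rewrite /parameterized_integral -Rintegral_itv_obnd_cbnd; last by apply: (IntS _ _ _ fT).
  rewrite -Rintegral_itv_bndo_bndc//.
  have Z (a b : R) : a <= b -> b <= 0 -> \int[mu]_(t in `]a, b[) (f \_ I01) t = 0.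
    move=> ab b0; rewrite (@eq_Rintegral _ _ _ mu _ (cst 0)) ?Rintegral_cst ?mul0r// => t.
    rewrite inE/= in_itv/= => /andP[_ tb]; rewrite patchE memNset//= /I01/= in_itv/=.
    by move=> /andP[t0 _]; have := lt_trans t0 tb; rewrite ltNge b0.
  have [y0|y0] := leP 0 y.
    by rewrite (@Rintegral_split _ _ _ 0) ?(ltW y1)// ?lerN10// Z// ?lerN10// add0r.
  have -> : prim f y = 0 by apply: prim_le0; exact: ltW.
  by apply: Z; exact: ltW.
move=> cx; rewrite /prop_for /continuous_at -(nbhs_singleton E).
by apply: cvg_trans cx; apply: near_eq_cvg; apply: filterS E => y ->.
Unshelve. all: by end_near. Qed.

Lemma prim_ge f a b (c : R) : 0 <= a -> a <= b -> b <= 1 -> Int I01 f ->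
  {ae mu, forall t, I01 t -> a < t < b -> c <= f t} -> c * (b - a) <= prim f b - prim f a.
Proof.
move=> a0 ab b1 fi H; rewrite primB// -Rintegral_cst_itv//.
apply: ae_le_Rintegral => //; first exact: Int_cst_itv.
  apply: IntS fi => //; first exact: measurable_I01.
  by apply: subset_itv; rewrite bnd_simp.
apply: ae_imp H => t h; rewrite /= in_itv/= => /andP[ta tb]; apply: h; last by rewrite ta.
by rewrite /I01/= in_itv/= (le_lt_trans a0)// (lt_le_trans tb).
Qed.

Lemma primN f x : x <= 1 -> Int I01 f -> prim (fun t => - f t) x = - prim f x.
Proof.
move=> x1 fi; have fx : Int `]0, x[ f.
  by apply: IntS fi => //; [exact: measurable_I01|apply: subset_itvl; rewrite bnd_simp].
rewrite !prim_itv// -mulN1r -RintegralZl//.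
by apply: eq_Rintegral => t _; rewrite mulN1r.
Qed.

Lemma prim_le f a b (c : R) : 0 <= a -> a <= b -> b <= 1 -> Int I01 f ->
  {ae mu, forall t, I01 t -> a < t < b -> f t <= c} -> prim f b - prim f a <= c * (b - a).
Proof.
move=> a0 ab b1 fi H; have := @prim_ge (fun t => - f t) a b (- c) a0 ab b1 (IntN fi).
rewrite !primN ?(le_trans ab)// mulNr -opprD lerN2; apply.
by apply: ae_imp H => t h It tab; rewrite lerN2 h.
Qed.

(** Between x and a nearby y the density is almost everywhere within e of g(x), hence so is the
    difference quotient. Agreement almost everywhere near x is all that a weak solution provides. *)
Lemma is_derive_prim_ae f (g : R -> R) x : 0 < x < 1 -> Int I01 f ->
  {for x, continuous g} -> (\forall e \near 0^'+, {ae mu, forall t, I01 t -> `|t - x| < e -> f t = g t}) ->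
  is_derive x 1 (prim f) (g x).
Proof.
move=> /andP[x0 x1] fi cg [d /= d0 hd]; apply: is_derive_eps => e e0.
have d2 : 0 < d / 2 by rewrite divr_gt0.
have fg : {ae mu, forall t, I01 t -> `|t - x| < d / 2 -> f t = g t}.
  apply: hd => //; rewrite /= sub0r normrN gtr0_norm//; lra.
have /cvgrPdist_le/(_ _ e0)/nbhs_ballP[r /= r0 hr] := cg.
have hr' t : `|x - t| < r -> `|g x - g t| <= e by move=> h; exact: hr.
near=> y.
have y0 : 0 < y by near: y; exact: lt_nbhsr.
have y1 : y < 1 by near: y; exact: lt_nbhsl.
have yd : `|x - y| < d / 2 by near: y; exact: (@nbhsx_ballx _ _ x (d / 2)).
have yr : `|x - y| < r by near: y; exact: (@nbhsx_ballx _ _ x r).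
have [xy|yx] := leP x y.
  have B t : I01 t -> x < t < y -> (I01 t -> `|t - x| < d / 2 -> f t = g t) -> `|g x - f t| <= e.
    move=> It /andP[xt ty] E; have txy : `|x - t| < `|x - y|.
      by rewrite ![`|x - _|]distrC !ger0_norm ?subr_ge0// ?ltrD2r// ltW.
    rewrite E//; first by apply: hr'; exact: lt_trans yr.
    by rewrite distrC; exact: lt_trans yd.
  have L : (g x - e) * (y - x) <= prim f y - prim f x.
    apply: prim_ge; rewrite ?(ltW x0) ?(ltW y1)//.
    by apply: ae_imp fg => t h It xty; have := B t It xty h; rewrite ler_distlC => /andP[].
  have U : prim f y - prim f x <= (g x + e) * (y - x).
    apply: prim_le; rewrite ?(ltW x0) ?(ltW y1)//.
    by apply: ae_imp fg => t h It xty; have := B t It xty h; rewrite ler_distlC => /andP[].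
  rewrite (ger0_norm (_ : 0 <= y - x)) ?subr_ge0// ler_norml; apply/andP; split; lra.
have B t : I01 t -> y < t < x -> (I01 t -> `|t - x| < d / 2 -> f t = g t) -> `|g x - f t| <= e.
  move=> It /andP[yt tx] E; have txy : `|x - t| < `|x - y|.
    by rewrite !ger0_norm ?subr_ge0 ?(ltW tx) ?(ltW yx)// ltrD2l ltrN2.
  rewrite E//; first by apply: hr'; exact: lt_trans yr.
  by rewrite distrC; exact: lt_trans yd.
have L : (g x - e) * (x - y) <= prim f x - prim f y.
  apply: prim_ge; rewrite ?(ltW y0) ?(ltW x1) ?(ltW yx)//.
  by apply: ae_imp fg => t h It xty; have := B t It xty h; rewrite ler_distlC => /andP[].
have U : prim f x - prim f y <= (g x + e) * (x - y).
  apply: prim_le; rewrite ?(ltW y0) ?(ltW x1) ?(ltW yx)//.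
  by apply: ae_imp fg => t h It xty; have := B t It xty h; rewrite ler_distlC => /andP[].
rewrite distrC (ltr0_norm (_ : y - x < 0)) ?subr_lt0// ler_norml; apply/andP; split; lra.
Unshelve. all: by end_near. Qed.

(** Turns L^1 closeness of derivatives into uniform closeness of primitives, which carries facts
    from test functions over to W_0^{1,p}. *)
Lemma prim_dist f (G g : R -> R) b : 0 <= b <= 1 -> Int I01 f ->
  (forall x : R, is_derive x 1 G (g x)) -> continuous g ->
  `|prim f b - (G b - G 0)| <= int01 (fun x => `|g x - f x|).
Proof.
move=> /andP[b0 b1] fi dG cg; rewrite prim_itv// -(FTC_itv b0 dG cg).
have sub : `]0, b[ `<=` (@I01 R) by apply: subset_itvl; rewrite bnd_simp.
have fb : Int `]0, b[ f by apply: IntS fi => //; exact: measurable_I01.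
have gI : Int I01 (fun x => g x - f x) by apply: IntB => //; [exact: measurable_I01|exact: (Int_cont 0 1 cg)].
rewrite distrC -RintegralB//; last exact: Int_cont.
apply: le_trans (le_normr_Rintegral _ _) _ => //; first by apply: IntS gI => //; exact: measurable_I01.
by apply: le_Rintegral_set => //; [exact: measurable_I01|exact: Int_norm].
Qed.

End primitive.

(** * Sobolev functions of one variable *)

Section sobolev.
Context {R : realType}.
Variable p : R.
Hypothesis p1 : 1 < p.
Local Notation mu := (@lebesgue_measure R).
Local Notation Int A f := (mu.-integrable A (EFin \o f)).
Implicit Types (f g u v du dv : R -> R).
Let p0 : 0 < p. Proof. exact: lt_trans p1. Qed.

Lemma powR_young_sum (a b : R) : 0 <= a -> 0 <= b -> (a + b) `^ p <= 2 `^ p * (a `^ p + b `^ p).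
Proof.
move=> a0 b0; have m0 : 0 <= Num.max a b by rewrite le_max a0.
apply: (@le_trans _ _ ((2 * Num.max a b) `^ p)).
  apply: ge0_ler_powR; rewrite ?nnegrE ?mulr_ge0 ?addr_ge0 ?(ltW p0)//.
  have : a <= Num.max a b by rewrite le_max lexx.
  have : b <= Num.max a b by rewrite le_max lexx orbT.
  lra.
rewrite powRM// ler_pM2l ?powR_gt0// /Num.max; case: ifP => _.
  by rewrite lerDr powR_ge0.
by rewrite lerDl powR_ge0.
Qed.

(** Young's inequality with cruder constants: the smaller of a and b is replaced by the larger. It
    stands in for Hölder's inequality when the terms of the weak equation are shown to be
    integrable. *)
Lemma powR_mul_le (a b : R) : 0 <= a -> 0 <= b -> a `^ (p - 1) * b <= a `^ p + b `^ p.
Proof.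
move=> a0 b0; have p10 : 0 <= p - 1 by rewrite subr_ge0 ltW.
have [ab|ba] := leP a b.
  apply: (@le_trans _ _ (b `^ (p - 1) * b)).
    by rewrite ler_wpM2r//; apply: ge0_ler_powR; rewrite ?nnegrE.
  by rewrite powRM11// lerDr powR_ge0.
apply: (@le_trans _ _ (a `^ (p - 1) * a)); first by rewrite ler_wpM2l ?powR_ge0// ltW.
by rewrite powRM11// lerDl powR_ge0.
Qed.

(** Either t <= a, or (t / a)^(p-1) >= 1 and the power term dominates. Integrated, with a suitable
    a, it controls the L^1 norm by the L^p norm. *)
Lemma powR_lin (a t : R) : 0 < a -> 0 <= t -> t <= a + a `^ (1 - p) * t `^ p.
Proof.
move=> a0 t0; have p10 : 0 <= p - 1 by rewrite subr_ge0 ltW.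
have [ta|at_] := leP t a; first by rewrite (le_trans ta)// lerDl mulr_ge0 ?powR_ge0.
apply: (@le_trans _ _ (a `^ (1 - p) * t `^ p)); last by rewrite lerDr ltW.
rewrite -(powRM11 p1 t0) mulrA -[leLHS]mul1r ler_wpM2r//.
rewrite (_ : 1 - p = - (p - 1)); last by ring.
rewrite powRN mulrC ler_pdivlMr ?powR_gt0// mul1r.
by apply: ge0_ler_powR; rewrite ?nnegrE// ltW.
Qed.

Lemma measurable_powR_norm f : measurable_fun I01 f -> measurable_fun I01 (fun x => `|f x| `^ p).
Proof.
by move=> mf; apply: (measurableT_comp (measurable_powR p)); exact: measurableT_comp.
Qed.

Lemma Lp_Int f : Lp01 p f -> Int I01 (fun x => `|f x| `^ p).
Proof. by case. Qed.

Lemma Lp_L1 f : Lp01 p f -> Int I01 f.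
Proof.
move=> [mf fp]; apply: (@Int_le _ _ _ (fun x => 1 + `|f x| `^ p)).
- exact: measurable_I01.
- exact: mf.
- by apply: IntD; [exact: measurable_I01|exact: Int_cst_itv|exact: fp].
by move=> x _; have := powR_lin ltr01 (normr_ge0 (f x)); rewrite powR1 mul1r.
Qed.

Lemma Lp_cont f : continuous f -> Lp01 p f.
Proof.
move=> cf; split; first exact: Int_meas (Int_cont 0 1 cf).
by apply: Int_cont => x; apply: cvg_powR => //; apply: cvg_norm; exact: cf.
Qed.

Lemma Lp_le f g : measurable_fun I01 f -> Int I01 g ->
  (forall x, I01 x -> `|f x| `^ p <= g x) -> Lp01 p f.
Proof.
move=> mf gi fg; split=> //; apply: (Int_le _ _ gi) => //; first exact: measurable_I01.
  exact: measurable_powR_norm.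
by move=> x Ix; rewrite ger0_norm ?powR_ge0// fg.
Qed.

Lemma LpB f g : Lp01 p f -> Lp01 p g -> Lp01 p (fun x => f x - g x).
Proof.
move=> [mf fp] [mg gp]; have mI := @measurable_I01 R.
apply: (@Lp_le _ (fun x => 2 `^ p * (`|f x| `^ p + `|g x| `^ p))).
- exact: measurable_funB.
- by apply: IntZ => //; exact: IntD.
move=> x _; apply: le_trans (powR_young_sum _ _) => //.
by apply: ge0_ler_powR; rewrite ?nnegrE ?(ltW p0) ?addr_ge0// ler_normB.
Qed.

Lemma int01_le_pow f (a : R) : 0 < a -> Lp01 p f ->
  int01 (fun x => `|f x|) <= a + a `^ (1 - p) * int01 (fun x => `|f x| `^ p).
Proof.
move=> a0 Lf; have mI := @measurable_I01 R; have fp := Lp_Int Lf.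
have f1 := Int_norm (Lp_L1 Lf).
have c1 : Int I01 (cst a) by exact: Int_cst_itv.
have c2 : Int I01 (fun x => a `^ (1 - p) * `|f x| `^ p) by exact: IntZ.
have -> : a + a `^ (1 - p) * int01 (fun x => `|f x| `^ p) =
    int01 (fun x => a + a `^ (1 - p) * `|f x| `^ p).
  rewrite /int01 RintegralD// RintegralZl//; congr (_ + _).
  by rewrite Rintegral_cst_itv// subr0 mulr1.
apply: le_Rintegral => //; first exact: IntD.
by move=> x _; exact: powR_lin.
Qed.

Lemma int01_pow_ge0 f : 0 <= int01 (fun x => `|f x| `^ p).
Proof. by apply: Rintegral_ge0 => x _; exact: powR_ge0. Qed.

Lemma C1c_data phi : C1c01 phi -> [/\ forall x : R, is_derive x 1 phi (derive1 phi x),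
  continuous (derive1 phi), phi 0 = 0 & phi 1 = 0].
Proof.
move=> [dphi cphi [a [b [a0 b1 H]]]]; split=> //.
- by move=> x; apply: DeriveDef; [exact: dphi|rewrite derive1E].
- by apply: H; rewrite negb_and -ltNge a0.
- by apply: H; rewrite negb_and -!ltNge b1 orbT.
Qed.

Lemma W01p_approx u du (e : R) : W01p p u du -> 0 < e -> exists phi, [/\ C1c01 phi,
  int01 (fun x => `|phi x - u x|) <= e & int01 (fun x => `|derive1 phi x - du x|) <= e].
Proof.
move=> [[Lu Ldu _] H] e0; have e2 : 0 < e / 2 by rewrite divr_gt0.
have [phi Cphi N] := H _ e2; exists phi.
have [dphi cphi _ _] := C1c_data Cphi.
have c' : continuous phi by move=> x; exact: is_derive_cont (dphi x).
(* The linear bound with a = e / 2 gives e / 2 + (e / 2)^(1-p) (e / 2)^p = e. *)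
have key f : Lp01 p f -> int01 (fun x => `|f x| `^ p) <= (e / 2) `^ p -> int01 (fun x => `|f x|) <= e.
  move=> Lf h; apply: le_trans (int01_le_pow e2 Lf) _.
  rewrite [leRHS](splitr e) lerD2l; apply: (@le_trans _ _ ((e / 2) `^ (1 - p) * (e / 2) `^ p)).
    by rewrite ler_wpM2l ?powR_ge0.
  rewrite -powRD; last by rewrite (gt_eqF e2) implybT.
  by rewrite subrK powRr1// ltW.
have N' : int01 (fun x => `|phi x - u x| `^ p) + int01 (fun x => `|derive1 phi x - du x| `^ p) <=
    (e / 2) `^ p.
  move: N; rewrite /W1p_norm => N.
  have s0 := addr_ge0 (int01_pow_ge0 (fun x => phi x - u x)) (int01_pow_ge0 (fun x => derive1 phi x - du x)).
  move: N s0; set S := _ + _ => N s0.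
  have -> : S = (S `^ p^-1) `^ p by rewrite -powRrM mulVf ?gt_eqF// powRr1.
  by apply: ge0_ler_powR; rewrite ?nnegrE ?powR_ge0 ?(ltW p0) ?(ltW e2)// ltW.
have A := int01_pow_ge0 (fun x => phi x - u x).
have B := int01_pow_ge0 (fun x => derive1 phi x - du x).
split=> //; apply: key.
- by apply: LpB => //; exact: Lp_cont.
- by move: N' A B; move: (int01 _) (int01 _) (_ `^ _) => s t r *; lra.
- by apply: LpB => //; exact: Lp_cont.
- by move: N' A B; move: (int01 _) (int01 _) (_ `^ _) => s t r *; lra.
Qed.

(** Test functions approximating u are close to u in L^1 and uniformly close to [prim du], so these
    two agree almost everywhere; the value 0 of the test functions at 1 passes to the limit. *)
Lemma W01p_prim u du : W01p p u du -> ae_eq01 u (prim du) /\ prim du 1 = 0.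
Proof.
move=> Wu; have [[Lu Ldu _] _] := Wu; have mI := @measurable_I01 R.
have duI := Lp_L1 Ldu; have uI := Lp_L1 Lu.
have B (e : R) : 0 < e -> exists2 phi : R -> R, continuous phi & [/\ phi 1 = 0,
    int01 (fun x => `|phi x - u x|) <= e & forall x, 0 <= x <= 1 -> `|prim du x - phi x| <= e].
  move=> e0; have [phi [Cphi h1 h2]] := W01p_approx Wu e0.
  have [dphi cphi q0 q1] := C1c_data Cphi.
  exists phi; first by move=> x; exact: is_derive_cont (dphi x).
  split=> // x x01; apply: le_trans h2.
  by have := prim_dist x01 duI dphi cphi; rewrite q0 subr0.
split; last first.
  apply/eqP; rewrite -normr_eq0 eq_le normr_ge0 andbT; apply/ler_addgt0Pr => e e0.
  have [phi _ [q1 _ H]] := B e e0; rewrite add0r; have := H 1.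
  by rewrite q1 subr0 ler01 lexx; apply.
have mprim : measurable_fun I01 (prim du).
  apply: open_continuous_measurable_fun; first exact: interval_open.
  move=> x; rewrite inE /I01/= in_itv/= => /andP[x0 x1]; apply: prim_cont => //.
  by rewrite !ltW.
have pI : Int I01 (prim du).
  have [phi cphi [_ _ H]] := B 1 ltr01.
  apply: (@Int_le _ _ _ (fun x => `|phi x| + 1)) => //.
    by apply: IntD => //; [exact: Int_norm (Int_cont 0 1 cphi)|exact: Int_cst_itv].
  move=> x; rewrite /I01/= in_itv/= => /andP[x0 x1].
  have := H x; rewrite (ltW x0) (ltW x1) => /(_ isT) h; rewrite -lerBlDl.
  by apply: le_trans h; rewrite lerB_dist.
have dI : Int I01 (fun x => u x - prim du x) by exact: IntB.
have Z : int01 (fun x => `|u x - prim du x|) = 0.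
  have i0 : 0 <= int01 (fun x => `|u x - prim du x|) by apply: Rintegral_ge0 => x _; exact: normr_ge0.
  apply/le_anti; rewrite i0 andbT.
  apply/ler_addgt0Pr => e e0; rewrite add0r.
  have [phi cphi [_ h1 H]] := B (e / 2) (divr_gt0 e0 (ltr0Sn _ 1)).
  have fI : Int I01 (fun x => phi x - u x) by apply: IntB => //; exact: Int_cont.
  apply: (@le_trans _ _ (int01 (fun x => `|phi x - u x| + e / 2))).
    apply: le_Rintegral => //; first exact: Int_norm.
      by apply: IntD => //; [exact: Int_norm|exact: Int_cst_itv].
    move=> x; rewrite /I01/= in_itv/= => /andP[x0 x1].
    have := H x; rewrite (ltW x0) (ltW x1) => /(_ isT) h.
    have -> : u x - prim du x = - (phi x - u x) - (prim du x - phi x) by ring.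
    by apply: le_trans (ler_normB _ _) _; rewrite normrN lerD2l.
  rewrite /int01 RintegralD//; [|exact: Int_norm|exact: Int_cst_itv].
  by rewrite Rintegral_cst_itv// subr0 mulr1 [leRHS](splitr e) lerD2r.
by apply: ae_imp (ae0_Rintegral mI dI Z) => x h Ix; apply/eqP; rewrite -subr_eq0 h.
Qed.

End sobolev.

(** * Cutoff functions of class C^1 *)

Section plateau.
Context {R : realType}.
Implicit Types (a b r x t : R).

Lemma is_derive_mulnorm x : is_derive x 1 (fun y : R => y * `|y|) (2 * `|x|).
Proof.
apply: is_derive_eps => e e0; near=> y.
have yx : `|x - y| < e by near: y; exact: (@nbhsx_ballx _ _ x e).
have : `|y * `|y| - x * `|x| - 2 * `|x| * (y - x)| <= `|x - y| * `|y - x|.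
  rewrite [`|x - y|]distrC -normrM ger0_norm; last by rewrite -expr2 sqr_ge0.
  have hx := sqr_ge0 x; have hy := sqr_ge0 y; rewrite !expr2 in hx hy.
  rewrite ler_norml; case: (ger0P x) => x0; case: (ger0P y) => y0.
  - by apply/andP; split; have := sqr_ge0 (x - y); rewrite expr2; lra.
  - have xy : x * y <= 0 by rewrite mulr_ge0_le0// ltW.
    by apply/andP; split; lra.
  - have xy : x * y <= 0 by rewrite mulr_le0_ge0// ltW.
    by apply/andP; split; lra.
  - by apply/andP; split; have := sqr_ge0 (x - y); rewrite expr2; lra.
by move=> h; apply: le_trans h _; rewrite ler_wpM2r// ltW.
Unshelve. all: by end_near. Qed.

(* C^1 step: twice the second difference of [t * |t|], whose derivative is the tent. *)
Definition step t := ((t + 1) * `|t + 1| - 2 * (t * `|t|) + (t - 1) * `|t - 1|) / 4 + 2^-1.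
Definition tent t := (`|t + 1| - 2 * `|t| + `|t - 1|) / 2.

Lemma is_derive_step x : is_derive x 1 step (tent x).
Proof.
have sh (c : R) : is_derive x 1 (fun y => (y + c) * `|y + c|) (2 * `|x + c|).
  have d1 := is_deriveD (is_derive_id x 1) (is_derive_cst c x 1).
  apply: (trigger_derive (@is_derive1_comp R (fun y => y * `|y|) (fun y => y + c) x _ _
    (is_derive_mulnorm _) d1)).
  by rewrite addr0 mulr1.
have d1 := is_deriveB (sh 1) (is_deriveZ (2 : R) (is_derive_mulnorm x)).
have d2 := is_deriveD d1 (sh (- 1)).
have d3 := is_deriveD (is_deriveZ (4^-1 : R) d2) (is_derive_cst (2^-1 : R) x 1).
have E : step = (4^-1 \*: ((fun y : R => (y + 1) * `|y + 1|) - (2 : R) \*: (fun y : R => y * `|y|) +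
  (fun y : R => (y + -1) * `|y + -1|))) + cst (2^-1 : R) by apply/funext => y; rewrite /step mulrC.
rewrite E; apply: (trigger_derive d3).
by rewrite /GRing.scale/= addr0 /tent; field.
Qed.

Lemma tent_cont : continuous tent.
Proof.
move=> x; apply: cvgM; last exact: cvg_cst.
have c (d : R) : `|y + d| @[y --> x] --> `|x + d|.
  by apply: cvg_norm; apply: cvgD; [exact: cvg_id|exact: cvg_cst].
apply: cvgD; last exact: c.
apply: cvgB; first exact: c.
by apply: cvgM; [exact: cvg_cst|exact: cvg_norm].
Qed.

Lemma tent_ge0 t : 0 <= tent t.
Proof. by rewrite /tent; case: (ler0P t); case: (ler0P (t + 1)); case: (ler0P (t - 1)); lra. Qed.

Lemma tent_le1 t : tent t <= 1.
Proof. by rewrite /tent; case: (ler0P t); case: (ler0P (t + 1)); case: (ler0P (t - 1)); lra. Qed.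

Lemma tent_out t : 1 <= `|t| -> tent t = 0.
Proof. by rewrite /tent; case: (ler0P t); case: (ler0P (t + 1)); case: (ler0P (t - 1)); lra. Qed.

Lemma step_left t : t <= -1 -> step t = 0.
Proof.
by move=> t1; rewrite /step !ler0_norm; [field|lra..].
Qed.

Lemma step_right t : 1 <= t -> step t = 1.
Proof. by move=> t1; rewrite /step !ger0_norm; [field|lra..]. Qed.

Lemma step_ndecr : {homo step : x y / x <= y}.
Proof. by apply: (is_derive_ndecr is_derive_step) => x; exact: tent_ge0. Qed.

Lemma step_ge0 t : 0 <= step t.
Proof.
have [t1|t1] := leP t (-1); first by rewrite step_left.
by rewrite -(@step_left (-1))// step_ndecr// ltW.
Qed.

Lemma step_le1 t : step t <= 1.
Proof.
have [t1|t1] := leP 1 t; first by rewrite step_right.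
by rewrite -(@step_right 1)// step_ndecr// ltW.
Qed.

(** For a + r <= b - r, a cutoff that rises from 0 to 1 on [a - r, a + r] and falls back on
    [b - r, b + r]. Its derivative is the difference of two averaging kernels of mass 1 and radius
    r, centred at a and b. *)
Definition plateau a b r x := step ((x - a) / r) - step ((x - b) / r).
Definition dplateau a b r x := (tent ((x - a) / r) - tent ((x - b) / r)) / r.

Lemma is_derive_step_scaled (c r x : R) :
  is_derive x 1 (fun y => step ((y - c) / r)) (tent ((x - c) / r) / r).
Proof.
have d1 := is_deriveB (is_derive_id x 1) (is_derive_cst c x 1).
have d2 : is_derive x 1 (fun y => (y - c) / r) r^-1.
  have E : (fun y => (y - c) / r) = r^-1 \*: (id - cst c) by apply/funext => y; rewrite mulrC.
  by rewrite E; apply: (trigger_derive (is_deriveZ r^-1 d1)); rewrite /GRing.scale/= subr0 mulr1.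
exact: (@is_derive1_comp R step (fun y => (y - c) / r) x _ _ (is_derive_step _) d2).
Qed.

Lemma norm_tent_scaled (c r x : R) : 0 < r -> `|tent ((x - c) / r) / r| <= r^-1.
Proof.
move=> r0; rewrite normrM (ger0_norm (tent_ge0 _)) gtr0_norm ?invr_gt0//.
by rewrite -[leRHS]mul1r ler_pM2r ?invr_gt0// tent_le1.
Qed.

Lemma is_derive_plateau a b r x : is_derive x 1 (plateau a b r) (dplateau a b r x).
Proof.
have d := is_deriveB (is_derive_step_scaled a r x) (is_derive_step_scaled b r x).
by apply: (trigger_derive d); rewrite /dplateau [RHS]mulrBl.
Qed.

Lemma tent_shift_cont (c r : R) : continuous (fun x => tent ((x - c) / r)).
Proof.
move=> x; have h : (y - c) / r @[y --> x] --> (x - c) / r.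
  by apply: cvgM; [apply: cvgB; [exact: cvg_id|exact: cvg_cst]|exact: cvg_cst].
exact: cvg_comp h (@tent_cont _).
Qed.

Lemma dplateau_cont a b r : continuous (dplateau a b r).
Proof.
move=> x; apply: cvgM; last exact: cvg_cst.
by apply: cvgB; exact: tent_shift_cont.
Qed.

Lemma plateau_out a b r x : 0 < r -> a <= b -> ~~ (a - r <= x <= b + r) -> plateau a b r x = 0.
Proof.
move=> r0 ab; rewrite negb_and -!ltNge => /orP[xa|bx].
  by rewrite /plateau !step_left ?subrr// ler_pdivrMr//; lra.
by rewrite /plateau !step_right ?subrr// ler_pdivlMr//; lra.
Qed.

Lemma plateau_in a b r x : 0 < r -> a + r <= x <= b - r -> plateau a b r x = 1.
Proof.
move=> r0 /andP[ax xb]; rewrite /plateau step_right ?step_left ?subr0//.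
  by rewrite ler_pdivrMr//; lra.
by rewrite ler_pdivlMr//; lra.
Qed.

Lemma dplateau_out a b r x : 0 < r -> r <= `|x - a| -> r <= `|x - b| -> dplateau a b r x = 0.
Proof.
move=> r0 ha hb; rewrite /dplateau !tent_out ?subrr ?mul0r//.
  by rewrite normrM [X in _ * X]gtr0_norm ?invr_gt0// ler_pdivlMr// mul1r.
by rewrite normrM [X in _ * X]gtr0_norm ?invr_gt0// ler_pdivlMr// mul1r.
Qed.

Lemma plateau_ge0 a b r x : 0 < r -> a <= b -> 0 <= plateau a b r x.
Proof.
by move=> r0 ab; rewrite subr_ge0 step_ndecr// ler_pM2r ?invr_gt0// lerD2l lerN2.
Qed.

Lemma plateau_le1 a b r x : plateau a b r x <= 1.
Proof. by have := step_le1 ((x - a) / r); have := step_ge0 ((x - b) / r); rewrite /plateau; lra. Qed.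

Lemma norm_dplateau a b r x : 0 < r -> `|dplateau a b r x| <= r^-1.
Proof.
move=> r0; rewrite normrM [X in _ * X]gtr0_norm ?invr_gt0// -[leRHS]mul1r ler_pM2r ?invr_gt0//.
have := tent_ge0 ((x - a) / r); have := tent_le1 ((x - a) / r).
have := tent_ge0 ((x - b) / r); have := tent_le1 ((x - b) / r).
by rewrite ler_norml; lra.
Qed.

Lemma C1c01_plateau a b r : 0 < r -> a <= b -> 0 < a - r -> b + r < 1 ->
  C1c01 (plateau a b r) /\ derive1 (plateau a b r) = dplateau a b r.
Proof.
move=> r0 ab ar br.
have dE : derive1 (plateau a b r) = dplateau a b r.
  by apply/funext => x; rewrite derive1E; have [_ ->] := is_derive_plateau a b r x.
split; last exact: dE.
split.
- by move=> x; have [] := is_derive_plateau a b r x.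
- by rewrite dE; exact: dplateau_cont.
- by exists (a - r), (b + r); split=> // x; exact: plateau_out.
Qed.

End plateau.

(** * Membership in W_0^{1,p} and integration by parts *)

Section membership.
Context {R : realType}.
Variable p : R.
Hypothesis p1 : 1 < p.
Local Notation mu := (@lebesgue_measure R).
Local Notation Int A f := (mu.-integrable A (EFin \o f)).
Implicit Types (f g u v du dv : R -> R).
Let p0 : 0 < p. Proof. exact: lt_trans p1. Qed.

Lemma is_derive_int0 (f g f' g' : R -> R) :
  (forall x : R, is_derive x 1 f (f' x)) -> (forall x : R, is_derive x 1 g (g' x)) ->
  continuous f' -> continuous g' -> f 1 * g 1 = f 0 * g 0 ->
  int01 (fun x => f x * g' x) = - int01 (fun x => f' x * g x).
Proof.
move=> df dg cf' cg' E; have mI := @measurable_I01 R.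
have cf : continuous f by move=> x; exact: is_derive_cont (df x).
have cg : continuous g by move=> x; exact: is_derive_cont (dg x).
have c1 : continuous (fun x => f x * g' x) by move=> x; apply: cvgM; [exact: cf|exact: cg'].
have c2 : continuous (fun x => f' x * g x) by move=> x; apply: cvgM; [exact: cf'|exact: cg].
have dfg (x : R) : is_derive x 1 (fun x => f x * g x) (f x * g' x + f' x * g x).
  by apply: (trigger_derive (is_deriveM (df x) (dg x))); rewrite /GRing.scale/= [g x * _]mulrC.
have H := @FTC_itv R _ _ 0 1 ler01 dfg (fun x => cvgD (c1 x) (c2 x)).
apply/eqP; rewrite -addr_eq0; apply/eqP.
rewrite /int01 -RintegralD//; [|exact: (Int_cont 0 1 c1)|exact: (Int_cont 0 1 c2)].
by rewrite H E subrr.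
Qed.

Lemma W1p_C1 u d : (forall x : R, is_derive x 1 u (d x)) -> continuous d -> W1p p u d.
Proof.
move=> du cd; have cu : continuous u by move=> x; exact: is_derive_cont (du x).
split; [exact: Lp_cont|exact: Lp_cont|move=> phi Cphi].
have [dphi cphi q0 q1] := C1c_data Cphi.
by apply: is_derive_int0 => //; rewrite q0 q1 !mulr0.
Qed.

Lemma W01p_C1c phi : C1c01 phi -> W01p p phi (derive1 phi).
Proof.
move=> Cphi; have [dphi cphi _ _] := C1c_data Cphi; split; first exact: W1p_C1.
move=> e e0; exists phi => //; rewrite /W1p_norm.
have Z : int01 (fun x => `|phi x - phi x| `^ p) = 0.
  rewrite /int01 (@eq_Rintegral _ _ _ mu _ (cst 0)) ?Rintegral_cst_itv ?mul0r// => x _.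
  by rewrite subrr normr0 powR0// gt_eqF.
have Z' : int01 (fun x => `|derive1 phi x - derive1 phi x| `^ p) = 0.
  rewrite /int01 (@eq_Rintegral _ _ _ mu _ (cst 0)) ?Rintegral_cst_itv ?mul0r// => x _.
  by rewrite subrr normr0 powR0// gt_eqF.
by rewrite Z Z' addr0 powR0// invr_neq0// gt_eqF.
Qed.

Lemma int01_layer (f : R -> R) (M r : R) : 0 < r -> r < 1 / 2 -> measurable_fun I01 f -> 0 <= M ->
  (forall x, I01 x -> 0 <= f x <= M) -> (forall x, r < x < 1 - r -> f x = 0) ->
  int01 f <= M * (2 * r).
Proof.
move=> r0 r1 mf M0 fM fz; have mI := @measurable_I01 R.
have fi : Int I01 f.
  apply: (Int_le mI mf (Int_cst_itv 0 1 M)) => x Ix.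
  by have /andP[f0 fM'] := fM x Ix; rewrite ger0_norm.
have s1 : Int `]r, 1[%classic f by apply: IntS fi => //; apply: subset_itvr; rewrite bnd_simp ltW.
have h1 : r <= 1 by lra.
have h2 : r <= 1 - r by lra.
have h3 : 1 - r <= 1 by lra.
rewrite /int01 /I01 (Rintegral_split (ltW r0) h1 fi) (Rintegral_split h2 h3 s1).
have -> : M * (2 * r) = M * (r - 0) + (M * 0 + M * (1 - (1 - r))) by ring.
have part (a b : R) : 0 <= a -> a <= b -> b <= 1 -> \int[mu]_(x in `]a, b[) f x <= M * (b - a).
  move=> a0 ab b1; rewrite -Rintegral_cst_itv//.
  have sub : `]a, b[%classic `<=` (@I01 R) by apply: subset_itv; rewrite bnd_simp.
  apply: le_Rintegral => //; [exact: IntS fi|exact: Int_cst_itv|].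
  by move=> x /sub/fM/andP[].
apply: lerD; first by apply: part; lra.
apply: lerD; last by apply: part; lra.
rewrite mulr0 (@eq_Rintegral _ _ _ mu _ (cst 0)) ?Rintegral_cst_itv ?mul0r//.
by move=> x; rewrite inE/= in_itv/=; exact: fz.
Qed.

(** The function is multiplied by a cutoff near the ends. The derivative of the cutoff is of order 1
    / r, but |u| is at most M times the distance to either end, so the error in the derivative stays
    bounded, on layers of total length 6 r. *)
Lemma W01p_C1 u d : (forall x : R, is_derive x 1 u (d x)) -> continuous d ->
  u 0 = 0 -> u 1 = 0 -> W01p p u d.
Proof.
move=> du cd u0 u1; split; first exact: W1p_C1.
have cu : continuous u by move=> x; exact: is_derive_cont (du x).
move=> e e0; have [M M0 dM] := bounded_itv 0 1 cd.
have uM x : 0 <= x <= 1 -> `|u x| <= M * x.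
  move=> /andP[]; rewrite le_eqVlt => /predU1P[<- _|x0 x1]; first by rewrite u0 mulr0 normr0.
  have [c /andP[c0 cx]] := MVT_is_derive x0 (fun z _ => du z).
  rewrite u0 !subr0 => ->; rewrite normrM (gtr0_norm x0) ler_pM2r// dM//.
  by rewrite (ltW c0)/=; lra.
have uM' x : 0 <= x <= 1 -> `|u x| <= M * (1 - x).
  move=> /andP[x0]; rewrite le_eqVlt => /predU1P[->|x1]; first by rewrite u1 subrr mulr0 normr0.
  have [c /andP[c0 cx]] := MVT_is_derive x1 (fun z _ => du z).
  rewrite u1 sub0r -[`|u x|]normrN => ->; rewrite normrM [X in _ * X]gtr0_norm ?subr_gt0//.
  by rewrite ler_pM2r ?subr_gt0// dM// (ltW cx) andbT; lra.
(* Bound for the p-th power of the errors: the derivative of the cutoff times u contributes at most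
   3 M, the removed part of u' at most M. *)
pose C := (4 * M) `^ p.
have C0 : 0 < C by rewrite powR_gt0// mulr_gt0.
(* The two errors are at most 6 r C each, together at most e^p / 2; the bound 1 / 8 keeps the layers
   of width 3 r at the two ends disjoint. *)
pose r := Num.min (1 / 8) ((e `^ p) / (24 * C)).
have r0 : 0 < r by rewrite lt_min; apply/andP; split; rewrite divr_gt0 ?powR_gt0 ?mulr_gt0.
have r8 : r <= 1 / 8 by rewrite ge_min lexx.
have re : C * (2 * (3 * r)) * 2 < e `^ p.
  have : r <= (e `^ p) / (24 * C) by rewrite ge_min lexx orbT.
  rewrite ler_pdivlMr ?mulr_gt0// => h.
  have : 0 < r * C by rewrite mulr_gt0.
  lra.
pose chi := plateau (2 * r) (1 - 2 * r) r; pose dchi := dplateau (2 * r) (1 - 2 * r) r.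
have dchiE (x : R) : is_derive x 1 chi (dchi x) by exact: is_derive_plateau.
pose phi x := chi x * u x; pose dphi x := dchi x * u x + chi x * d x.
have dphiE (x : R) : is_derive x 1 phi (dphi x).
  apply: (trigger_derive (is_deriveM (dchiE x) (du x))).
  by rewrite /GRing.scale/= addrC /dphi [u x * _]mulrC.
have cchi : continuous chi by move=> x; exact: is_derive_cont (dchiE x).
have cdphi : continuous dphi.
  move=> x; apply: cvgD; apply: cvgM; [exact: dplateau_cont|exact: cu|exact: cchi|exact: cd].
have cphi : continuous phi by move=> x; exact: is_derive_cont (dphiE x).
have dphi1 : derive1 phi = dphi.
  by apply/funext => x; rewrite derive1E; have [_ ->] := dphiE x.
exists phi.
  split; [by move=> x; have [] := dphiE x|by rewrite dphi1|].
  exists r, (1 - r); split; [by []|lra|move=> x xr].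
  rewrite /phi /chi plateau_out ?mul0r//; first by lra.
  by move: xr; congr (~~ _); congr (_ && _); congr (_ <= _); ring.
rewrite dphi1 /W1p_norm.
have est (f g : R -> R) : continuous f -> continuous g ->
    (forall x, 3 * r < x < 1 - 3 * r -> f x = g x) ->
    (forall x, I01 x -> `|f x - g x| <= 4 * M) ->
    int01 (fun x => `|f x - g x| `^ p) <= C * (2 * (3 * r)).
  move=> cf cg fg fgM; apply: int01_layer.
  - lra.
  - lra.
  - exact: (Int_meas (Lp_Int (LpB p1 (Lp_cont p1 cf) (Lp_cont p1 cg)))).
  - exact: ltW.
  - move=> x Ix; rewrite powR_ge0/=; apply: ge0_ler_powR; rewrite ?nnegrE ?(ltW p0)//.
      by rewrite mulr_ge0// ltW.
    exact: fgM.
  - by move=> x h; rewrite fg// subrr normr0 powR0// gt_eqF.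
have chi1 x : 3 * r < x < 1 - 3 * r -> chi x = 1 /\ dchi x = 0.
  move=> /andP[h1 h2]; split; first by apply: plateau_in => //; lra.
  apply: dplateau_out => //.
    by rewrite ger0_norm; lra.
  by rewrite ler0_norm; lra.
have chiB x : 0 <= chi x <= 1 by rewrite plateau_ge0//= ?plateau_le1//; lra.
have I1 : int01 (fun x => `|phi x - u x| `^ p) <= C * (2 * (3 * r)).
  apply: est => //; first by move=> x /chi1[h _]; rewrite /phi h mul1r.
  move=> x; rewrite /I01/= in_itv/= => /andP[x0 x1].
  have -> : phi x - u x = - ((1 - chi x) * u x) by rewrite /phi; ring.
  rewrite normrN normrM ger0_norm; last by have := chiB x; lra.
  have h1 : `|u x| <= M by apply: le_trans (uM x _) _; rewrite ?(ltW x0) ?(ltW x1)// ler_piMr// ltW.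
  have := chiB x => /andP[q0 q1]; have := normr_ge0 (u x); nra.
have I2 : int01 (fun x => `|dphi x - d x| `^ p) <= C * (2 * (3 * r)).
  apply: est => //; first by move=> x /chi1[h h']; rewrite /dphi h h' mul0r add0r mul1r.
  move=> x; rewrite /I01/= in_itv/= => /andP[x0 x1].
  have hd : `|d x| <= M by apply: dM; rewrite !ltW.
  have hu : `|dchi x * u x| <= 3 * M.
    have [xl|xl] := leP x (3 * r).
      rewrite normrM; apply: (@le_trans _ _ (r^-1 * (M * x))).
        by apply: ler_pM => //; [exact: norm_dplateau|apply: uM; rewrite !ltW].
      by rewrite mulrC ler_pdivrMr//; nra.
    have [xr|xr] := leP (1 - 3 * r) x.
      rewrite normrM; apply: (@le_trans _ _ (r^-1 * (M * (1 - x)))).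
        by apply: ler_pM => //; [exact: norm_dplateau|apply: uM'; rewrite !ltW].
      by rewrite mulrC ler_pdivrMr//; nra.
    by have [|_ ->] := chi1 x; rewrite ?xl// mul0r normr0 mulr_ge0// ltW.
  have -> : dphi x - d x = dchi x * u x - (1 - chi x) * d x by rewrite /dphi; ring.
  apply: le_trans (ler_normB _ _) _.
  have : `|(1 - chi x) * d x| <= M.
    rewrite normrM ger0_norm; last by have := chiB x; lra.
    have := chiB x => /andP[q0 q1]; have := normr_ge0 (d x); nra.
  lra.
rewrite -[ltRHS](powRr1 (ltW e0)) -(mulfV (_ : p != 0)) ?gt_eqF// powRrM.
apply: gt0_ltr_powR; rewrite ?invr_gt0 ?nnegrE ?powR_ge0 ?addr_ge0 ?int01_pow_ge0//.
by apply: le_lt_trans re; rewrite mulr_natr mulr2n; exact: lerD.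
Qed.

(** For test functions this is the product rule; both sides pass to the limit in L^1 because w and h
    are bounded on [0, 1]. *)
Lemma W01p_by_parts (w h v dv : R -> R) : (forall x : R, is_derive x 1 w (h x)) -> continuous h ->
  W01p p v dv -> int01 (fun x => w x * dv x) = - int01 (fun x => h x * v x).
Proof.
move=> dw ch Wv; have mI := @measurable_I01 R; have [[Lv Ldv _] _] := Wv.
have cw : continuous w by move=> x; exact: is_derive_cont (dw x).
have [M M0 wM] := bounded_itv 0 1 cw; have [N N0 hN] := bounded_itv 0 1 ch.
have vI := Lp_L1 p1 Lv; have dvI := Lp_L1 p1 Ldv.
have mulI (f g : R -> R) (K : R) : Int I01 f -> continuous g ->
    (forall x, 0 <= x <= 1 -> `|g x| <= K) -> Int I01 (fun x => g x * f x).
  move=> fi cg gK; under eq_fun do rewrite mulrC.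
  apply: (@Int_mul_bounded _ _ _ _ K) => //; first exact: Int_meas (Int_cont 0 1 cg).
  by move=> x; rewrite /I01/= in_itv/= => /andP[x0 x1]; apply: gK; rewrite !ltW.
have diff (f1 f2 g : R -> R) (K e : R) : Int I01 f1 -> Int I01 f2 -> continuous g -> 0 < K ->
    (forall x, 0 <= x <= 1 -> `|g x| <= K) -> int01 (fun x => `|f1 x - f2 x|) <= e ->
    `|int01 (fun x => g x * f1 x) - int01 (fun x => g x * f2 x)| <= K * e.
  move=> i1 i2 cg K0 gK he.
  have gi1 := mulI _ _ _ i1 cg gK; have gi2 := mulI _ _ _ i2 cg gK.
  rewrite /int01 -RintegralB//; apply: le_trans (le_normr_Rintegral _ _) _ => //; first exact: IntB.
  apply: (@le_trans _ _ (int01 (fun x => K * `|f1 x - f2 x|))).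
    apply: le_Rintegral => //; first by apply: Int_norm; exact: IntB.
      by apply: IntZ => //; apply: Int_norm; exact: IntB.
    move=> x; rewrite /I01/= in_itv/= => /andP[x0 x1].
    by rewrite -mulrBr normrM ler_wpM2r// gK// !ltW.
  rewrite /int01 RintegralZl//; first by rewrite ler_pM2l.
  by apply: Int_norm; exact: IntB.
apply/eqP; rewrite -addr_eq0 -normr_eq0; apply/eqP/le_anti; rewrite normr_ge0 andbT.
apply/ler_addgt0Pr => e e0; rewrite add0r.
have ee : 0 < e / (M + N) by rewrite divr_gt0// addr_gt0.
have [phi [Cphi e1 e2]] := W01p_approx p1 Wv ee.
have [dphi cphi q0 q1] := C1c_data Cphi.
have cp : continuous phi by move=> x; exact: is_derive_cont (dphi x).
have E := is_derive_int0 dw dphi ch cphi.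
rewrite q0 q1 !mulr0 in E; have {}E := E erefl.
have D1 := diff _ _ _ _ _ (Int_cont 0 1 cphi) dvI cw M0 wM e2.
have D2 := diff _ _ _ _ _ (Int_cont 0 1 cp) vI ch N0 hN e1.
have -> : int01 (fun x => w x * dv x) + int01 (fun x => h x * v x) =
  - (int01 (fun x => w x * derive1 phi x) - int01 (fun x => w x * dv x))
  - (int01 (fun x => h x * phi x) - int01 (fun x => h x * v x)) by rewrite E; ring.
apply: le_trans (ler_normB _ _) _; rewrite normrN; apply: le_trans (lerD D1 D2) _.
by rewrite -mulrDl mulrC divfK// gt_eqF// addr_gt0.
Qed.

End membership.

(** * The lemma of du Bois-Reymond *)

Section dubois.
Context {R : realType}.
Local Notation mu := (@lebesgue_measure R).
Local Notation Int A f := (mu.-integrable A (EFin \o f)).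
Implicit Types (f g w h : R -> R) (a b c r x e : R).

Lemma lebesgue_small f x e : Int setT f -> lebesgue_pt f x -> 0 < e ->
  exists2 r0, 0 < r0 & forall r, 0 < r < r0 ->
    \int[mu]_(y in `]x - r, x + r[) `|f y - f x| <= e * (2 * r).
Proof.
move=> fi H e0; have {H} : \forall r \near 0^'+, `|fine (davg f x r)| < e.
  by move: H => /fine_cvgP[_ /cvgr0Pnorm_lt/(_ _ e0)].
move=> [d /= d0 hd]; exists d => // r /andP[r0 rd].
have := hd r; rewrite /= sub0r normrN gtr0_norm// => /(_ rd r0).
rewrite /davg /iavg ball_itv.
have mb : measurable (`]x - r, x + r[%classic : set (measurableTypeR R)) by exact: measurable_itv.
have Ii : Int `]x - r, x + r[%classic (fun y => `|f y - f x|).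
  apply: Int_norm; apply: IntB => //; last exact: Int_cst_itv.
  by apply: (IntS _ _ _ fi).
have E : (\int[mu]_(y in `](x - r)%R, (x + r)%R[) `|((center (f x) \o f) y)%:E|)%E =
    (\int[mu]_(y in `]x - r, x + r[) `|f y - f x|)%:E.
  rewrite /Rintegral fineK//; exact: (@integrable_fin_num _ _ R mu _ mb _ Ii).
rewrite E -ball_itv lebesgue_measure_ball ?(ltW r0)// inver mulrn_eq0/= (gt_eqF r0)/=.
have i0 : 0 <= \int[mu]_(y in ball x r) `|f y - f x| by exact: Rintegral_ge0.
rewrite ger0_norm; last by rewrite mulr_ge0// ?invr_ge0 ?mulrn_wge0// ltW.
rewrite mulrC ltr_pdivrMr ?mulrn_wgt0// => /ltW.
by rewrite -[r *+ 2]mulr_natl.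
Qed.

Lemma le_int_sub (F g : R -> R) a b : `]a, b[%classic `<=` (@I01 R) -> Int I01 F -> Int I01 g ->
  (forall x, I01 x -> a < x < b -> F x <= g x) -> (forall x, I01 x -> ~~ (a < x < b) -> F x <= 0) ->
  int01 F <= \int[mu]_(x in `]a, b[) g x.
Proof.
move=> sub Fi gi H1 H2; have mI := @measurable_I01 R.
have mb : measurable (`]a, b[%classic : set (measurableTypeR R)) by exact: measurable_itv.
have E : \int[mu]_(x in `]a, b[) g x = \int[mu]_(x in I01) (g \_ `]a, b[) x.
  by rewrite -Rintegral_mkcondr setIidr.
rewrite E; apply: le_Rintegral => //.
  apply: (Int_le mI) (Int_norm gi) _.
    apply/measurable_restrict => //.
    by apply: measurable_funS (Int_meas gi) => //; exact: subIsetl.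
  by move=> x _; rewrite patchE; case: ifP => // _; rewrite normr0.
move=> x Ix; rewrite patchE; case: ifPn.
  by rewrite inE/= in_itv/= => xab; exact: H1.
by rewrite notin_setE/= in_itv/= => /negP; exact: H2.
Qed.

Lemma sub_I01 c r : 0 < c - r -> c + r < 1 -> `]c - r, c + r[%classic `<=` (@I01 R).
Proof. by move=> h1 h2; apply: subset_itv; rewrite bnd_simp ltW. Qed.

(** The kernel has mass 1, is at most 1 / r and vanishes at distance r or more from c, so only the
    oscillation of w around w(c) contributes to the error. *)
Lemma tent_average w c r : 0 < r -> 0 < c - r -> c + r < 1 -> Int I01 w ->
  `|int01 (fun x => w x * (tent ((x - c) / r) / r)) - w c| <=
  \int[mu]_(x in `]c - r, c + r[) (`|w x - w c| / r).
Proof.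
move=> r0 cr0 cr1 wi; have mI := @measurable_I01 R.
have ct : continuous (fun x => tent ((x - c) / r) / r).
  by move=> x; apply: cvgM; [exact: tent_shift_cont|exact: cvg_cst].
have tB x := norm_tent_scaled c x r0.
have mt : measurable_fun I01 (fun x => tent ((x - c) / r) / r) := Int_meas (Int_cont 0 1 ct).
have tE : int01 (fun x => tent ((x - c) / r) / r) = 1.
  rewrite /int01 (FTC_itv ler01 (is_derive_step_scaled c r) ct) step_right ?step_left ?subr0//.
    by rewrite ler_pdivrMr//; lra.
  by rewrite ler_pdivlMr//; lra.
have wt : Int I01 (fun x => w x * (tent ((x - c) / r) / r)).
  by apply: Int_mul_bounded => //.
have ci : Int I01 (cst (w c)) by exact: Int_cst_itv.
have wci : Int I01 (fun x => w x - w c) by exact: IntB.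
have wct : Int I01 (fun x => (w x - w c) * (tent ((x - c) / r) / r)).
  by apply: Int_mul_bounded => //.
have -> : int01 (fun x => w x * (tent ((x - c) / r) / r)) - w c =
    int01 (fun x => (w x - w c) * (tent ((x - c) / r) / r)).
  rewrite -[X in _ - X]mulr1 -tE /int01 -RintegralZl//; last exact: (Int_cont 0 1 ct).
  rewrite -RintegralB//; first by apply: eq_Rintegral => x _; rewrite [RHS]mulrBl.
  by apply: IntZ => //; exact: (Int_cont 0 1 ct).
apply: le_trans (le_normr_Rintegral _ _) _ => //.
apply: (@le_int_sub (fun x => `|(w x - w c) * (tent ((x - c) / r) / r)|) (fun x => `|w x - w c| / r));
  [exact: sub_I01|exact: Int_norm| | |].
- under eq_fun do rewrite mulrC; apply: IntZ => //; exact: Int_norm.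
- by move=> x _ _; rewrite normrM ler_wpM2l.
move=> x _ xc; rewrite tent_out ?mul0r ?mulr0 ?normr0//.
rewrite normrM [X in _ * X]gtr0_norm ?invr_gt0// ler_pdivlMr// mul1r.
by rewrite leNgt ltr_norml; apply: contra xc => /andP[]; lra.
Qed.

(** The cutoff differs from the indicator [J] of (a, b) only within r of the two ends, and by at
    most 1. *)
Lemma plateau_increment h a b r : 0 < r -> 0 < a - r -> a + r < b - r -> b + r < 1 -> Int I01 h ->
  `|int01 (fun x => h x * plateau a b r x) - (prim h b - prim h a)| <=
  \int[mu]_(x in `]a - r, a + r[) `|h x| + \int[mu]_(x in `]b - r, b + r[) `|h x|.
Proof.
move=> r0 ar ab br hi; have mI := @measurable_I01 R.
have sub : `]a, b[%classic `<=` (@I01 R) by apply: subset_itv; rewrite bnd_simp; lra.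
have ab' : a <= b by lra.
have a0 : 0 <= a by lra.
have b1 : b <= 1 by lra.
pose J x : R := if a < x < b then 1 else 0.
have hJE : prim h b - prim h a = int01 (fun x => h x * J x).
  rewrite (primB a0 ab' b1 hi) -[in LHS](setIidr sub) Rintegral_mkcondr.
  apply: eq_Rintegral => x _; rewrite patchE /J; case: ifPn.
    by rewrite inE/= in_itv/= => ->; rewrite mulr1.
  by rewrite notin_setE/= in_itv/= => /negP/negbTE ->; rewrite mulr0.
have mJ : measurable_fun I01 J.
  have -> : J = (cst 1 : R -> R) \_ (`]a, b[%classic : set (measurableTypeR R)).
    apply/funext => x; rewrite patchE /J; case: ifPn => h'.
      by rewrite mem_set//= in_itv/=.
    by rewrite memNset//= in_itv/=; exact/negP.
  by apply: (measurable_funS measurableT) => //; apply/(measurable_restrictT _ _).1.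
have cp : continuous (plateau a b r).
  by move=> x; exact: is_derive_cont (is_derive_plateau a b r x).
have mp : measurable_fun I01 (plateau a b r) := Int_meas (Int_cont 0 1 cp).
have pB x : `|plateau a b r x| <= 1 by rewrite ger0_norm ?plateau_le1 ?plateau_ge0.
have JB x : `|J x| <= 1 by rewrite /J; case: ifP => _; rewrite ?normr1 ?normr0.
have i1 : Int I01 (fun x => h x * plateau a b r x) by apply: (@Int_mul_bounded _ _ _ _ 1).
have i2 : Int I01 (fun x => h x * J x) by apply: (@Int_mul_bounded _ _ _ _ 1).
rewrite hJE /int01 -RintegralB//; apply: le_trans (le_normr_Rintegral _ _) _ => //; first exact: IntB.
have hn := Int_norm hi.
pose Fa x := if a - r < x < a + r then `|h x| else 0.
pose Fb x := if b - r < x < b + r then `|h x| else 0.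
have iF (c d : R) : Int I01 (fun x => if c < x < d then `|h x| else 0).
  apply: (Int_le mI _ hn).
    have -> : (fun x => if c < x < d then `|h x| else 0) = (fun x => `|h x|) \_ `]c, d[%classic.
      apply/funext => x; rewrite patchE; case: ifPn => h'.
        by rewrite mem_set//= in_itv/=.
      by rewrite memNset//= in_itv/=; exact/negP.
    apply/measurable_restrict => //.
    by apply: measurable_funS (Int_meas hn) => //; exact: subIsetl.
  by move=> x _; case: ifP => // _; rewrite ?normr_id ?normr0.
have stepF (c d : R) : `]c, d[%classic `<=` (@I01 R) ->
    int01 (fun x => if c < x < d then `|h x| else 0) <= \int[mu]_(x in `]c, d[) `|h x|.
  move=> s; apply: le_int_sub => //.
    by move=> x _ ->.
  by move=> x _ /negbTE ->.
apply: le_trans (lerD (stepF (a - r) (a + r) _) (stepF (b - r) (b + r) _)); last 2 first.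
- by apply: sub_I01; clear -ar ab br r0; lra.
- by apply: sub_I01; clear -ar ab br r0; lra.
rewrite /int01 -RintegralD//; apply: le_Rintegral => //.
- by apply: Int_norm; exact: IntB.
- exact: IntD.
move=> x _; rewrite -mulrBr normrM.
have d1 : `|plateau a b r x - J x| <= 1.
  have := plateau_le1 a b r x; have := plateau_ge0 x r0 ab'.
  by rewrite /J ler_norml; case: ifP => _; lra.
have FF : (a - r < x < a + r) || (b - r < x < b + r) -> `|h x| * `|plateau a b r x - J x| <=
  (if a - r < x < a + r then `|h x| else 0) + (if b - r < x < b + r then `|h x| else 0).
  move=> H; apply: (@le_trans _ _ `|h x|); first by rewrite ler_piMr.
  by move: H; case: ifP => _; case: ifP => _ //= _; rewrite ?lerDl ?addr0 ?add0r.
case: (boolP ((a - r < x < a + r) || (b - r < x < b + r))) => [//|H].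
suff -> : plateau a b r x - J x = 0.
  by rewrite normr0 mulr0; case: ifP => _; case: ifP => _; rewrite ?addr_ge0.
have rr : a < b - r by clear -ab r0; lra.
move: H; rewrite negb_or !negb_and -!leNgt => /andP[/orP[xa|xa] /orP[xb|xb]].
- have h1 : (a < x) = false by apply/negbTE; rewrite -leNgt; clear -xa r0; lra.
  by rewrite /J h1 subr0 /plateau !step_left ?subrr// ler_pdivrMr//; clear -xa ab r0; lra.
- by exfalso; clear -xa xb ab ab' r0; lra.
- have h1 : a < x by clear -xa r0; lra.
  have h2 : x < b by clear -xb r0; lra.
  by rewrite /J h1 h2 plateau_in ?subrr// xa xb.
- have h1 : (x < b) = false by apply/negbTE; rewrite -leNgt; clear -xb r0; lra.
  by rewrite /J h1 andbF subr0 /plateau !step_right ?subrr// ler_pdivlMr//; clear -xb ab r0; lra.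
Qed.

Lemma restrict_in f x : 0 < x < 1 -> (f \_ I01) x = f x.
Proof. by move=> x01; rewrite patchE mem_set// /I01/= in_itv. Qed.

Lemma small_radius (r1 r2 r3 r4 a b e S : R) : 0 < r1 -> 0 < r2 -> 0 < r3 -> 0 < r4 ->
  0 < a -> a < b -> b < 1 -> 0 < e -> 0 < S ->
  exists r, [/\ 0 < r, [/\ r < r1, r < r2, r < r3 & r < r4] &
    [/\ r < a, b + r < 1, a + r < b - r & 2 * r * S <= e]].
Proof.
move=> r10 r20 r30 r40 a0 ab b1 e0 S0.
pose m := Num.min (Num.min (Num.min r1 r2) (Num.min r3 r4))
  (Num.min (Num.min a (1 - b)) (Num.min ((b - a) / 2) (e / (2 * S)))).
have m0 : 0 < m.
  rewrite !lt_min r10 r20 r30 r40 a0/= subr_gt0 b1/= divr_gt0 ?subr_gt0//=.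
  by rewrite divr_gt0 ?mulr_gt0.
have : m <= m by [].
rewrite {2}/m !le_min => /andP[/andP[/andP[h1 h2] /andP[h3 h4]] /andP[/andP[h5 h6] /andP[h7 h8]]].
exists (m / 2); split; first by rewrite divr_gt0.
  by split; [clear -h1 m0|clear -h2 m0|clear -h3 m0|clear -h4 m0]; lra.
split; [clear -h5 m0|clear -h6 m0|clear -h7 m0|]; [lra..|].
by move: h8; rewrite ler_pdivlMr ?mulr_gt0//; clear -e0; lra.
Qed.

(** Testing with the cutoff of (a, b) compares averages of w near a and near b with the integral of
    h between them; at Lebesgue points the errors vanish as r tends to 0. *)
Lemma weak_increment w h a b : Int I01 w -> Int I01 h ->
  (forall phi, C1c01 phi -> int01 (fun x => w x * derive1 phi x) = int01 (fun x => h x * phi x)) ->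
  0 < a -> a < b -> b < 1 ->
  lebesgue_pt (w \_ I01) a -> lebesgue_pt (w \_ I01) b ->
  lebesgue_pt (h \_ I01) a -> lebesgue_pt (h \_ I01) b ->
  w a - w b = prim h b - prim h a.
Proof.
move=> wi hi H a0 ab b1 wa wb ha hb; have mI := @measurable_I01 R.
have wT := Int_restrict wi; have hT := Int_restrict hi.
apply/eqP; rewrite -subr_eq0 -normr_eq0; apply/eqP/le_anti; rewrite normr_ge0 andbT.
apply/ler_addgt0Pr => e0 e00; rewrite add0r.
(* The factor 5 allows an error 2 e for each of the two averages of w and an error e for the
   integral of h near the two ends. *)
have [e [e_gt0 ee0]] : exists e, 0 < e /\ 5 * e <= e0 by exists (e0 / 5); split; lra.
have a01 : 0 < a < 1 by rewrite a0 (lt_trans ab).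
have b01 : 0 < b < 1 by rewrite b1 (lt_trans a0).
have [r1 r10 H1] := lebesgue_small wT wa e_gt0.
have [r2 r20 H2] := lebesgue_small wT wb e_gt0.
have [r3 r30 H3] := lebesgue_small hT ha e_gt0.
have [r4 r40 H4] := lebesgue_small hT hb e_gt0.
pose S := 2 * e + `|h a| + `|h b| + 1.
have S0 : 0 < S by rewrite /S; have := normr_ge0 (h a); have := normr_ge0 (h b); lra.
have [r [r0 [rr1 rr2 rr3 rr4] [ra rb rab rS]]] := small_radius r10 r20 r30 r40 a0 ab b1 e_gt0 S0.
have ar0 : 0 < a - r by clear -ra; lra.
have ar1 : a + r < 1 by clear -rab rb r0; lra.
have br0 : 0 < b - r by clear -ar0 ab; lra.
have [CP dP] := C1c01_plateau r0 (ltW ab) ar0 rb.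
have ct c : continuous (fun x => tent ((x - c) / r) / r).
  by move=> x; apply: cvgM; [exact: tent_shift_cont|exact: cvg_cst].
have tB c x := norm_tent_scaled c x r0.
have wt c : Int I01 (fun x => w x * (tent ((x - c) / r) / r)).
  by apply: Int_mul_bounded => //; exact: (Int_meas (Int_cont 0 1 (ct c))).
have E := H _ CP.
have E1 : int01 (fun x => w x * derive1 (plateau a b r) x) =
    int01 (fun x => w x * (tent ((x - a) / r) / r)) - int01 (fun x => w x * (tent ((x - b) / r) / r)).
  rewrite /int01 -RintegralB//; apply: eq_Rintegral => x _.
  by rewrite dP -mulrBr /dplateau; congr (_ * _); rewrite [LHS]mulrBl.
have avg c : 0 < c < 1 -> 0 < c - r -> c + r < 1 ->
    \int[mu]_(y in `]c - r, c + r[) `|(w \_ I01) y - (w \_ I01) c| <= e * (2 * r) ->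
    `|int01 (fun x => w x * (tent ((x - c) / r) / r)) - w c| <= 2 * e.
  move=> c01 c0 c1 L; apply: le_trans (tent_average r0 c0 c1 wi) _.
  have -> : \int[mu]_(x in `]c - r, c + r[) (`|w x - w c| / r) =
      r^-1 * \int[mu]_(y in `]c - r, c + r[) `|(w \_ I01) y - (w \_ I01) c|.
    rewrite -RintegralZl//; last first.
      apply: Int_norm; apply: IntB => //; last exact: Int_cst_itv.
      by apply: (IntS _ _ _ wT).
    apply: eq_Rintegral => x; rewrite inE/= in_itv/= => /andP[x1 x2].
    by rewrite mulrC !restrict_in//; clear -c0 c1 x1 x2; lra.
  by rewrite ler_pdivrMl//; apply: (le_trans L); rewrite mulrCA [r * (2 * e)]mulrCA (mulrC e).
have A1 := avg a a01 ar0 ar1 (H1 r (introT andP (conj r0 rr1))).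
have A2 := avg b b01 br0 rb (H2 r (introT andP (conj r0 rr2))).
have mass c : 0 < c < 1 -> 0 < c - r -> c + r < 1 ->
    \int[mu]_(y in `]c - r, c + r[) `|(h \_ I01) y - (h \_ I01) c| <= e * (2 * r) ->
    \int[mu]_(x in `]c - r, c + r[) `|h x| <= (e + `|h c|) * (2 * r).
  move=> c01 c0 c1 L.
  have hc : Int `]c - r, c + r[%classic (h \_ I01) by apply: (IntS _ _ _ hT).
  have i1 : Int `]c - r, c + r[%classic (fun y => `|(h \_ I01) y - (h \_ I01) c|).
    by apply: Int_norm; apply: IntB => //; exact: Int_cst_itv.
  have i2 : Int `]c - r, c + r[%classic (cst `|h c|) by exact: Int_cst_itv.
  have i3 : Int `]c - r, c + r[%classic (fun x => `|h x|).
    by apply: Int_norm; apply: IntS hi => //; exact: sub_I01.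
  apply: (@le_trans _ _ (\int[mu]_(y in `]c - r, c + r[) (`|(h \_ I01) y - (h \_ I01) c| + `|h c|))).
    apply: le_Rintegral => //; first exact: IntD.
    move=> x; rewrite /= in_itv/= => /andP[x1 x2]; rewrite !restrict_in//; last by clear -c0 c1 x1 x2; lra.
    by rewrite -{1}(subrK (h c) (h x)) ler_normD.
  rewrite RintegralD// Rintegral_cst_itv; last by clear -r0; lra.
  by rewrite mulrDl; apply: lerD => //; rewrite le_eqVlt; apply/orP; left; apply/eqP; ring.
have B1 := mass a a01 ar0 ar1 (H3 r (introT andP (conj r0 rr3))).
have B2 := mass b b01 br0 rb (H4 r (introT andP (conj r0 rr4))).
have P := plateau_increment r0 ar0 rab rb hi.
rewrite -E E1 in P; apply: le_trans ee0.
move: A1 A2 P rS B1 B2; rewrite /S.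
move: (int01 _) (int01 _) => Ib Ia A1 A2 P rS B1 B2.
have -> : w a - w b - (prim h b - prim h a) = (Ia - Ib - (prim h b - prim h a)) - (Ia - w a) + (Ib - w b).
  by ring.
apply: le_trans (ler_normD _ _) _; apply: le_trans (lerD (ler_normB _ _) (lexx _)) _.
apply: le_trans (lerD (lerD P A1) A2) _.
have := normr_ge0 (h a); have := normr_ge0 (h b); clear -B1 B2 rS r0; nra.
Qed.

(** Almost every point is compared with one fixed common Lebesgue point of w and h, which exists
    since (0, 1) has positive measure. *)
Lemma weak_primitive w h : Int I01 w -> Int I01 h ->
  (forall phi, C1c01 phi -> int01 (fun x => w x * derive1 phi x) = int01 (fun x => h x * phi x)) ->
  exists c, ae_eq01 w (fun x => c - prim h x).
Proof.
move=> wi hi H; have mI := @measurable_I01 R.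
have lw := lebesgue_differentiation (integrable_locally_restrict mI wi).
have lh := lebesgue_differentiation (integrable_locally_restrict mI hi).
have good : {ae mu, forall x, lebesgue_pt (w \_ I01) x /\ lebesgue_pt (h \_ I01) x}.
  by apply: ae_imp2 lw lh.
have [a [a01 [wa ha]]] : exists a, 0 < a < 1 /\ lebesgue_pt (w \_ I01) a /\ lebesgue_pt (h \_ I01) a.
  apply: contrapT => N.
  have neg : mu.-negligible (@I01 R).
    apply: negligibleS good => x; rewrite /I01/= in_itv/= => x01 g.
    by apply: N; exists x.
  have : 1%E = 0%E :> \bar R := etrans (esym (@mu_I01 R)) (measure_negligible mI neg).
  by move=> /eqP; rewrite eqe oner_eq0.
exists (w a + prim h a); apply: ae_imp good => b [wb hb]; rewrite /I01/= in_itv/= => b01.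
have /andP[a0 a1] := a01; have /andP[b0 b1] := b01.
case: (ltgtP a b) => [ab|ba|->]; last by ring.
  by have := weak_increment wi hi H a0 ab b1 wa wb ha hb; lra.
by have := weak_increment wi hi H b0 ba a1 wb wa hb ha; lra.
Qed.

End dubois.

(** * Regularity of weak solutions *)

Section regularity.
Context {R : realType}.
Variables (p k lam : R).
Hypothesis p1 : 1 < p.
Local Notation mu := (@lebesgue_measure R).
Local Notation Int A f := (mu.-integrable A (EFin \o f)).
Implicit Types (f g u v du dv : R -> R).
Let p0 : 0 < p. Proof. exact: lt_trans p1. Qed.
Let p10 : 0 < p - 1. Proof. by rewrite subr_gt0. Qed.

Lemma measurable_grad_norm u du : measurable_fun I01 u -> measurable_fun I01 du ->
  measurable_fun I01 (grad_norm k u du).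
Proof.
move=> mu' mdu; apply: (measurableT_comp (continuous_measurable_fun (@sqrt_continuous R))).
apply: measurable_funD; last exact: measurable_funX.
by apply: measurable_funM => //; exact: measurable_funX.
Qed.

Lemma Int_grad_norm u du : Lp01 p u -> Lp01 p du -> Int I01 (fun x => grad_norm k u du x `^ p).
Proof.
move=> [mu' up] [mdu dup]; have mI := @measurable_I01 R.
apply: (@Int_le _ _ _ (fun x => 2 `^ p * (`|k| `^ p * `|u x| `^ p + `|du x| `^ p))) => //.
- by apply: (measurableT_comp (measurable_powR p)); exact: measurable_grad_norm.
- by apply: IntZ => //; apply: IntD => //; exact: IntZ.
move=> x _; rewrite ger0_norm ?powR_ge0//.
rewrite -powRM//; apply: le_trans (powR_young_sum p1 _ _); rewrite ?mulr_ge0//.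
by apply: ge0_ler_powR; rewrite ?nnegrE ?(ltW p0) ?gradn_ge0 ?addr_ge0 ?mulr_ge0// gradn_le.
Qed.

Lemma Int_dual (a v G : R -> R) (C : R) : measurable_fun I01 a -> (forall x, 0 <= G x) ->
  Int I01 (fun x => G x `^ p) -> 0 <= C -> (forall x, `|a x| <= C * G x `^ (p - 1)) -> Lp01 p v ->
  Int I01 (fun x => a x * v x).
Proof.
move=> ma G0 Gp C0 aG [mv vp]; have mI := @measurable_I01 R.
apply: (@Int_le _ _ _ (fun x => C * (G x `^ p + `|v x| `^ p))) => //.
- exact: measurable_funM.
- by apply: IntZ => //; exact: IntD.
move=> x _; rewrite normrM; apply: (@le_trans _ _ (C * G x `^ (p - 1) * `|v x|)).
  by rewrite ler_wpM2r.
by rewrite -mulrA ler_wpM2l// powR_mul_le.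
Qed.

Lemma measurable_weighted (g f : R -> R) : measurable_fun I01 g -> measurable_fun I01 f ->
  measurable_fun I01 (fun x => g x `^ (p - 2) * f x).
Proof.
by move=> mg mf; apply: measurable_funM => //; apply: (measurableT_comp (measurable_powR (p - 2))).
Qed.

Lemma Int_flux u du v : Lp01 p u -> Lp01 p du -> Lp01 p v ->
  Int I01 (fun x => grad_norm k u du x `^ (p - 2) * du x * v x).
Proof.
move=> Lu Ldu Lv; apply: (Int_dual (G := grad_norm k u du) (C := 1)) => //.
- by apply: measurable_weighted; [apply: measurable_grad_norm; [case: Lu|case: Ldu]|case: Ldu].
- by move=> x; exact: gradn_ge0.
- exact: Int_grad_norm.
move=> x; rewrite mul1r normrM ger0_norm ?powR_ge0// -powRM1 ?gradn_ge0//.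
by rewrite ler_wpM2l ?powR_ge0// le_gradn_snd.
Qed.

Lemma Int_potential u du v : k != 0 -> Lp01 p u -> Lp01 p du -> Lp01 p v ->
  Int I01 (fun x => grad_norm k u du x `^ (p - 2) * u x * v x).
Proof.
move=> k0 Lu Ldu Lv; have nk : 0 < `|k| by rewrite normr_gt0.
apply: (Int_dual (G := grad_norm k u du) (C := `|k|^-1)) => //.
- by apply: measurable_weighted; [apply: measurable_grad_norm; [case: Lu|case: Ldu]|case: Lu].
- by move=> x; exact: gradn_ge0.
- exact: Int_grad_norm.
move=> x; rewrite normrM ger0_norm ?powR_ge0// -powRM1 ?gradn_ge0//.
rewrite mulrCA ler_wpM2l ?powR_ge0// mulrC ler_pdivlMr// mulrC; exact: le_gradn_fst.
Qed.

Lemma Int_mass u v : Lp01 p u -> Lp01 p v -> Int I01 (fun x => `|u x| `^ (p - 2) * u x * v x).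
Proof.
move=> Lu Lv; apply: (Int_dual (G := fun x => `|u x|) (C := 1)) => //.
- by apply: measurable_weighted; [apply: measurableT_comp => //|]; case: Lu.
- exact: Lp_Int.
by move=> x; rewrite mul1r normrM ger0_norm ?powR_ge0// powRM1.
Qed.

(** For k = 0 and p < 2 the integrand without its factor need not be integrable; with k^2 inside the
    integral both claims hold for every k. *)
Lemma potential_scale u du v : Lp01 p u -> Lp01 p du -> Lp01 p v ->
  Int I01 (fun x => k ^+ 2 * (grad_norm k u du x `^ (p - 2) * u x * v x)) /\
  k ^+ 2 * int01 (fun x => grad_norm k u du x `^ (p - 2) * u x * v x) =
  int01 (fun x => k ^+ 2 * (grad_norm k u du x `^ (p - 2) * u x * v x)).
Proof.
move=> Lu Ldu Lv; have mI := @measurable_I01 R; have [k0|kn0] := eqVneq (k ^+ 2) 0.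
  rewrite k0 mul0r; under eq_fun do rewrite mul0r.
  split; first exact: (Int_cst_itv 0 1 0).
  by rewrite /int01 Rintegral_cst_itv// mul0r.
have k0 : k != 0 by apply: contra kn0 => /eqP->; rewrite expr0n.
have i := Int_potential k0 Lu Ldu Lv.
by split; [exact: IntZ|rewrite /int01 RintegralZl].
Qed.

Definition flux_of u du x := grad_norm k u du x `^ (p - 2) * du x.
Definition source_of u du x :=
  lam * (`|u x| `^ (p - 2) * u x) - k ^+ 2 * (grad_norm k u du x `^ (p - 2) * u x).

Lemma weak_flux u du v dv : Lp01 p u -> Lp01 p du -> weak_solution p k lam u du -> W01p p v dv ->
  int01 (fun x => flux_of u du x * dv x) = int01 (fun x => source_of u du x * v x).
Proof.
move=> Lu Ldu ws Wv; have mI := @measurable_I01 R; have [[Lv Ldv _] _] := Wv.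
have [i1 e1] := potential_scale Lu Ldu Lv.
have i2 := Int_mass Lu Lv.
have := ws v dv Wv; rewrite e1 => E.
have -> : int01 (fun x => source_of u du x * v x) =
    lam * int01 (fun x => `|u x| `^ (p - 2) * u x * v x) -
    int01 (fun x => k ^+ 2 * (grad_norm k u du x `^ (p - 2) * u x * v x)).
  rewrite /int01 -RintegralZl// -RintegralB//; last exact: IntZ.
  by apply: eq_Rintegral => x _; rewrite /source_of; ring.
by rewrite -E addrC addKr.
Qed.

Lemma Lp_one : Lp01 p (cst 1 : R -> R).
Proof. by apply: Lp_cont => // x; exact: cvg_cst. Qed.

Lemma Int_flux_of u du : Lp01 p u -> Lp01 p du -> Int I01 (flux_of u du).
Proof.
move=> Lu Ldu; have := Int_flux Lu Ldu Lp_one.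
by apply: eq_integrable; [exact: measurable_I01|move=> x _; rewrite /= mulr1].
Qed.

Lemma Int_source_of u du : Lp01 p u -> Lp01 p du -> Int I01 (source_of u du).
Proof.
move=> Lu Ldu; have mI := @measurable_I01 R.
have [i1 _] := potential_scale Lu Ldu Lp_one.
have := IntB mI (IntZ lam mI (Int_mass Lu Lp_one)) i1.
by apply: eq_integrable; [exact: measurable_I01|move=> x _; rewrite /= !mulr1].
Qed.

(** By homogeneity w = |a|^(p-1) P(b / |a|), and Q inverts P. *)
Lemma flux_slope (a b w : R) : a != 0 -> gradn k a b `^ (p - 2) * b = w ->
  b = `|a| * nslope p k (w / `|a| `^ (p - 1)).
Proof.
move=> a0 <-; have na : 0 < `|a| by rewrite normr_gt0.
have -> : gradn k a b = `|a| * gradn k 1 (b / `|a|).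
  rewrite -gradnM// mulr1 mulrC divfK ?gt_eqF//.
  by rewrite /gradn -(real_normK (num_real a)).
rewrite powRM ?gradn_ge0// -(powRM1 p1 (ltW na)).
have -> : `|a| `^ (p - 2) * gradn k 1 (b / `|a|) `^ (p - 2) * b / (`|a| `^ (p - 2) * `|a|) =
    nflux p k (b / `|a|).
  by rewrite /nflux; field; rewrite !gt_eqF// powR_gt0.
by rewrite nfluxK// mulrC divfK// gt_eqF.
Qed.

Definition slope_of (U W : R -> R) (x : R) : R := `|U x| * nslope p k (W x / `|U x| `^ (p - 1)).
Definition force_of (U W : R -> R) (x : R) : R :=
  (k ^+ 2 * gradn k (U x) (slope_of U W x) `^ (p - 2) - lam * `|U x| `^ (p - 2)) * U x.

(* [W] stands for the flux |grad_k U|^(p-2) U'; away from the zeros of [U], the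
   slope U' is recovered from [U] and [W] through Q. *)
Definition psol (U W : R -> R) :=
  [/\ forall x, 0 <= x <= 1 -> {for x, continuous U} /\ {for x, continuous W},
      U 0 = 0, U 1 = 0,
      forall x : R, 0 < x < 1 -> U x != 0 ->
        is_derive x 1 U (slope_of U W x) /\ is_derive x 1 W (force_of U W x) &
      forall b, 0 <= b <= 1 -> U b = 0 -> W b != 0 ->
        \forall x \near b, 0 <= x <= 1 -> x != b -> U x != 0].

Lemma slope_of_cont (U W : R -> R) x : U x != 0 -> {for x, continuous U} -> {for x, continuous W} ->
  {for x, continuous (slope_of U W)}.
Proof.
move=> Ux cU cW; have nU : 0 < `|U x| by rewrite normr_gt0.
have cn : `|U y| @[y --> x] --> `|U x| by exact: cvg_norm.
apply: cvgM => //.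
have c1 : `|U y| `^ (p - 1) @[y --> x] --> `|U x| `^ (p - 1) by apply: cvg_powR.
have c2 : W y / `|U y| `^ (p - 1) @[y --> x] --> W x / `|U x| `^ (p - 1).
  by apply: cvgM => //; apply: cvgV => //; rewrite gt_eqF ?powR_gt0.
by apply: (cvg_comp _ _ c2); exact: nslope_cont.
Qed.

Lemma force_of_cont (U W : R -> R) x : U x != 0 -> {for x, continuous U} -> {for x, continuous W} ->
  {for x, continuous (force_of U W)}.
Proof.
move=> Ux cU cW; have nU : 0 < `|U x| by rewrite normr_gt0.
have cn : `|U y| @[y --> x] --> `|U x| by exact: cvg_norm.
have cs := slope_of_cont Ux cU cW.
apply: cvgM => //; apply: cvgB; last first.
  apply: cvgM; first exact: cvg_cst.
  have /is_derive_cont c := is_derive1_powR (p - 2) nU.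
  exact: cvg_comp cn c.
have [k0|kn0] := eqVneq (k ^+ 2) 0.
  rewrite [X in _ --> X](_ : _ = 0); last by rewrite k0 !mul0r.
  by apply: cvg_near_cst; near=> t; rewrite k0 !mul0r.
have g0 : 0 < gradn k (U x) (slope_of U W x).
  apply: lt_le_trans (le_gradn_fst _ _ _); rewrite mulr_gt0// normr_gt0.
  by apply: contra kn0 => /eqP->; rewrite expr0n.
apply: cvgM; first exact: cvg_cst.
have /is_derive_cont c := is_derive1_powR (p - 2) g0.
have h : gradn k (U y) (slope_of U W y) @[y --> x] --> gradn k (U x) (slope_of U W x).
  exact: cvg_gradn cU cs.
exact: cvg_comp h c.
Unshelve. all: by end_near. Qed.

(* Where the flux is bounded below and the primitive is small, the density is
   bounded below. *)
Lemma zero_isolated f (W : R -> R) b : Int I01 f -> {for b, continuous W} ->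
  {ae mu, forall t, I01 t -> W t = gradn k (prim f t) (f t) `^ (p - 2) * f t} ->
  0 <= b <= 1 -> prim f b = 0 -> 0 < W b ->
  \forall x \near b, 0 <= x <= 1 -> x != b -> prim f x != 0.
Proof.
move=> fi cW H b01 Ub Wb; have cU := prim_cont fi b01.
(* Near b the flux is at least c, which forces the norm of the gradient to be at least c^(1/(p-1)) =
   2 d. The primitive, multiplied by |k|, accounts for at most d of it, so the density is at least
   d. *)
pose c := W b / 2; have c0 : 0 < c by rewrite divr_gt0.
pose d := c `^ (p - 1)^-1 / 2; have d0 : 0 < d by rewrite divr_gt0// powR_gt0.
have nk : 0 < `|k| + 1 by rewrite ltr_wpDl.
have /nbhs_ballP[r /= r0 hr] : nbhs b [set t | c <= W t /\ `|prim f t| <= d / (`|k| + 1)].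
  apply: filterI.
    move/cvgrPdist_le : cW => /(_ _ c0); apply: filterS => t; rewrite ler_distlC => /andP[+ _].
    by apply: le_trans; rewrite /c; lra.
  have dk : 0 < d / (`|k| + 1) by rewrite divr_gt0.
  move/cvgrPdist_le : cU => /(_ _ dk); apply: filterS => t.
  by rewrite Ub sub0r normrN.
have hr' t : `|b - t| < r -> c <= W t /\ `|prim f t| <= d / (`|k| + 1) by move=> h; exact: hr.
have key : {ae mu, forall t, I01 t -> `|b - t| < r -> d <= f t}.
  apply: ae_imp H => t Ht It tr; have [h1 h2] := hr' t tr.
  have E := Ht It; set g := gradn _ _ _ in E.
  have f0 : 0 < f t.
    rewrite ltNge; apply/negP => f0; have : g `^ (p - 2) * f t <= 0 by rewrite mulr_ge0_le0// powR_ge0.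
    by rewrite -E; lra.
  have cg : c <= g `^ (p - 1).
    apply: (le_trans h1); rewrite E -powRM1 ?gradn_ge0// ler_wpM2l ?powR_ge0//.
    by apply: le_trans (ler_norm _) (le_gradn_snd _ _ _).
  have dg : 2 * d <= g.
    have -> : 2 * d = c `^ (p - 1)^-1 by rewrite /d; field.
    have -> : g = (g `^ (p - 1)) `^ (p - 1)^-1 by rewrite -powRrM divff ?gt_eqF// powRr1// gradn_ge0.
    by apply: ge0_ler_powR; rewrite ?nnegrE ?powR_ge0 ?invr_ge0 ?(ltW p10) ?(ltW c0).
  have := gradn_le k (prim f t) (f t); rewrite -/g (gtr0_norm f0).
  have : `|k| * `|prim f t| <= d.
    apply: (@le_trans _ _ ((`|k| + 1) * (d / (`|k| + 1)))).
      by apply: ler_pM => //; rewrite lerDl.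
    by rewrite mulrC divfK// gt_eqF.
  lra.
have /andP[b0 b1] := b01.
near=> x => /andP[x0 x1] xb.
have xr : `|b - x| < r by near: x; exact: (@nbhsx_ballx _ _ b r).
case: (ltgtP x b) xb => // xb _.
- have : d * (b - x) <= prim f b - prim f x.
    apply: prim_ge => //; first exact: ltW.
    apply: ae_imp key => t kt It /andP[xt tb]; apply: kt => //.
    apply: lt_trans xr; rewrite !ger0_norm ?subr_ge0 ?(ltW tb) ?(ltW xb)//.
    by rewrite ltrD2l ltrN2.
  have : 0 < d * (b - x) by rewrite mulr_gt0// subr_gt0.
  by rewrite Ub sub0r => h1 h2; rewrite lt_eqF//; lra.
- have : d * (x - b) <= prim f x - prim f b.
    apply: prim_ge => //; first exact: ltW.
    apply: ae_imp key => t kt It /andP[bt tx]; apply: kt => //.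
    apply: lt_trans xr; rewrite ![`|b - _|]distrC !ger0_norm ?subr_ge0 ?(ltW bt) ?(ltW xb)//.
    by rewrite ltrD2r.
  have : 0 < d * (x - b) by rewrite mulr_gt0// subr_gt0.
  by rewrite Ub subr0 => h1 h2; rewrite gt_eqF//; lra.
Unshelve. all: by end_near. Qed.

(** Both representatives are primitives, hence continuous. Away from the zeros of U, [du] and
    [source_of u du] agree almost everywhere with continuous expressions in U and W, which turns the
    primitives into classically differentiable functions. *)
Lemma regularity u du : W01p p u du -> weak_solution p k lam u du ->
  exists U W, psol U W /\ ae_eq01 u U.
Proof.
move=> Wu ws; have [[Lu Ldu _] _] := Wu; have mI := @measurable_I01 R.
have [uU U1] := W01p_prim p1 Wu; have duI := Lp_L1 p1 Ldu.
have wI := Int_flux_of Lu Ldu; have hI := Int_source_of Lu Ldu.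
have [c wW] : exists c, ae_eq01 (flux_of u du) (fun x => c - prim (source_of u du) x).
  apply: weak_primitive => // phi Cphi.
  by have := weak_flux Lu Ldu ws (W01p_C1c p1 Cphi).
pose U := prim du; pose W x := c - prim (source_of u du) x.
have cUW x : 0 <= x <= 1 -> {for x, continuous U} /\ {for x, continuous W}.
  move=> x01; split; first exact: prim_cont.
  by apply: cvgB; [exact: cvg_cst|exact: prim_cont].
have WE : {ae mu, forall t, I01 t -> u t = U t /\ W t = gradn k (U t) (du t) `^ (p - 2) * du t}.
  apply: ae_imp2 uU wW => t h1 h2 It; split; first exact: h1.
  by rewrite /W -(h2 It) /flux_of /grad_norm (h1 It).
have near0 x : 0 < x < 1 -> U x != 0 -> \forall e \near 0^'+, forall t, `|t - x| < e -> U t != 0.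
  move=> /andP[x0 x1] Ux; have [cU _] := cUW x (introT andP (conj (ltW x0) (ltW x1))).
  have nU : 0 < `|U x| by rewrite normr_gt0.
  move/cvgrPdist_lt : cU => /(_ _ nU)/nbhs_ballP[r /= r0 hr].
  near=> e => t te; have := hr t; rewrite /ball/= distrC => /(_ (lt_le_trans te _)) h.
  have {}h : `|U x - U t| < `|U x|.
    by apply: h; near: e; apply: nbhs_right_le.
  by apply: contraL h => /eqP ->; rewrite subr0 ltxx.
exists U, W; split; last exact: uU.
split=> //.
- exact: prim0.
- move=> x x01 Ux; have /andP[x0 x1] := x01.
  have [cU cW] := cUW x (introT andP (conj (ltW x0) (ltW x1))).
  have n0 := near0 x x01 Ux; split.
    apply: is_derive_prim_ae => //; first exact: slope_of_cont.
    apply: filterS n0 => e n0; apply: ae_imp WE => t h It te.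
    have [_ h2] := h It; apply: flux_slope (esym h2).
    exact: n0.
  have d : is_derive x 1 (prim (source_of u du)) (- force_of U W x).
    apply: (@is_derive_prim_ae _ _ (fun x => - force_of U W x)) => //.
      by apply: cvgN; exact: force_of_cont.
    apply: filterS n0 => e n0; apply: ae_imp WE => t h It te.
    have [h1 h2] := h It.
    have Ut : U t != 0 by exact: n0.
    have dE := flux_slope Ut (esym h2).
    rewrite /source_of /force_of /grad_norm -/(gradn k (u t) (du t)) h1 /slope_of -dE; ring.
  have := is_deriveB (is_derive_cst c x 1) d.
  by move=> d'; apply: (trigger_derive d'); rewrite sub0r opprK.
- move=> b b01 Ub Wb; have [cU cW] := cUW b b01.
  have [Wp|Wn] := ltP 0 (W b).
    apply: (@zero_isolated du W) => //.
    by apply: ae_imp WE => t h It; have [] := h It.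
  (* A negative flux is reduced to the positive case by a change of sign, the relation between slope
     and flux being odd. *)
  have Wn' : 0 < - W b by rewrite oppr_gt0 lt_neqAle Wb.
  have Z := @zero_isolated (fun t => - du t) (fun t => - W t) b (IntN duI) (cvgN cW) _ b01 _ Wn'.
  have pE t : t <= 1 -> prim (fun t => - du t) t = - U t by move=> t1; rewrite primN.
  have {}Z : \forall x \near b, 0 <= x <= 1 -> x != b -> prim (fun t => - du t) x != 0.
    apply: Z; last by rewrite pE ?Ub ?oppr0//; case/andP: b01.
    apply: ae_imp WE => t h It; have [_ ->] := h It.
    rewrite pE; first by rewrite gradnN mulrN.
    by move: It; rewrite /I01/= in_itv/= => /andP[_ /ltW].
  apply: filterS Z => x Hx x01 xb; have := Hx x01 xb.
  by rewrite pE ?oppr_eq0//; case/andP: x01.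
Unshelve. all: by end_near. Qed.

End regularity.

(** * Nodal intervals *)

Section zeros.
Context {R : realType}.
Implicit Types (f : R -> R) (a b c d x : R).

Lemma last_zero f c d : c < d -> (forall x, c <= x <= d -> {for x, continuous f}) ->
  f c = 0 -> f d != 0 ->
  exists a, [/\ c <= a, a < d, f a = 0 & forall x, a < x -> x <= d -> f x != 0].
Proof.
move=> cd cf fc fd; pose A := [set t | c <= t <= d /\ f t = 0].
have Ac : A c by split=> //; rewrite lexx ltW.
have Ad : ubound A d by move=> t [/andP[]].
have hA : has_sup A by split; [exists c|exists d].
have ca : c <= sup A by exact: ub_le_sup hA.2 _ Ac.
have ad : sup A <= d by apply: ge_sup => //; exists c.
have cfa := cf _ (introT andP (conj ca ad)).
have fa : f (sup A) = 0.
  apply/eqP/negPn/negP => fa; have na : 0 < `|f (sup A)| by rewrite normr_gt0.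
  move/cvgrPdist_lt : cfa => /(_ _ na)/nbhs_ballP[r /= r0 hr].
  have [t [tcd ft] tr] := sup_adherent r0 hA.
  have ts : t <= sup A by apply: (ub_le_sup hA.2); split.
  have /hr : ball (sup A) r t by rewrite /ball/= ger0_norm ?subr_ge0//; lra.
  by rewrite ft subr0 ltxx.
exists (sup A); split=> //.
  by rewrite lt_neqAle ad andbT; apply: contra fd => /eqP <-; rewrite fa.
move=> x ax xd; apply/eqP => fx; have : x <= sup A.
  by apply: (ub_le_sup hA.2); split=> //; rewrite xd (le_trans ca (ltW ax)).
by rewrite leNgt ax.
Qed.

Lemma first_zero f c d : c < d -> (forall x, c <= x <= d -> {for x, continuous f}) ->
  f d = 0 -> f c != 0 ->
  exists b, [/\ c < b, b <= d, f b = 0 & forall x, c <= x -> x < b -> f x != 0].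
Proof.
move=> cd cf fd fc; have [||||b [h1 h2 h3 h4]] := @last_zero (f \o -%R) (- d) (- c).
- by rewrite ltrN2.
- move=> x xdc; apply: continuous_comp; first exact: opp_continuous.
  by apply: cf; lra.
- by rewrite /= opprK.
- by rewrite /= opprK.
exists (- b); split; [lra|lra|exact: h3|].
by move=> x cx xb; have := h4 (- x); rewrite /= opprK; apply; lra.
Qed.

Lemma nonzero_sign f a b : (forall x, a < x < b -> {for x, continuous f}) ->
  (forall x, a < x < b -> f x != 0) ->
  (forall x, a < x < b -> 0 < f x) \/ (forall x, a < x < b -> f x < 0).
Proof.
move=> cf f0.
have H x y : a < x < b -> a < y < b -> x <= y -> f x * f y < 0 -> False.
  move=> /andP[ax xb] /andP[ay yb] xy fxy.
  have cw : {within `[x, y], continuous f}.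
    by apply: continuous_in_subspaceT => t; rewrite inE/= in_itv/= => /andP[xt ty]; apply: cf; lra.
  have [|c cxy fc] := @IVT R f x y 0 xy cw.
    rewrite ge_min le_max; case: (ltP (f x) 0) fxy => fx.
      by rewrite nmulr_rlt0// => /ltW ->; rewrite (ltW fx) orbT.
    move=> h; rewrite andbT; apply/orP; right; rewrite leNgt; apply/negP => fy.
    by move: h; rewrite ltNge mulr_ge0// ltW.
  have := f0 c; rewrite fc eqxx => /(_ _)/negP; case => //.
  by move: cxy; rewrite in_itv/=; lra.
have [[m mab fm]|N] := pselect (exists2 m, a < m < b & 0 < f m); [left|right] => x xab.
  rewrite lt_neqAle eq_sym f0//= leNgt; apply/negP => fx.
  case: (leP x m) => [h|/ltW h]; first by apply: (H x m) => //; rewrite nmulr_rlt0.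
by apply: (H m x) => //; rewrite pmulr_rlt0.
rewrite lt_neqAle f0//= leNgt; apply/negP => fx; apply: N; by exists x.
Qed.

Lemma derive0_const f a b : (forall x : R, a < x < b -> is_derive x 1 f 0) ->
  forall x y, a < x < b -> a < y < b -> f x = f y.
Proof.
move=> H; have K x y : a < x < b -> a < y < b -> x < y -> f x = f y.
  move=> /andP[ax xb] /andP[ay yb] xy.
  have [|c _ E] := @MVT_is_derive R f (fun=> 0) x y xy; first by move=> t txy; apply: H; lra.
  by apply/esym/eqP; rewrite -subr_eq0 E mul0r.
by move=> x y xab yab; case: (ltgtP x y) => [h|h|->//]; [exact: K|exact/esym/K].
Qed.

End zeros.

Section components.
Context {R : realType}.
Variables (p k lam : R).
Hypothesis p1 : 1 < p.
Implicit Types (U W : R -> R) (a b x : R).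
Local Notation psol := (psol p k lam).

Lemma psolN U W : psol U W -> psol (fun x => - U x) (fun x => - W x).
Proof.
move=> [c U0 U1 d z].
have sE x : slope_of p k (fun x => - U x) (fun x => - W x) x = - slope_of p k U W x.
  by rewrite /slope_of normrN mulNr (nslopeN k p1) mulrN.
split.
- by move=> x /c[c1 c2]; split; exact: cvgN.
- by rewrite U0 oppr0.
- by rewrite U1 oppr0.
- move=> x x01; rewrite oppr_eq0 => /(d _ x01)[d1 d2]; split.
    by apply: (trigger_derive (is_deriveN d1)); rewrite sE.
  apply: (trigger_derive (is_deriveN d2)).
  by rewrite /force_of sE gradnN normrN mulrN.
move=> b b01 /eqP; rewrite oppr_eq0 => /eqP Ub; rewrite oppr_eq0 => /(z _ b01 Ub).
by apply: filterS => x h x01 xb; rewrite oppr_eq0; exact: h.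
Qed.

Hypothesis lamk : `|k| `^ p < lam.
Local Notation T := (period p k lam).
Local Notation phase := (phase p k lam).
Local Notation namp := (namp p k lam).
Local Notation nslope := (nslope p k).
Local Notation hamil := (hamil p k).
Local Notation zsol := (zsol p k lam).

(** The limits of z at the ends come from the relation U = C [namp (z)]: U tends to 0, while [namp]
    has a positive minimum on each compact interval, so the decreasing function z leaves every
    compact set. The phase then has the limits T at a and 0 at b, and the flux has nonzero
    limits. *)
Lemma pos_component U W a b : psol U W -> 0 <= a -> a < b -> b <= 1 -> U a = 0 -> U b = 0 ->
  (forall x, a < x < b -> 0 < U x) ->
  [/\ b - a = T, W a != 0, W b != 0 &
    exists C, forall x, a < x < b -> U x = C * namp (zsol (x - a))].
Proof.
move=> [cUW _ _ dUW _] a0 ab b1 Ua Ub Upos.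
have cU x : 0 <= x <= 1 -> {for x, continuous U} by case/cUW.
have cW x : 0 <= x <= 1 -> {for x, continuous W} by case/cUW.
pose z x := U x `^ (- (p - 1)) * W x.
have in01 x : a < x < b -> 0 < x < 1 by lra.
have zE x : z x = W x / U x `^ (p - 1) by rewrite /z powRN mulrC.
have dU x : a < x < b -> is_derive x 1 U (U x * nslope (z x)).
  move=> xab; have Ux := Upos x xab.
  have [d _] := dUW x (in01 x xab) (lt0r_neq0 Ux).
  by apply: (trigger_derive d); rewrite /slope_of gtr0_norm// zE.
have dz x : a < x < b -> is_derive x 1 z (- (lam + hamil (z x))).
  move=> xab; have Ux := Upos x xab; have Up := powR_gt0 (p - 1) Ux.
  have [_ d2] := dUW x (in01 x xab) (lt0r_neq0 Ux).
  have d3 := @is_derive1_comp R (fun y => y `^ (- (p - 1))) U x _ _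
    (is_derive1_powR (- (p - 1)) Ux) (dU x xab).
  apply: (trigger_derive (is_deriveM d3 d2)); rewrite /GRing.scale/= /force_of /slope_of gtr0_norm//.
  rewrite -zE hamilE// -[X in gradn k X (U x * _)]mulr1 gradnM ?(ltW Ux)// powRM ?gradn_ge0 ?(ltW Ux)//.
  have gz : gradn k 1 (nslope (z x)) `^ (p - 2) * nslope (z x) = z x by exact: nslopeK.
  have U1 : U x `^ (- (p - 1) - 1) * U x = U x `^ (- (p - 1)).
    by rewrite powRD ?(gt_eqF Ux) ?implybT// (powR_inv1 (ltW Ux)) divfK// gt_eqF.
  have U2 : U x `^ (- (p - 1)) * (U x `^ (p - 2) * U x) = 1.
    by rewrite (powRM1 p1 (ltW Ux)) powRN mulVf// gt_eqF.
  have Wz : U x `^ (- (p - 1)) * W x = z x by [].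
  set q := nslope (z x) in gz *; set g := gradn k 1 q `^ (p - 2) in gz *.
  have alg (A B D w u : R) : D * ((k ^+ 2 * (A * g) - lam * A) * u) + w * (- (p - 1) * B * (u * q)) =
      D * (A * u) * (k ^+ 2 * g - lam) - (p - 1) * (B * u * w) * q by ring.
  rewrite alg U1 U2 Wz; move: (z x) gz => ? <-; ring.
have n0 x := namp_gt0 p1 lamk (z x).
(* U / [namp (z)] is the p-th root of the conserved quantity U^p (lam + N(z)). *)
have [C UC] : exists C, forall x, a < x < b -> U x = C * namp (z x).
  pose m := (a + b) / 2; exists (U m / namp (z m)) => x xab.
  have mab : a < m < b by rewrite /m; lra.
  suff <- : U x / namp (z x) = U m / namp (z m) by rewrite divfK// lt0r_neq0.
  apply: (derive0_const (f := fun x => U x * (namp (z x))^-1) _ xab mab) => t tab.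
  have e0 := energy_gt0 p1 lamk (z t).
  have d1 := @is_derive1_comp R namp z t _ _ (is_derive_namp p1 lamk (z t)) (dz t tab).
  have d2 := @is_deriveV R (namp \o z) t _ 1 (lt0r_neq0 (n0 t)) d1.
  apply: (trigger_derive (is_deriveM (dU t tab) d2)); rewrite /GRing.scale/=.
  by field; rewrite !gt_eqF.
have C0 : 0 < C.
  have mab : a < (a + b) / 2 < b by lra.
  by have := Upos _ mab; rewrite UC// pmulr_lgt0.
(* The phase decreases at unit speed; the constant c is identified afterwards from the limits of the
   phase at the two ends. *)
have [c phc] : exists c, forall x, a < x < b -> phase (z x) = c - x.
  pose m := (a + b) / 2; exists (phase (z m) + m) => x xab.
  have mab : a < m < b by rewrite /m; lra.
  apply: (addIr x); rewrite subrK.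
  apply: (derive0_const (f := fun x => phase (z x) + x) _ xab mab) => t tab.
  have e0 := energy_gt0 p1 lamk (z t).
  have d1 := @is_derive1_comp R phase z t _ _ (is_derive_phase p1 lamk (z t)) (dz t tab).
  apply: (trigger_derive (is_deriveD d1 (is_derive_id t 1))).
  by rewrite /rate; field; rewrite gt_eqF.
have zlt x y : a < x < b -> a < y < b -> x < y -> z y < z x.
  by move=> xab yab xy; rewrite -(leW_mono (le_mono (phase_incr p1 lamk))) !phc//; lra.
have unb e : 0 <= e <= 1 -> U e = 0 -> forall A B, \forall x \near e, a < x < b -> ~~ (A <= z x <= B).
  move=> e01 Ue A B; have [BA|AB] := ltP B A.
    near=> x => _; apply/negP => /andP[h1 h2]; lra.
  have cn : {within `[A, B], continuous namp}.
    by apply: continuous_subspaceT => t; exact: (namp_cont p1 lamk).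
  have [t _ tmin] := EVT_min AB cn.
  have ct : 0 < C * namp t by rewrite mulr_gt0// namp_gt0.
  move/cvgrPdist_lt : (cU e e01) => /(_ _ ct); apply: filterS => x.
  rewrite Ue sub0r normrN => h xab; apply/negP => zAB.
  move: h; rewrite gtr0_norm ?Upos// UC// ltr_pM2l// ltNge tmin//.
have a01 : 0 <= a <= 1 by lra.
have b01 : 0 <= b <= 1 by lra.
pose m := (a + b) / 2; have mab : a < m < b by rewrite /m; lra.
have za : z x @[x --> a^'+] --> +oo.
  apply/cvgryPge => M; near=> x.
  have ax : a < x by [].
  have xm : x < m by near: x; apply: nbhs_right_lt; case/andP: mab.
  have xab : a < x < b by lra.
  have := zlt _ _ xab mab xm => zz.
  have : ~~ (z m <= z x <= M).
    move: xab; near: x; exact: cvg_within (unb a a01 Ua (z m) M).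
  by rewrite (ltW zz)/= -ltNge => /ltW.
have zb : z x @[x --> b^'-] --> -oo.
  apply/cvgrNyPle => M; near=> x.
  have xb : x < b by [].
  have xm : m < x by near: x; apply: nbhs_left_gt; case/andP: mab.
  have xab : a < x < b by lra.
  have := zlt _ _ mab xab xm => zz.
  have : ~~ (M <= z x <= z m).
    move: xab; near: x; exact: cvg_within (unb b b01 Ub M (z m)).
  by rewrite (ltW zz) andbT -ltNge => /ltW.
have neara : \forall x \near a^'+, a < x < b.
  by near=> x; apply/andP; split => //; near: x; exact: nbhs_right_lt.
have nearb : \forall x \near b^'-, a < x < b.
  by near=> x; apply/andP; split => //; near: x; exact: nbhs_left_gt.
have caT : c - a = T.
  have h1 : (c - x) @[x --> a^'+] --> c - a.
    by apply: cvg_at_right_filter; apply: cvgB; [exact: cvg_cst|exact: cvg_id].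
  have h2 : (c - x) @[x --> a^'+] --> T.
    apply: cvg_trans (cvg_comp _ _ za (phase_pinfty p1 lamk)); apply: near_eq_cvg.
    by apply: filterS neara => x xab; rewrite /= phc.
  exact: (cvg_unique _ h1 h2).
have cb0 : c - b = 0.
  have h1 : (c - x) @[x --> b^'-] --> c - b.
    by apply: cvg_at_left_filter; apply: cvgB; [exact: cvg_cst|exact: cvg_id].
  have h2 : (c - x) @[x --> b^'-] --> (0 : R).
    apply: cvg_trans (cvg_comp _ _ zb (phase_ninfty p1 lamk)); apply: near_eq_cvg.
    by apply: filterS nearb => x xab; rewrite /= phc.
  exact: (cvg_unique _ h1 h2).
have WE x : a < x < b -> W x = C `^ (p - 1) * (namp (z x) `^ (p - 1) * z x).
  move=> xab; rewrite mulrA -powRM ?(ltW C0) ?(ltW (n0 x))// -UC// zE mulrC divfK//.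
  by rewrite gt_eqF// powR_gt0// Upos.
have Cd : 0 < C `^ (p - 1) * dlim p `^ (p - 1).
  by rewrite mulr_gt0// powR_gt0// dlim_gt0.
split.
- lra.
- have h1 := cvg_at_right_filter (cW a a01).
  have h2 : W x @[x --> a^'+] --> C `^ (p - 1) * dlim p `^ (p - 1).
    apply: cvg_trans (cvg_comp _ _ za (cvgM (cvg_cst _) (namp_flux_pinfty p1 lamk))).
    by apply: near_eq_cvg; apply: filterS neara => x xab; rewrite /= WE.
  by rewrite (cvg_unique _ h1 h2)// gt_eqF.
- have h1 := cvg_at_left_filter (cW b b01).
  have h2 : W x @[x --> b^'-] --> C `^ (p - 1) * - dlim p `^ (p - 1).
    have od t : namp (- t) `^ (p - 1) * (- t) = - (namp t `^ (p - 1) * t) by rewrite (nampN k p1) mulrN.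
    apply: cvg_trans (cvg_comp _ _ zb (cvgM (cvg_cst _) (cvg_odd od (namp_flux_pinfty p1 lamk)))).
    by apply: near_eq_cvg; apply: filterS nearb => x xab; rewrite /= WE.
  by rewrite (cvg_unique _ h1 h2)// mulrN oppr_eq0 gt_eqF.
exists C => x xab; suff <- : z x = zsol (x - a) by exact: UC.
apply: (can_inj (phaseK p1 lamk)); rewrite (phc x xab) zsol_phase//; lra.
Unshelve. all: by end_near. Qed.

Lemma component U W a b : psol U W -> 0 <= a -> a < b -> b <= 1 -> U a = 0 -> U b = 0 ->
  (forall x, a < x < b -> U x != 0) ->
  [/\ b - a = T, W a != 0, W b != 0 &
    exists C, forall x, a < x < b -> U x = C * namp (zsol (x - a))].
Proof.
move=> S a0 ab b1 Ua Ub U0; have [cUW _ _ _ _] := S.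
have [|H|H] := @nonzero_sign R U a b _ U0.
- by move=> x xab; apply: (proj1 (cUW x _)); lra.
- exact: pos_component S _ _ _ _ _ _.
have [||x xab|h1 h2 h3 [C hC]] := pos_component (psolN S) a0 ab b1.
- by rewrite Ua oppr0.
- by rewrite Ub oppr0.
- by rewrite oppr_gt0 H.
split=> //; [by rewrite -oppr_eq0|by rewrite -oppr_eq0|].
by exists (- C) => x xab; rewrite mulNr -hC// opprK.
Qed.

Lemma component_exists U W x : psol U W -> 0 < x < 1 -> U x != 0 ->
  exists a b, [/\ 0 <= a, a < x < b, b <= 1, U a = 0 /\ U b = 0 & forall t, a < t < b -> U t != 0].
Proof.
move=> [cUW U0 U1 _ _] /andP[x0 x1] Ux.
have [t tx|a [a0 ax Ua Ha]] := last_zero x0 _ U0 Ux; first by apply: (proj1 (cUW t _)); lra.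
have [t tx|b [xb b1 Ub Hb]] := first_zero x1 _ U1 Ux; first by apply: (proj1 (cUW t _)); lra.
exists a, b; split=> //; first by rewrite ax.
by move=> t /andP[at' tb]; case: (leP t x) => [|/ltW] h; [exact: Ha|exact: Hb].
Qed.

(** A zero with nonzero flux is isolated, so a point just to the right of b lies in a nodal
    interval, which must start at b and end at b + T. The flux is again nonzero there, which allows
    iteration. *)
Lemma next_zero U W b : psol U W -> 0 <= b < 1 -> U b = 0 -> W b != 0 ->
  [/\ b + T <= 1, U (b + T) = 0 & W (b + T) != 0].
Proof.
move=> S /andP[b0 b1] Ub Wb; have [cUW _ U1 _ isol] := S.
have b01 : 0 <= b <= 1 by lra.
have /nbhs_ballP[r /= r0 hr] := isol b b01 Ub Wb.
pose m := Num.min (r / 2) ((1 - b) / 2).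
have m0 : 0 < m by rewrite lt_min !divr_gt0// subr_gt0.
have [mr mb] : m <= r / 2 /\ m <= (1 - b) / 2 by rewrite !ge_min !lexx orbT.
pose x := b + m.
have near0 t : b < t <= x -> U t != 0.
  move=> /andP[bt tx]; rewrite /x in tx; apply: hr; [|lra|by rewrite gt_eqF].
  by rewrite /ball/= distrC gtr0_norm ?subr_gt0//; lra.
have bx : b < x by rewrite /x; lra.
have x01 : 0 < x < 1 by rewrite /x; lra.
have Ux : U x != 0 by apply: near0; rewrite bx lexx.
have [a [c [a0 /andP[ax xc] c1 [Ua Uc] H]]] := component_exists S x01 Ux.
have ab : a = b.
  case: (ltgtP a b) => // ab.
    by have := H b; rewrite Ub eqxx => /(_ _)/negP; case => //; lra.
  by have := near0 a; rewrite Ua eqxx => /(_ _)/negP; case => //; lra.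
have [cT _ Wc _] := component S a0 (lt_trans ax xc) c1 Ua Uc H.
by have -> : b + T = c by rewrite -cT -ab; ring.
Qed.

Lemma prev_zero U W b : psol U W -> 0 < b <= 1 -> U b = 0 -> W b != 0 ->
  [/\ 0 <= b - T, U (b - T) = 0 & W (b - T) != 0].
Proof.
move=> S /andP[b0 b1] Ub Wb; have [cUW U0 _ _ isol] := S.
have b01 : 0 <= b <= 1 by lra.
have /nbhs_ballP[r /= r0 hr] := isol b b01 Ub Wb.
pose m := Num.min (r / 2) (b / 2).
have m0 : 0 < m by rewrite lt_min !divr_gt0.
have [mr mb] : m <= r / 2 /\ m <= b / 2 by rewrite !ge_min !lexx orbT.
pose x := b - m.
have near0 t : x <= t < b -> U t != 0.
  move=> /andP[tx bt]; rewrite /x in tx; apply: hr; [|lra|by rewrite lt_eqF].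
  by rewrite /ball/= gtr0_norm ?subr_gt0//; lra.
have bx : x < b by rewrite /x; lra.
have x01 : 0 < x < 1 by rewrite /x; lra.
have Ux : U x != 0 by apply: near0; rewrite bx lexx.
have [c [a [c0 /andP[cx xa] a1 [Uc Ua] H]]] := component_exists S x01 Ux.
have ab : a = b.
  case: (ltgtP a b) => // ab.
    by have := near0 a; rewrite Ua eqxx => /(_ _)/negP; case => //; lra.
  by have := H b; rewrite Ub eqxx => /(_ _)/negP; case => //; lra.
have [cT Wc _ _] := component S c0 (lt_trans cx xa) a1 Uc Ua H.
by have -> : b - T = c by rewrite -cT -ab; ring.
Qed.

(** From one nodal interval (a, b), steps of length T lead exactly down to 0 and up to 1, so a = n1
    T and 1 - b = n2 T; the starting interval adds 1 to n1 + n2. The inductions run on a bound for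
    the number of steps, given by the Archimedean property. *)
Lemma psol_quantized U W x : psol U W -> 0 < x < 1 -> U x != 0 ->
  exists n, (0 < n)%N /\ n%:R * T = 1.
Proof.
move=> S x01 Ux; have T0 := period_gt0 p1 lamk.
have [a [b [a0 /andP[ax xb] b1 [Ua Ub] H]]] := component_exists S x01 Ux.
have [baT Wa Wb _] := component S a0 (lt_trans ax xb) b1 Ua Ub H.
have left N : forall t, 0 <= t <= 1 -> U t = 0 -> W t != 0 -> t <= N%:R * T ->
    exists n, t = n%:R * T.
  elim: N => [|N IH] t /andP[t0 t1] Ut Wt tN.
    by exists 0%N; move: tN; rewrite mul0r; lra.
  have [->|tn0] := eqVneq t 0; first by exists 0%N; rewrite mul0r.
  have [|h1 h2 h3] := prev_zero S _ Ut Wt; first by rewrite t1 andbT lt_neqAle eq_sym tn0.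
  have [||n nE] := IH _ _ h2 h3; [lra|by move: tN; rewrite -natr1 mulrDl; lra|].
  by exists n.+1; rewrite -natr1 mulrDl mul1r -nE subrK.
have right N : forall t, 0 <= t <= 1 -> U t = 0 -> W t != 0 -> 1 - t <= N%:R * T ->
    exists n, 1 - t = n%:R * T.
  elim: N => [|N IH] t /andP[t0 t1] Ut Wt tN.
    by exists 0%N; move: tN; rewrite mul0r; lra.
  have [->|tn1] := eqVneq t 1; first by exists 0%N; rewrite mul0r subrr.
  have [|h1 h2 h3] := next_zero S _ Ut Wt; first by rewrite t0 lt_neqAle tn1.
  have [||n nE] := IH _ _ h2 h3; [lra|by move: tN; rewrite -natr1 mulrDl; lra|].
  by exists n.+1; rewrite -natr1 mulrDl mul1r -nE; ring.
have big t : exists N, t <= N%:R * T.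
  exists (Num.bound `|t / T|); rewrite -ler_pdivrMr//.
  by apply: le_trans (ler_norm _) (ltW (archi_boundP (normr_ge0 _))).
have [Na hNa] := big a; have [Nb hNb] := big (1 - b).
have [|n1 e1] := left Na a _ Ua Wa hNa; first by lra.
have [|n2 e2] := right Nb b _ Ub Wb hNb; first by lra.
exists (n1 + n2).+1; split => //.
by rewrite -natr1 natrD !mulrDl -e1 -e2; lra.
Qed.

Lemma psol_period1 U W : T = 1 -> psol U W ->
  exists C, forall x, 0 < x < 1 -> U x = C * namp (zsol x).
Proof.
move=> T1 S; have [[x x01 Ux]|N] := pselect (exists2 x, 0 < x < 1 & U x != 0).
  have [a [b [a0 /andP[ax xb] b1 [Ua Ub] H]]] := component_exists S x01 Ux.
  have [baT _ _ [C hC]] := component S a0 (lt_trans ax xb) b1 Ua Ub H.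
  have a_0 : a = 0 by lra.
  have b_1 : b = 1 by lra.
  by exists C => t t01; rewrite hC a_0 ?subr0// b_1.
exists 0 => x x01; rewrite mul0r; apply/eqP/negPn/negP => Ux; apply: N; by exists x.
Qed.

End components.

(** * Eigenvalues and eigenfunctions *)

Section eigenvalues.
Context {R : realType}.
Variables (p k : R).
Hypothesis p1 : 1 < p.
Local Notation mu := (@lebesgue_measure R).
Local Notation Int A f := (mu.-integrable A (EFin \o f)).
Implicit Types (u du v dv U W : R -> R) (lam nu : R).
Local Notation T := (period p k).
Let p0 : 0 < p. Proof. exact: lt_trans p1. Qed.

Lemma ae_neq0_lt u (t : R) : 0 < t -> t <= 1 -> (forall x, 0 < x < t -> u x != 0) ->
  ~ ae_eq01 u (cst 0).
Proof.
move=> t0 t1 H u0; have mt : measurable (`]0, t[%classic : set (measurableTypeR R)) by exact: measurable_itv.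
have neg : mu.-negligible (`]0, t[%classic : set (measurableTypeR R)).
  apply: negligibleS u0 => x /=; rewrite in_itv/= => x0t.
  have x01 : I01 x by rewrite /I01/= in_itv/=; lra.
  by move=> /(_ x01) E; have := H x x0t; rewrite E eqxx.
have E : mu `]0, t[%classic = t%:E.
  by rewrite lebesgue_measure_itv/= lte_fin t0 oppr0 adde0.
by have := etrans (esym E) (measure_negligible mt neg) => -[] /eqP; rewrite gt_eqF.
Qed.

Lemma Lp_mass_gt0 u : Lp01 p u -> ~ ae_eq01 u (cst 0) -> 0 < int01 (fun x => `|u x| `^ p).
Proof.
move=> Lu u0; have mI := @measurable_I01 R; rewrite lt_neqAle int01_pow_ge0 andbT eq_sym.
apply/eqP => A0; apply: u0; have := ae0_Rintegral mI (Lp_Int Lu).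
have -> : \int[mu]_(x in I01) `| (`|u x| `^ p) | = 0.
  by rewrite -[RHS]A0; apply: eq_Rintegral => x _; rewrite ger0_norm// powR_ge0.
move=> /(_ erefl); apply: ae_imp => x H Ix; have /eqP := H Ix.
by rewrite powR_eq0 normr_eq0 => /andP[/eqP].
Qed.

Lemma energy_identity lam u du : W01p p u du -> weak_solution p k lam u du ->
  int01 (fun x => grad_norm k u du x `^ p) = lam * int01 (fun x => `|u x| `^ p).
Proof.
move=> Wu ws; have [[Lu Ldu _] _] := Wu; have mI := @measurable_I01 R.
have [i1 e1] := potential_scale k p1 Lu Ldu Lu.
have i2 := Int_flux k p1 Lu Ldu Ldu.
have -> : int01 (fun x => `|u x| `^ p) = int01 (fun x => `|u x| `^ (p - 2) * u x * u x).
  apply: eq_Rintegral => x _; rewrite -mulrA -expr2 -(powRM2 p0 (normr_ge0 _)).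
  by rewrite real_normK// num_real.
rewrite -(ws u du Wu) e1 /int01 -RintegralD//; apply: eq_Rintegral => x _.
by rewrite -(powRM2 p0 (gradn_ge0 k (u x) (du x))) gradn_sq /grad_norm /gradn; ring.
Qed.

(** If lam <= |k|^p, the energy identity makes the integral of the nonnegative function [D] at most
    0. Then u' = 0 almost everywhere, and the zero boundary value makes u vanish. *)
Lemma eigenvalue_gt lam u : is_eigenfunction p k lam u -> `|k| `^ p < lam.
Proof.
move=> [u0 [du Wu ws]]; have [[Lu Ldu _] _] := Wu; have mI := @measurable_I01 R.
have A0 := Lp_mass_gt0 Lu u0; have E := energy_identity Wu ws.
have [_ |lamk //] := ltP (`|k| `^ p) lam; first by [].
exfalso; apply: u0; have ip := Int_grad_norm k p1 Lu Ldu; have iu := IntZ (`|k| `^ p) mI (Lp_Int Lu).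
pose D x := grad_norm k u du x `^ p - `|k| `^ p * `|u x| `^ p.
have iD : Int I01 D by exact: IntB.
have D0 x : 0 <= D x.
  rewrite subr_ge0 -powRM//; apply: ge0_ler_powR; rewrite ?nnegrE ?(ltW p0) ?gradn_ge0 ?mulr_ge0//.
  exact: le_gradn_fst.
have DI : \int[mu]_(x in I01) `|D x| = 0.
  have -> : \int[mu]_(x in I01) `|D x| = \int[mu]_(x in I01) D x.
    by apply: eq_Rintegral => x _; rewrite ger0_norm.
  apply/le_anti/andP; split; last by apply: Rintegral_ge0 => x _; exact: D0.
  rewrite /D RintegralB// RintegralZl//; last exact: Lp_Int.
  rewrite -/(int01 _) -/(int01 _) E -mulrBl mulr_le0_ge0 ?(ltW A0)// subr_le0//.
have du0 : ae_eq01 du (cst 0).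
  apply: ae_imp (ae0_Rintegral mI iD DI) => x H Ix; have /eqP := H Ix.
  rewrite subr_eq0 -powRM// => /eqP Ep.
  have {}Ep : grad_norm k u du x = `|k| * `|u x|.
    rewrite -[LHS](powRr1 (gradn_ge0 _ _ _)) -[RHS]powRr1 ?mulr_ge0//.
    by rewrite -(divff (lt0r_neq0 p0)) !powRrM Ep.
  have := gradn_sq k (u x) (du x); rewrite /gradn -/(grad_norm k u du x) Ep exprMn !real_normK ?num_real//.
  by move/eqP; rewrite -subr_eq0 opprD addrA subrr sub0r oppr_eq0 sqrf_eq0 => /eqP.
have [uU _] := W01p_prim p1 Wu.
apply: ae_imp uU => x H Ix; rewrite H//.
have /andP[x0 x1] : 0 < x < 1 by move: Ix; rewrite /I01/= in_itv.
have duI := Lp_L1 p1 Ldu.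
apply/le_anti; rewrite -[prim du x]subr0 -{1 4}(prim0 du).
have h1 := @prim_le R du 0 x 0 (lexx _) (ltW x0) (ltW x1) duI.
have h2 := @prim_ge R du 0 x 0 (lexx _) (ltW x0) (ltW x1) duI.
rewrite !mul0r in h1 h2; rewrite h1 ?h2//; apply: ae_imp du0 => t Ht It _; by rewrite Ht.
Qed.

Lemma csol_weak lam u d w h : csol p k lam 1 u d w h -> u 0 = 0 -> u 1 = 0 ->
  W01p p u d /\ weak_solution p k lam u d.
Proof.
move=> [[du cd dw ch] wE hE] u0 u1; have Wu := W01p_C1 p1 du cd u0 u1.
split=> // v dv Wv; have [[Lu Ldu _] _] := Wu; have [[Lv Ldv _] _] := Wv.
have mI := @measurable_I01 R.
have [i1 e1] := potential_scale k p1 Lu Ldu Lv; have i2 := Int_mass p1 Lu Lv.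
have in01 x : x \in @I01 R -> 0 < x < 1 by rewrite inE /I01/= in_itv.
have -> : int01 (fun x => grad_norm k u d x `^ (p - 2) * d x * dv x) = int01 (fun x => w x * dv x).
  by apply: eq_Rintegral => x /in01 x01; rewrite wE.
rewrite (W01p_by_parts p1 dw ch Wv).
have -> : int01 (fun x => h x * v x) =
    int01 (fun x => k ^+ 2 * (grad_norm k u d x `^ (p - 2) * u x * v x)) -
    lam * int01 (fun x => `|u x| `^ (p - 2) * u x * v x).
  rewrite /int01 -RintegralZl// -RintegralB//; last exact: IntZ.
  by apply: eq_Rintegral => x /in01 x01; rewrite hE// /grad_norm /gradn; ring.
by rewrite e1; ring.
Qed.

Lemma eigenfunction_exists lam n : `|k| `^ p < lam -> (0 < n)%N -> n%:R * T lam = 1 ->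
  exists2 u, is_eigenfunction p k lam u &
    forall x, 0 < x < T lam -> u x = namp p k lam (zsol p k lam x).
Proof.
move=> lamk n0 nT; have [u [d [w [h [S [u0 uE u1] _ _ _]]]]] := csol_exists p1 lamk n0.
rewrite nT in S u1; have [Wu ws] := csol_weak S u0 u1.
exists u => //; split; last by exists d.
have T0 := period_gt0 p1 lamk.
apply: (@ae_neq0_lt _ (T lam)) => //.
  by rewrite -nT ler_peMl ?(ltW T0)// ler1n.
by move=> x x0T; rewrite uE// gt_eqF// namp_gt0.
Qed.

Lemma eigenvalueP lam : is_eigenvalue p k lam <->
  `|k| `^ p < lam /\ exists n, (0 < n)%N /\ n%:R * T lam = 1.
Proof.
split=> [[u E]|[lamk [n [n0 nT]]]].
  have lamk := eigenvalue_gt E; split => //; have [u0 [du Wu ws]] := E.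
  have [U [W [S uU]]] := regularity p1 Wu ws.
  have [[x x01 Ux]|N] := pselect (exists2 x, 0 < x < 1 & U x != 0).
    exact: (psol_quantized p1 lamk S x01 Ux).
  exfalso; apply: u0; apply: ae_imp uU => x H Ix; rewrite H//.
  apply/eqP/negPn/negP => Ux; apply: N; by exists x.
by have [u ? _] := eigenfunction_exists lamk n0 nT; exists u.
Qed.

(** With T = 1 the only nodal interval is (0, 1), where every solution is a multiple of the same
    arch. *)
Lemma simple_of_period1 lam : `|k| `^ p < lam -> T lam = 1 -> simple_eigenvalue p k lam.
Proof.
move=> lamk T1; have [|u0 E0 u0E] := eigenfunction_exists lamk (ltn0Sn 0); first by rewrite mul1r.
exists u0 => // u [_ [du Wu ws]]; have [U [W [S uU]]] := regularity p1 Wu ws.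
have [C hC] := psol_period1 p1 lamk T1 S.
exists C; apply: ae_imp uU => x H Ix; have x01 : 0 < x < 1 by move: Ix; rewrite /I01/= in_itv.
by rewrite H// hC// u0E// T1.
Qed.

(** |u(x)| is at most the L^1 norm I of u', and I^p is at most 2^p times the integral of |u'|^p. The
    constant is not sharp; (b) asks only for some positive lower bound of the quotient. *)
Lemma poincare u du : W01p p u du ->
  int01 (fun x => `|u x| `^ p) <= 2 `^ p * int01 (fun x => `|du x| `^ p).
Proof.
move=> Wu; have [[Lu Ldu _] _] := Wu; have mI := @measurable_I01 R.
have [uU _] := W01p_prim p1 Wu; have duI := Lp_L1 p1 Ldu.
set B := int01 (fun x => `|du x| `^ p); have B0 : 0 <= B by exact: int01_pow_ge0.
set I := int01 (fun x => `|du x|); have I0 : 0 <= I by exact: Rintegral_ge0.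
have IB : I `^ p <= 2 `^ p * B.
  have Ia a : 0 < a -> I <= a + a `^ (1 - p) * B by move=> a0; exact: int01_le_pow.
  move: B0; rewrite le_eqVlt => /predU1P[B0|B0].
    have -> : I = 0.
      apply/le_anti; rewrite I0 andbT; apply/ler_addgt0Pr => a a0; rewrite add0r.
      by have := Ia a a0; rewrite -B0 mulr0 addr0.
    by rewrite powR0 ?gt_eqF// mulr_ge0// ?powR_ge0// -B0.
  (* The choice a = B^(1/p) makes the two terms of the bound on I equal, hence the factor 2. *)
  have b0 : 0 < B `^ p^-1 by rewrite powR_gt0.
  have := Ia _ b0.
  have -> : (B `^ p^-1) `^ (1 - p) * B = B `^ p^-1.
    rewrite -{2}(powRr1 (ltW B0)) -powRrM -powRD ?(gt_eqF B0) ?implybT//.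
    by congr (_ `^ _); field; rewrite gt_eqF.
  have -> : B `^ p^-1 + B `^ p^-1 = 2 * B `^ p^-1 by ring.
  move=> h.
  have -> : 2 `^ p * B = (2 * B `^ p^-1) `^ p.
    by rewrite powRM ?powR_ge0// -powRrM mulVf ?gt_eqF// powRr1// ltW.
  by apply: ge0_ler_powR; rewrite ?nnegrE ?(ltW p0) ?mulr_ge0 ?powR_ge0.
apply: le_trans IB.
have <- : \int[mu]_(x in (@I01 R)) I `^ p = I `^ p by rewrite Rintegral_cst_itv// subr0 mulr1.
apply: ae_le_Rintegral => //; [exact: Lp_Int|exact: Int_cst_itv|].
apply: ae_imp uU => x H Ix; rewrite H//.
have /andP[x0 x1] : 0 < x < 1 by move: Ix; rewrite /I01/= in_itv.
apply: ge0_ler_powR; rewrite ?nnegrE ?(ltW p0)//.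
have s : `]0, x[%classic `<=` (@I01 R) by apply: subset_itvl; rewrite bnd_simp ltW.
rewrite (prim_itv _ (ltW x1)).
apply: le_trans (le_normr_Rintegral _ _) _ => //; first exact: (IntS mI _ s duI).
by apply: le_Rintegral_set => //; exact: Int_norm.
Qed.

End eigenvalues.

Theorem theorem2p1 (R : realType) (p k : R) (hp : 1 < p) :
  exists lam : nat -> R,
    (* (a); [lam n] is meaningful for n >= 1 only *)
    [/\ forall n : nat, (1 <= n)%N -> is_eigenvalue p k (lam n),
        0 < lam 1%N,
        lam 1%N < lam 2%N,
        forall n : nat, (2 <= n)%N -> lam n <= lam n.+1 &
        lam n @[n --> \oo] --> +oo] /\
    (* (b) *)
    [/\ 0 < lambda1_pLaplacian p,
        lambda1_pLaplacian p <= lam 1%N &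
        `|k| `^ p <= lam 1%N] /\
    (* (c) *)
    [/\ simple_eigenvalue p k (lam 1%N),
        isolated_eigenvalue p k (lam 1%N) &
        second_eigenvalue p k (lam 1%N) (lam 2%N)].
Proof.
have p0 : 0 < p by exact: lt_trans hp.
have inv n : (0 < n)%N -> 0 < (n%:R^-1 : R) by move=> n0; rewrite invr_gt0 ltr0n.
(* The implication leaves [lam 0] arbitrary; only the periods 1/n with n >= 1 are prescribed. *)
have [n|lam lamP] := @choice _ _ (fun n (l : R) => (0 < n)%N ->
    `|k| `^ p < l /\ period p k l = n%:R^-1).
  have [->|n0] := posnP n; first by exists 0.
  have [|l kl lT] := period_surj k hp (inv n n0); first by rewrite invf_le1 ?ler1n ?ltr0n.
  by exists l.
have lamk n (n0 : (0 < n)%N) := (lamP n n0).1.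
have lamT n (n0 : (0 < n)%N) := (lamP n n0).2.
have eig n : (0 < n)%N -> is_eigenvalue p k (lam n).
  move=> n0; apply/(eigenvalueP k hp); split; first exact: lamk.
  by exists n; split => //; rewrite lamT// divff// pnatr_eq0 -lt0n.
(* Since T decreases strictly, a period of at most 1/n forces nu to be at least [lam n]. *)
have above n nu : (0 < n)%N -> `|k| `^ p < nu -> period p k nu <= n%:R^-1 -> lam n <= nu.
  move=> n0 knu Tnu; rewrite leNgt; apply/negP => /(period_decr hp knu).
  by rewrite lamT// ltNge Tnu.
have lam_incr n m : (0 < n)%N -> (n < m)%N -> lam n < lam m.
  move=> n0 nm; have m0 := ltn_trans n0 nm.
  have nm' : (m%:R^-1 : R) < n%:R^-1 by rewrite ltf_pV2 ?posrE ?ltr0n// ltr_nat.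
  rewrite lt_neqAle above ?lamk ?lamT ?(ltW nm')// andbT.
  by apply/eqP => E; move: nm'; rewrite -!lamT// E ltxx.
have first : first_eigenvalue p k (lam 1%N).
  split; first exact: eig.
  move=> nu /(eigenvalueP k hp)[knu [n [n0 nT]]]; apply: above => //.
  by rewrite invr1 -nT ler_peMl ?ler1n// ltW// period_gt0.
have second nu : is_eigenvalue p k nu -> lam 1%N < nu -> lam 2%N <= nu.
  move=> /(eigenvalueP k hp)[knu [n [n0 nT]]] l1; apply: above => //.
  have := period_decr hp (lamk 1%N isT) l1; rewrite lamT// invr1 => T1.
  have T0 := period_gt0 hp knu.
  (* Above [lam 1] the period is less than 1, so at least two arches are needed to fill (0, 1). *)
  have n2 : (2 <= n)%N.
    rewrite ltn_neqAle n0 andbT eq_sym; apply/eqP => n1; move: T1; rewrite -nT n1 mul1r ltxx//.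
  rewrite -[X in _ <= X]mul1r ler_pdivlMr// mulrC.
  by apply: (@le_trans _ _ (n%:R * period p k nu)); [rewrite ler_wpM2r ?ler_nat// ltW|rewrite nT].
exists lam; split; [|split].
- split => //.
  + exact: le_lt_trans (powR_ge0 _ _) (lamk 1%N isT).
  + exact: lam_incr.
  + by move=> n n2; apply/ltW/lam_incr => //; exact: ltn_trans n2.
  (* [M'] is raised above |k|^p, where T is positive and decreasing; once n exceeds 1 / T(M'), the
     period 1/n of [lam n] is at most T(M'), so [lam n] is at least [M']. *)
  apply/cvgryPge => M; pose M' := Num.max M (`|k| `^ p + 1).
  have kM : `|k| `^ p < M' by rewrite lt_max ltrDl ltr01 orbT.
  have T0 := period_gt0 hp kM.
  near=> n; have n0 : (0 < n)%N by near: n; exact: nbhs_infty_gt.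
  apply: (@le_trans _ _ M'); first by rewrite le_max lexx.
  rewrite leNgt; apply/negP => /(period_decr hp (lamk n n0)).
  rewrite lamT// -[X in _ < X]mul1r ltr_pdivlMr ?ltr0n// mulrC -ltr_pdivlMr// ltNge mul1r.
  move=> /negP; apply; apply: (le_trans (ler_norm _)); apply: (le_trans (ltW (archi_boundP (normr_ge0 _)))).
  by rewrite ler_nat; near: n; exact: nbhs_infty_ge.
- have [u [u0 [du Wu ws]]] := eig 1%N isT; have [[Lu Ldu _] _] := Wu.
  have A0 := Lp_mass_gt0 Lu u0; have c0 : 0 < (2 : R) `^ p by rewrite powR_gt0.
  have lb : lbound [set q : R | exists u du : R -> R, [/\ W01p p u du, ~ ae_eq01 u (cst 0) &
      q = int01 (fun x => `|du x| `^ p) / int01 (fun x => `|u x| `^ p)]] (2 `^ p)^-1.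
    move=> q [v [dv [Wv v0 ->]]]; have [[Lv _ _] _] := Wv.
    have v1 := Lp_mass_gt0 Lv v0; rewrite (ler_pdivlMr _ _ v1) (ler_pdivrMl _ _ c0).
    exact: poincare.
  split; last exact/ltW/lamk.
  + apply: (lt_le_trans (_ : 0 < (2 `^ p)^-1)); first by rewrite invr_gt0.
    (* The eigenfunction of [lam 1] shows that the infimum runs over a nonempty set, so the lower
       bound 2^(-p) passes to it. *)
    by apply: lb_le_inf lb; eexists; exists u, du; split.
  + have q1 : int01 (fun x => `|du x| `^ p) / int01 (fun x => `|u x| `^ p) <= lam 1%N.
      rewrite ler_pdivrMr// -(energy_identity hp Wu ws).
      apply: le_Rintegral; [exact: measurable_I01|exact: Lp_Int|exact: Int_grad_norm|].
      move=> x _; apply: ge0_ler_powR; rewrite ?nnegrE ?(ltW p0) ?gradn_ge0//.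
      exact: le_gradn_snd.
    apply: le_trans q1; apply: ge_inf; first by exists (2 `^ p)^-1.
    by exists u, du; split.
- split.
  + by apply: simple_of_period1 => //; [exact: lamk|rewrite lamT// invr1].
  + split; first exact: eig.
    have l12 : lam 1%N < lam 2%N by exact: lam_incr.
    (* Every nu below [lam 2] is close enough: an eigenvalue there cannot exceed [lam 1]. *)
    near=> nu => En; apply/le_anti; rewrite first.2// andbT leNgt; apply/negP => /(second _ En).
    by rewrite leNgt => /negP; apply; near: nu; exact: lt_nbhsl.
  + by split => //; [exact: eig|exact: lam_incr].
Unshelve. all: by end_near. Qed.
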